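(* A subset $B\subset\mathcal{S}'^{\ast}_{\dagger}(\mathbb{R}^n)$ is bounded if and only if there exists $(\ell_p)\in\mathfrak{R}^{\ast}$ such that $$\sup_{f\in B,\ x\in\mathbb{R}^n}e^{-N_{\ell_p}(|x|)}\left|(f*\psi)(x)\right|<\infty,\qquad\forall\psi\in\mathcal{D}^{\ast}(\mathbb{R}^n).$$
   Context: Weight sequences. $\mathbb{N}=\{0,1,2,\dots\}$. For a sequence $(M_p)_{p\in\mathbb{N}}$ of positive reals put $m_p=M_p/M_{p-1}$ ($p\ge1$), $M_p^{*}=M_p/p!$, and $M_\alpha=M_{|\alpha|}$ for $\alpha\in\mathbb{N}^n$ (the same convention is used for all sequences indexed by $p$). Conditions: $(M.1)$: $M_p^2\le M_{p-1}M_{p+1}$, $p\ge1$; $(M.1)^{*}$: $(M_p^{*})^2\le M_{p-1}^{*}M_{p+1}^{*}$, $p\ge1$; $(M.2)'$: $M_{p+1}\le AH^pM_p$, $p\in\mathbb{N}$, for some $A,H\ge1$; $(M.2)$: $M_{p+q}\le AH^{p+q}M_pM_q$, $p,q\in\mathbb{N}$, for some $A,H\ge1$; $(M.3)'$: $\sum_{p\ge1}1/m_p<\infty$; $(NA)$ for $N_p$: for every $h>0$ there is $L_h>0$ with $p!\le L_hh^pN_p$ for all $p$. Standing assumptions: $M_p$ satisfies $(M.1)$, $(M.2)'$, $(M.3)'$; $N_p$ satisfies $(M.1)^{*}$ and $(M.2)$; in the Beurling case $N_p$ also satisfies $(NA)$. Beurling/Roumieu notation. Either $\ast=(M_p)$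 and $\dagger=(N_p)$ (Beurling case), or $\ast=\{M_p\}$ and $\dagger=\{N_p\}$ (Roumieu case). $\mathfrak{R}^{(M_p)}$ is the set of constant sequences $(\ell_p)_{p\ge1}$, $\ell_p=\ell>0$; $\mathfrak{R}^{\{M_p\}}$ is the set of sequences $(\ell_p)_{p\ge1}$ of positive reals that increase (non-strictly) to $\infty$; $\mathfrak{R}^{\ast}$ denotes the one corresponding to the case considered. For $(\ell_p)\in\mathfrak{R}^{\ast}$ put $L_p=\prod_{j=1}^p\ell_j$, $L_0=1$, and let $N_{\ell_p}(t)=\sup_{p\in\mathbb{N}}\log\frac{t^pN_0}{L_pN_p}$ for $t>0$, $N_{\ell_p}(0)=0$ (the associated function of $N_pL_p$). Spaces. For $(a_p),(b_p)\in\mathfrak{R}^{\ast}$, with $A_p=\prod_{j\le p}a_j$, $B_p=\prod_{j\le p}b_j$, let $\mathcal{S}^{M_p,(a_p)}_{N_p,(b_p)}(\mathbb{R}^n)$ be the Banach space of $\varphi\in C^\infty(\mathbb{R}^n)$ with $\|\varphi\|_{(a_p),(b_p)}=\sup_{\alpha,\beta\in\mathbb{N}^n}\sup_{t\in\mathbb{R}^n}\frac{|t^\beta\varphi^{(\alpha)}(t)|}{A_\alpha M_\alpha B_\beta N_\beta}<\infty$. Then $\mathcal{S}^{\ast}_{\dagger}(\mathbb{R}^n)=\varprojlim_{(a_p),(b_p)\in\mathfrak{R}^{\ast}}\mathcal{S}^{M_p,(a_p)}_{N_p,(b_p)}(\mathbb{R}^n)$, with (strong) dual $\mathcal{S}'^{\ast}_{\dagger}(\mathbb{R}^n)$.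 $\mathcal{D}^{\ast}(\mathbb{R}^n)$ is the subspace of compactly supported elements of $\mathcal{S}^{\ast}_{\dagger}(\mathbb{R}^n)$. Convolution: $(f*\psi)(x)=\langle f(t),\psi(x-t)\rangle$. *)

(* Defs.v *)
From HB Require Import structures.
From mathcomp Require Import all_boot all_order all_algebra.
From mathcomp Require Import all_classical all_reals all_analysis.
From mathcomp Require Export complex.

Set Implicit Arguments.
Unset Strict Implicit.
Unset Printing Implicit Defensive.

Import Order.TTheory GRing.Theory Num.Theory.
Import numFieldNormedType.Exports.

Local Open Scope classical_set_scope.
Local Open Scope ring_scope.

Section WeightSequences.
Variable R : realType.
Implicit Types M N : nat -> R.

Definition star M : nat -> R := fun p => M p / (p`!)%:R.

Definition log_convex M :=
  forall p, (1 <= p)%N -> M p ^+ 2 <= M p.-1 * M p.+1.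

Definition cond_M1 M := log_convex M.

Definition cond_M1star M := log_convex (star M).

Definition cond_M2' M := exists A H : R,
  [/\ 1 <= A, 1 <= H & forall p, M p.+1 <= A * H ^+ p * M p].

Definition cond_M2 M := exists A H : R,
  [/\ 1 <= A, 1 <= H & forall p q, M (p + q)%N <= A * H ^+ (p + q) * M p * M q].

(* [M p / M p.-1] is the quotient m_p, for p >= 1 *)
Definition cond_M3' M :=
  (\sum_(1 <= p <oo) ((M p / M p.-1)^-1)%:E < +oo)%E.

Definition cond_NA N := forall h : R, 0 < h ->
  exists2 L : R, 0 < L & forall p, (p`!)%:R <= L * h ^+ p * N p.

End WeightSequences.

Variant ucase := Beurling | Roumieu.

Definition standing (R : realType) (c : ucase) (M N : nat -> R) : Prop :=
  [/\ forall p, 0 < M p,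
      forall p, 0 < N p,
      [/\ cond_M1 M, cond_M2' M & cond_M3' M],
      cond_M1star N /\ cond_M2 N
    & c = Beurling -> cond_NA N].

(* The sequences are (l_p)_{p >= 1}: the value l 0 is never used. *)
Definition Rset (R : realType) (c : ucase) : set (nat -> R) :=
  match c with
  | Beurling => [set l | exists2 k : R, 0 < k & forall p, (1 <= p)%N -> l p = k]
  | Roumieu => [set l | [/\ forall p, (1 <= p)%N -> 0 < l p,
                            forall p, (1 <= p)%N -> l p <= l p.+1
                          & l p @[p --> \oo] --> +oo]]
  end.

Definition cumprod (R : realType) (l : nat -> R) (p : nat) : R :=
  \prod_(1 <= j < p.+1) l j.

Definition assoc_fun (R : realType) (N l : nat -> R) (t : R) : \bar R :=
  if t == 0 then 0%E
  else ereal_sup [set (ln (t ^+ p * N 0 / (cumprod l p * N p)))%:E | p in setT].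

Section Smooth.
Variables (R : realType) (n : nat).
Implicit Types (h : 'rV[R]_n -> R) (phi : 'rV[R]_n -> R[i])
  (alpha beta : {ffun 'I_n -> nat}).

Definition partial (i : 'I_n) h : 'rV[R]_n -> R := 'D_(delta_mx 0 i) h.

Definition smooth h := forall s : seq 'I_n,
  continuous (foldr partial h s) /\
  forall i x, derivable (foldr partial h s) x (delta_mx 0 i).

Definition csmooth phi :=
  smooth (fun x => complex.Re (phi x)) /\ smooth (fun x => complex.Im (phi x)).

Definition mabs alpha : nat := \sum_(i < n) alpha i.

Definition mpow (t : 'rV[R]_n) beta : R := \prod_(i < n) t 0 i ^+ beta i.

Definition mderiv alpha h : 'rV[R]_n -> R :=
  foldr (fun i => iter (alpha i) (partial i)) h (enum 'I_n).

Definition cderiv alpha phi : 'rV[R]_n -> R[i] := fun x =>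
  (mderiv alpha (fun y => complex.Re (phi y)) x
     +i* mderiv alpha (fun y => complex.Im (phi y)) x)%C.

(* The norm of the library on ['rV[R]_n] is the sup norm. *)
Definition euclid (x : 'rV[R]_n) : R := Num.sqrt (\sum_(i < n) x 0 i ^+ 2).

End Smooth.

(* The norm of [R[i]] takes its values in [R[i]]. *)
Definition cabs (R : realType) (z : R[i]) : R := complex.Re `|z|.

Section Spaces.
Variables (R : realType) (n : nat) (c : ucase) (M N : nat -> R).
Implicit Types (a b l : nat -> R) (phi psi : 'rV[R]_n -> R[i])
  (K : set ('rV[R]_n -> R[i])) (f : ('rV[R]_n -> R[i]) -> R[i])
  (B : set (('rV[R]_n -> R[i]) -> R[i])).

Definition Snorm a b phi : \bar R :=
  ereal_sup [set y | exists (alpha beta : {ffun 'I_n -> nat}) (t : 'rV[R]_n),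
    y = (cabs ((mpow t beta)%:C%C * cderiv alpha phi t)
         / (cumprod a (mabs alpha) * M (mabs alpha)
            * cumprod b (mabs beta) * N (mabs beta)))%:E].

Definition SBanach a b : set ('rV[R]_n -> R[i]) :=
  [set phi | csmooth phi /\ (Snorm a b phi < +oo)%E].

Definition Sspace : set ('rV[R]_n -> R[i]) :=
  [set phi | forall a b, Rset c a -> Rset c b -> SBanach a b phi].

Definition Dspace : set ('rV[R]_n -> R[i]) :=
  Sspace `&` [set phi | compact (closure [set x | phi x != 0])].

(* Neighbourhoods of phi in the projective limit topology, i.e. the initial
   topology for the inclusions of [Sspace] in the spaces [SBanach a b]. *)
Definition Snbhs phi : set_system ('rV[R]_n -> R[i]) :=
  [set U | exists (k : nat) (a b : 'I_k -> nat -> R) (e : R),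
    [/\ forall j, Rset c (a j) /\ Rset c (b j), 0 < e &
        forall psi, Sspace psi ->
          (forall j, (Snorm (a j) (b j) (fun t => (psi t - phi t)%R) < e%:E)%E) -> U psi]].

(* An element of the dual is represented by a map on all functions, of which
   only the restriction to [Sspace] is constrained. *)
Definition dual : set (('rV[R]_n -> R[i]) -> R[i]) :=
  [set f |
    (forall (z : R[i]) phi psi, Sspace phi -> Sspace psi ->
       f (fun x => z * phi x + psi x) = z * f phi + f psi) /\
    (forall phi, Sspace phi -> forall e : R, 0 < e ->
       Snbhs phi [set psi | cabs (f psi - f phi) < e])].

Definition Sbounded K := K `<=` Sspace /\
  forall a b, Rset c a -> Rset c b ->
    (ereal_sup [set Snorm a b phi | phi in K] < +oo)%E.

(* The seminorms of the strong topology of the dual, for [K] bounded. *)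
Definition dual_seminorm K f : \bar R :=
  ereal_sup [set (cabs (f phi))%:E | phi in K].

Definition dual_bounded B := forall K, Sbounded K ->
  (ereal_sup [set dual_seminorm K f | f in B] < +oo)%E.

Definition convolution f psi : 'rV[R]_n -> R[i] := fun x => f (fun t => psi (x - t)).

End Spaces.

(* Main.v *)
Require Import Defs.
From mathcomp Require Import all_boot all_order all_algebra.
From mathcomp Require Import all_classical all_reals all_analysis.
From mathcomp Require Import ring lra zify.

Set Implicit Arguments.
Unset Strict Implicit.
Unset Printing Implicit Defensive.

Import Order.TTheory GRing.Theory Num.Theory.
Import numFieldNormedType.Exports.

Local Open Scope classical_set_scope.
Local Open Scope ring_scope.

(** Write [W_l t] for the exponential of the associated function,
    [W_l t = sup_p t^p N_0 / (L_p N_p)], which is finite by (M.1)*. The condition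
    on [B] then reads [|f * psi (x)| <= C W_l |x|] for [f] in [B] and all [x],
    with [C] depending on [psi].

    The condition suffices. By (M.3)' there is a smooth step from [0] to [1]
    whose derivatives are bounded by [C_h h^p M_p] for every [h]: it is a limit
    of averages of a Heaviside function over intervals of summable lengths
    ([exists_ultradifferentiable_step]). Differences of translates of it, and
    products over the coordinates, give a partition of unity on the grid of
    integer points, made of translates of one compactly supported function
    ([sum_pieces]). If [phi] is in the test space, [f phi] is the sum over the
    grid points [k] of the values of [f] on the pieces of [phi], and the value on
    the piece at [k] is [f * psi_k (k)], where [psi_k] is the piece moved to the
    origin and reflected ([dual_le_local_sums]). All the [psi_k] live in a fixed
    ball. A gliding hump ([gliding_hump], [uniform_convolution_bound]) turns the
    hypothesis into a bound [|f * psi (x)| <= C W_l |x|] which is uniform over the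
    [psi] supported in that ball and with derivatives bounded by [h^p M_p]. As
    [phi] decays faster than [1 / W_l] ([decay_at_center], which uses (M.2)), the
    sizes of the [psi_k] times [W_l |k|] are summable, and the sum is bounded
    uniformly for [phi] in a bounded set.

    The condition is necessary. In the Beurling case a bounded set [B] of
    functionals is uniformly bounded on the ball of one of the Banach spaces, by
    a diagonal argument ([Beurling_equicontinuity]); applied to the translates
    of [psi], whose norms grow like the associated function
    ([cdecays_reflection]), this yields the constant sequence [l]. In the
    Roumieu case, the balls for the constant sequences [h] are bounded sets
    ([Roumieu_ball_bounded]), so that the functionals are bounded on each of them
    by some [D_h]; and [psi] belongs to the class of some constant [h0]
    ([test_function_power]). Hence [|f * psi (x)|] is at most a constant times
    the infimum of [D_h W_h (2 |x|)] over [h >= h0]; a sequence [l] tending to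
    infinity slowly enough, chosen from the [D_h] only, makes [W_l] larger than
    all these infima up to constants ([Roumieu_weight]).

    Real and imaginary parts are treated as real functions, and iterated partial
    derivatives are indexed by lists of coordinates; by Schwarz' theorem they are
    those of the multi-indices ([pd_perm]). *)

(** * Directional derivatives and their limits *)

Lemma le_of_eq (R : realType) (x y : R) : x = y -> x <= y.
Proof. by move=> ->. Qed.

Section DirectionalDerivatives.
Variables (R : realType) (V : normedModType R).
Implicit Types (f g : V -> R) (x v : V).

(** The estimate [o(t)] along the direction, which spares computing with
    difference quotients. *)
Lemma is_derive_epsP f x v (d : R) :
  is_derive x v f d <-> forall e : R, 0 < e -> exists2 k : R, 0 < k &
    forall t : R, `|t| < k -> `|f (x + t *: v) - f x - t * d| <= e * `|t|.
Proof.
have quotE (t : R) : t != 0 ->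
    `|d - t^-1 *: (f (t *: v + x) - f x)| = `|f (x + t *: v) - f x - t * d| / `|t|.
  move=> t0; rewrite -normfV -normrM -normrN; congr `|_|.
  by rewrite addrC [t *: v + x]addrC /GRing.scale /=; field.
split=> [[cf df] e e0 | H].
  have /cvgrPdist_lt /(_ e e0) : (fun h : R => h^-1 *: ((f \o shift x) (h *: v) - f x)) @ 0^' --> d.
    by rewrite -df.
  move=> /nbhs_ballP[k /= k0 kP]; exists k => // t tk.
  have [->|t0] := eqVneq t 0.
    by rewrite scale0r addr0 subrr mul0r subrr !normr0 mulr0.
  have /kP /(_ t0) : ball (0 : R) k t by rewrite /ball /= sub0r normrN.
  by rewrite quotE // ltr_pdivrMr ?normr_gt0 // => /ltW.
suff cf : (fun h : R => h^-1 *: ((f \o shift x) (h *: v) - f x)) @ 0^' --> d.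
  split; first by apply/cvg_ex; exists d.
  exact: cvg_lim.
apply/cvgrPdist_le => e e0; have [k k0 kP] := H e e0.
apply/nbhs_ballP; exists k => //= t; rewrite /ball /= sub0r normrN => tk t0.
by rewrite quotE // ler_pdivrMr ?normr_gt0 // kP.
Qed.

End DirectionalDerivatives.

Section LinesAndLimits.
Variables (R : realType) (V : normedModType R).
Implicit Types (f g : V -> R) (x v : V).

Lemma is_derive_line f x v (d t : R) :
  is_derive (x + t *: v) v f d <-> is_derive t (1 : R) (fun s => f (x + s *: v)) d.
Proof.
have E (s : R) : x + (t + s *: 1) *: v = x + t *: v + s *: v.
  by rewrite [s *: 1]mulr1 scalerDl addrA.
split=> /is_derive_epsP H; apply/is_derive_epsP => e e0; have [k k0 kP] := H e e0;
  by exists k => // s sk; have := kP s sk; rewrite /= E.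
Qed.

Lemma line_MVT f x v (df : R -> R) :
  (forall t, is_derive (x + t *: v) v f (df t)) -> forall t,
  exists2 c : R, `|c| <= `|t| & f (x + t *: v) - f x = t * df c.
Proof.
move=> H t; set g := fun s : R => f (x + s *: v).
have dg s : is_derive s (1 : R) g (df s) by apply/is_derive_line.
have cg (a b : R) : {within `[a, b], continuous g}.
  apply: continuous_subspaceT => s.
  by apply: differentiable_continuous; apply/derivable1_diffP; case: (dg s).
have g0 : g 0 = f x by rewrite /g scale0r addr0.
have [t0|t0] := leP 0 t.
  have [c] := @MVT_segment R g df 0 t t0 (fun s _ => dg s) (cg 0 t).
  rewrite in_itv /= => /andP[c0 ct] E; exists c; first by rewrite !ger0_norm.
  by rewrite -g0 -/(g t) E subr0 mulrC.
have [c] := @MVT_segment R g df t 0 (ltW t0) (fun s _ => dg s) (cg t 0).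
rewrite in_itv /= => /andP[c0 ct] E; exists c.
  by rewrite !ler0_norm ?lerN2 // ltW.
by rewrite -g0 -/(g t) -opprB E sub0r mulrN opprK mulrC.
Qed.

Lemma le_of_forall_eps (a b : R) : (forall e : R, 0 < e -> a <= b + e) -> a <= b.
Proof. by move=> H; apply/ler_addgt0Pl => e e0; rewrite addrC; exact: H. Qed.

(** Only the derivatives are assumed to converge uniformly: by the mean value
    theorem, they control the increments of [h m - h m0], uniformly in [m]. *)
Lemma is_derive_lim (h dh : nat -> V -> R) f (df : V -> R) v (eps : nat -> R) :
  (forall m x, is_derive x v (h m) (dh m x)) ->
  (forall x, (fun m => h m x) @ \oo --> f x) ->
  (eps @ \oo --> 0) ->
  (forall m x, `|dh m x - df x| <= eps m) ->
  forall x, is_derive x v f (df x).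
Proof.
move=> Hh Hf He Hd x; apply/is_derive_epsP => e e0.
have e4 : 0 < e / 4 by rewrite divr_gt0.
have /cvgrPdist_lt /(_ _ e4) [m0 _ m0P] := He.
have epsm m : (m0 <= m)%N -> eps m <= e / 4.
  by move=> /m0P /=; rewrite sub0r normrN => /ltW; apply: le_trans; exact: ler_norm.
have /is_derive_epsP /(_ _ e4) [k k0 kP] := Hh m0 x.
exists k => // t tk.
(* the error of [h m0] controls that of its tail, by the mean value theorem *)
have tail : `|(f (x + t *: v) - f x) - (h m0 (x + t *: v) - h m0 x)| <= e / 2 * `|t|.
  apply: le_of_forall_eps => d d0.
  have d2 : 0 < d / 2 by rewrite divr_gt0.
  have /cvgrPdist_lt /(_ _ d2) [m1 _ m1P] := Hf (x + t *: v).
  have /cvgrPdist_lt /(_ _ d2) [m2 _ m2P] := Hf x.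
  pose m := maxn m0 (maxn m1 m2).
  have [c _ E] := @line_MVT (h m - h m0) x v
    (fun s => dh m (x + s *: v) - dh m0 (x + s *: v))
    (fun s => is_deriveB (Hh m (x + s *: v)) (Hh m0 (x + s *: v))) t.
  have {}E : h m (x + t *: v) - h m0 (x + t *: v) - (h m x - h m0 x) =
    t * (dh m (x + c *: v) - dh m0 (x + c *: v)) by exact: E.
  have a1 := m1P m (leq_trans (leq_maxl _ _) (leq_maxr _ _)).
  have a2 := m2P m (leq_trans (leq_maxr _ _) (leq_maxr _ _)).
  rewrite /= in a1 a2.
  have b1 := Hd m (x + c *: v).
  have b2 := Hd m0 (x + c *: v).
  have b3 := epsm m (leq_maxl _ _).
  have b4 := epsm m0 (leqnn _).
  have : `|t * (dh m (x + c *: v) - dh m0 (x + c *: v))| <= e / 2 * `|t|.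
    rewrite normrM mulrC ler_wpM2r //.
    have := ler_normB (dh m (x + c *: v) - df (x + c *: v))
                      (dh m0 (x + c *: v) - df (x + c *: v)).
    rewrite opprB addrA subrK => /le_trans; apply; lra.
  rewrite -E => F.
  have -> : f (x + t *: v) - f x - (h m0 (x + t *: v) - h m0 x) =
    (f (x + t *: v) - h m (x + t *: v)) - (f x - h m x) +
    (h m (x + t *: v) - h m0 (x + t *: v) - (h m x - h m0 x)) by ring.
  apply: le_trans (ler_normD _ _) _.
  have := ler_normB (f (x + t *: v) - h m (x + t *: v)) (f x - h m x).
  lra.
have A := kP t tk.
have B : `|t * (dh m0 x - df x)| <= e / 4 * `|t|.
  by rewrite normrM mulrC ler_wpM2r // (le_trans (Hd _ _)) // epsm.
have -> : f (x + t *: v) - f x - t * df x =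
  ((f (x + t *: v) - f x) - (h m0 (x + t *: v) - h m0 x)) +
  (h m0 (x + t *: v) - h m0 x - t * dh m0 x) + t * (dh m0 x - df x) by ring.
apply: le_trans (ler_normD _ _) _.
have := ler_normD (f (x + t *: v) - f x - (h m0 (x + t *: v) - h m0 x))
  (h m0 (x + t *: v) - h m0 x - t * dh m0 x).
lra.
Qed.

Lemma continuous_lim (h : nat -> V -> R) f (eps : nat -> R) :
  (forall m, continuous (h m)) -> (eps @ \oo --> 0) ->
  (forall m x, `|h m x - f x| <= eps m) -> continuous f.
Proof.
move=> Hc He Hd x; apply/cvgrPdist_le => e e0.
have e3 : 0 < e / 3 by rewrite divr_gt0.
have /cvgrPdist_lt /(_ _ e3) [m _ /(_ _ (leqnn _)) /=] := He.
rewrite sub0r normrN => em.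
have {}em : eps m < e / 3 by apply: le_lt_trans em; exact: ler_norm.
have /cvgrPdist_lt /(_ _ e3) := Hc m x; apply: filterS => y Hy.
have -> : f x - f y = - (h m x - f x) + (h m x - h m y) + (h m y - f y) by ring.
apply: le_trans (ler_normD _ _) _.
apply: le_trans (lerD (ler_normD _ _) (lexx _)) _.
rewrite normrN; have := Hd m x; have := Hd m y; lra.
Qed.

End LinesAndLimits.

Section IteratedPartials.
Variables (R : realType) (n : nat).
Implicit Types (g h : 'rV[R]_n -> R) (s : seq 'I_n) (i j : 'I_n) (x : 'rV[R]_n).

Definition pd s g : 'rV[R]_n -> R := foldr (@partial R n) g s.

Local Notation e_ i := (delta_mx (0 : 'I_1) i : 'rV[R]_n).

Lemma smooth_continuous g s : smooth g -> continuous (pd s g).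
Proof. by move=> /(_ s)[]. Qed.

Lemma smooth_is_derive g s i x : smooth g ->
  is_derive x (e_ i) (pd s g) (pd (i :: s) g x).
Proof. by move=> /(_ s)[_ H]; split; first exact: H. Qed.

(** The way all smoothness proofs below are organized: exhibit at once a
    candidate for every iterated partial derivative, and check one
    differentiation step. *)
Lemma smooth_family (F : seq 'I_n -> 'rV[R]_n -> R) :
  (forall s, continuous (F s)) ->
  (forall s i x, is_derive x (e_ i) (F s) (F (i :: s) x)) ->
  smooth (F [::]) /\ forall s, pd s (F [::]) = F s.
Proof.
move=> Fc Fd.
have E s : pd s (F [::]) = F s.
  elim: s => [//|i s IH]; rewrite /pd /= -/(pd s _) IH.
  by apply/funext => x; rewrite /partial; exact: (@derive_val _ _ _ _ _ _ _ (Fd s i x)).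
split=> // s; rewrite -/(pd s _) E; split=> [//|i x].
exact: (@ex_derive _ _ _ _ _ _ _ (Fd s i x)).
Qed.

End IteratedPartials.

(** * Smooth functions and the Leibniz rule *)

Section FiniteOperations.
Variables (R : realType) (V : normedModType R).
Implicit Types (f g : V -> R) (x v : V).

Lemma continuous_addf f g : continuous f -> continuous g -> continuous (fun x => f x + g x).
Proof. by move=> cf cg x; exact: (continuousD (cf x) (cg x)). Qed.

Lemma continuous_mulf f g : continuous f -> continuous g -> continuous (fun x => f x * g x).
Proof. by move=> cf cg x; exact: (continuousM (cf x) (cg x)). Qed.

Lemma continuous_scalef (a : R) f : continuous f -> continuous (fun x => a * f x).
Proof. by apply: continuous_mulf; exact: cst_continuous. Qed.

Lemma is_derive_bigsum (I : Type) (r : seq I) (F dF : I -> V -> R) x v :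
  (forall i, is_derive x v (F i) (dF i x)) ->
  is_derive x v (fun y => \sum_(i <- r) F i y) (\sum_(i <- r) dF i x).
Proof.
move=> H; elim: r => [|i r IH].
  have -> : (fun y => \sum_(i <- [::]) F i y) = cst 0.
    by apply/funext => y; rewrite big_nil.
  by rewrite big_nil; exact: is_derive_cst.
have -> : (fun y => \sum_(j <- i :: r) F j y) = F i + (fun y => \sum_(j <- r) F j y).
  by apply/funext => y; rewrite big_cons.
by rewrite big_cons; exact: is_deriveD.
Qed.

Lemma continuous_bigsum (I : Type) (r : seq I) (F : I -> V -> R) :
  (forall i, continuous (F i)) -> continuous (fun y => \sum_(i <- r) F i y).
Proof.
move=> H; elim: r => [|i r IH].
  have -> : (fun y => \sum_(i <- [::]) F i y) = cst 0.
    by apply/funext => y; rewrite big_nil.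
  exact: cst_continuous.
have -> : (fun y => \sum_(j <- i :: r) F j y) = F i + (fun y => \sum_(j <- r) F j y).
  by apply/funext => y; rewrite big_cons.
by move=> x; apply: continuousD; [exact: H|exact: IH].
Qed.

Lemma is_derive_affine f x0 (c : R) x v (d : R) :
  is_derive (x0 + c *: x) v f d ->
  is_derive x v (fun t => f (x0 + c *: t)) (c * d).
Proof.
move=> H; apply/is_derive_epsP => e e0.
have c1 : 0 < `|c| + 1 by rewrite ltr_wpDl.
have e1 : 0 < e / (`|c| + 1) by rewrite divr_gt0.
have /is_derive_epsP /(_ _ e1) [k k0 kP] := H.
exists (k / (`|c| + 1)); first by rewrite divr_gt0.
move=> t tk; have ck : `|t * c| < k.
  rewrite normrM; apply: le_lt_trans (_ : `|t| * (`|c| + 1) < k); last first.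
    by rewrite -ltr_pdivlMr.
  by rewrite ler_wpM2l // lerDl.
have := kP _ ck; rewrite scalerDr scalerA [c * t]mulrC addrA mulrA.
move=> /le_trans; apply; rewrite normrM -mulrA ler_wpM2l ?(ltW e0) //.
rewrite mulrC -mulrA ler_piMr // ler_pdivrMr // mul1r lerDl //.
Qed.

End FiniteOperations.

Section SmoothOperations.
Variables (R : realType) (n : nat).
Implicit Types (g h : 'rV[R]_n -> R) (s : seq 'I_n) (i j : 'I_n) (x : 'rV[R]_n).

Local Notation e_ i := (delta_mx (0 : 'I_1) i : 'rV[R]_n).

Lemma smooth_lincomb (a b : R) g h : smooth g -> smooth h ->
  smooth (fun x => a * g x + b * h x) /\
  forall s, pd s (fun x => a * g x + b * h x) =
            fun x => a * pd s g x + b * pd s h x.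
Proof.
move=> sg sh.
apply: (@smooth_family _ _ (fun s x => a * pd s g x + b * pd s h x)) => [s|s i x].
  by apply: continuous_addf; apply: continuous_scalef; exact: smooth_continuous.
apply: is_deriveD.
  exact: (@is_deriveZ _ _ _ _ a _ _ _ (smooth_is_derive s i x sg)).
exact: (@is_deriveZ _ _ _ _ b _ _ _ (smooth_is_derive s i x sh)).
Qed.

Lemma smooth_cst (a : R) : smooth (fun _ : 'rV[R]_n => a) /\
  forall s, pd s (fun _ : 'rV[R]_n => a) = fun=> if s is [::] then a else 0.
Proof.
pose F (s : seq 'I_n) (_ : 'rV[R]_n) := if s is [::] then a else 0.
have Fc s : continuous (F s) by exact: cst_continuous.
exact: (smooth_family Fc (fun s i x => is_derive_cst _ _ _)).
Qed.

Lemma smooth_affine g x0 (c : R) : smooth g ->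
  smooth (fun t => g (x0 + c *: t)) /\
  forall s, pd s (fun t => g (x0 + c *: t)) =
            fun t => c ^+ size s * pd s g (x0 + c *: t).
Proof.
move=> sg.
have E0 : (fun t => g (x0 + c *: t)) =
    fun t => c ^+ size (Nil 'I_n) * pd [::] g (x0 + c *: t).
  by apply/funext => t; rewrite expr0 mul1r.
rewrite {1 2}E0.
apply: (@smooth_family _ _ (fun s t => c ^+ size s * pd s g (x0 + c *: t)))
    => [s|s i x].
  apply: continuous_scalef => x.
  have cA : {for x, continuous (fun t : 'rV[R]_n => x0 + c *: t)}.
    by apply: continuousD; [exact: cst_continuous|exact: scaler_continuous].
  exact: (continuous_comp cA (@smooth_continuous _ _ _ s sg (x0 + c *: x))).
rewrite (_ : c ^+ size (i :: s) * _ =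
    c ^+ size s *: (c * pd (i :: s) g (x0 + c *: x))); last first.
  by rewrite /= exprSr -mulrA.
apply: (@is_deriveZ _ _ _ (fun t => pd s g (x0 + c *: t)) (c ^+ size s)).
exact: is_derive_affine (smooth_is_derive s i (x0 + c *: x) sg).
Qed.

(** Listed with repetitions, so that Leibniz' rule has no binomial coefficients. *)
Fixpoint splits (I : Type) (s : seq I) : seq (seq I * seq I) :=
  if s is i :: s' then
    [seq (i :: p.1, p.2) | p <- splits s'] ++ [seq (p.1, i :: p.2) | p <- splits s']
  else [:: ([::], [::])].

Lemma size_splits (I : Type) (s : seq I) : size (splits s) = (2 ^ size s)%N.
Proof. by elim: s => //= i s IH; rewrite size_cat !size_map IH expnS mul2n addnn. Qed.

Lemma mem_splits (I : eqType) (s : seq I) p :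
  p \in splits s -> (size p.1 + size p.2)%N = size s.
Proof.
elim: s p => [|i s IH] p /=; first by rewrite inE => /eqP ->.
by rewrite mem_cat => /orP[] /mapP[q /IH E ->] /=; rewrite ?addSn ?addnS E.
Qed.

Lemma smooth_mul g h : smooth g -> smooth h ->
  smooth (fun x => g x * h x) /\
  forall s, pd s (fun x => g x * h x) =
            fun x => \sum_(p <- splits s) pd p.1 g x * pd p.2 h x.
Proof.
move=> sg sh.
pose F s x : R := \sum_(p <- splits s) pd p.1 g x * pd p.2 h x.
have E0 : (fun x => g x * h x) = F [::].
  by apply/funext => x; rewrite /F big_cons big_nil addr0.
rewrite {1 2}E0; apply: smooth_family => [s|s i x].
  apply: continuous_bigsum => p.
  by apply: continuous_mulf; exact: smooth_continuous.
have -> : F (i :: s) x = \sum_(p <- splits s)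
    (pd p.1 g x * pd (i :: p.2) h x + pd p.2 h x * pd (i :: p.1) g x).
  rewrite /F /= big_cat /= !big_map -big_split /=; apply: eq_bigr => p _.
  by rewrite addrC; congr (_ + _); rewrite mulrC.
apply: (@is_derive_bigsum _ _ _ _ (fun p x => pd p.1 g x * pd p.2 h x)
  (fun p x => pd p.1 g x * pd (i :: p.2) h x + pd p.2 h x * pd (i :: p.1) g x)) => p.
exact: (is_deriveM (smooth_is_derive p.1 i x sg) (smooth_is_derive p.2 i x sh)).
Qed.

(** There are [2 ^ size s] terms in Leibniz' rule, and supermultiplicativity of
    the weight bounds each of them by the same quantity. *)
Lemma leibniz_bound g h (w : nat -> R) (K C1 C2 : R) x s :
  smooth g -> smooth h -> 0 <= C1 -> 0 <= C2 ->
  (forall p q, w p * w q <= K * w (p + q)%N) ->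
  (forall s', `|pd s' g x| <= C1 * w (size s')) ->
  (forall s', `|pd s' h x| <= C2 * w (size s')) ->
  `|pd s (fun y => g y * h y) x| <= C1 * C2 * K * (2 ^+ size s * w (size s)).
Proof.
move=> sg sh C10 C20 wM bg bh; have [_ ->] := smooth_mul sg sh.
apply: le_trans (ler_norm_sum _ _ _) _.
have -> : C1 * C2 * K * (2 ^+ size s * w (size s)) =
    \sum_(p <- splits s) C1 * C2 * (K * w (size s)).
  by rewrite big_const_seq count_predT size_splits iter_addr_0 -[RHS]mulr_natl natrX; ring.
rewrite big_seq [leRHS]big_seq; apply: ler_sum => p /mem_splits <-.
rewrite normrM; apply: le_trans (ler_pM _ _ (bg p.1) (bh p.2)) _ => //.
by rewrite mulrACA ler_wpM2l // mulr_ge0.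
Qed.

End SmoothOperations.

(** * Symmetry of mixed partial derivatives *)

Section MixedPartials.
Variables (R : realType) (n : nat).
Implicit Types (g h : 'rV[R]_n -> R) (s : seq 'I_n) (i j : 'I_n) (x : 'rV[R]_n).

Local Notation e_ i := (delta_mx (0 : 'I_1) i : 'rV[R]_n).

Lemma rV_normP x (r : R) : 0 <= r -> (forall i, `|x 0 i| <= r) -> `|x| <= r.
Proof.
move=> r0 H; have [/eqP|x0] := boolP (`|x| == 0); first by move=> ->.
have /mx_norm_neq0 [[k i] /= E] : mx_norm x != 0 by [].
by have := H i; rewrite [k]ord1 in E; rewrite -E.
Qed.

Lemma rV_norm_coord x i : `|x 0 i| <= `|x|.
Proof.
rewrite [leRHS]mx_normrE.
exact: (@le_bigmax _ _ _ 0 (fun k : 'I_1 * 'I_n => `|x k.1 k.2|) (0, i)).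
Qed.

Lemma rV_norm_witness x : `|x| != 0 -> exists i, `|x| = `|x 0 i|.
Proof.
move=> x0; have /mx_norm_neq0 [[k i] /= E] : mx_norm x != 0 by [].
by exists i; rewrite [k]ord1 in E.
Qed.

Lemma norm_delta i : `|e_ i| <= 1.
Proof.
apply: rV_normP => // j; rewrite mxE /=.
by case: (_ == _); rewrite /= ?normr0 ?normr1 ?ler01 ?lexx.
Qed.

Lemma pd_cat s1 s2 g : pd (s1 ++ s2) g = pd s1 (pd s2 g).
Proof. exact: foldr_cat. Qed.

Lemma smooth_pd s g : smooth g -> smooth (pd s g).
Proof. by move=> sg r; have := sg (r ++ s); rewrite foldr_cat. Qed.

Lemma is_derive_translate (V : normedModType R) (f : V -> R) (x0 x v : V) (d : R) :
  is_derive (x + x0) v f d -> is_derive x v (fun y => f (y + x0)) d.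
Proof.
move=> H; rewrite (_ : (fun y => _) = fun y => f (x0 + 1 *: y)); last first.
  by apply/funext => y; rewrite scale1r addrC.
by rewrite -[d]mul1r; apply: is_derive_affine; rewrite scale1r addrC.
Qed.

Let second_difference g i j x (a : R) : smooth g ->
  exists2 y, `|y - x| <= 2 * `|a| &
    g (x + a *: e_ i + a *: e_ j) - g (x + a *: e_ i) - g (x + a *: e_ j) + g x
    = a * (a * pd [:: j; i] g y).
Proof.
move=> sg.
pose G := (fun y => g (y + a *: e_ j)) - g.
have dG t : is_derive (x + t *: e_ i) (e_ i) G
    (pd [:: i] g (x + t *: e_ i + a *: e_ j) - pd [:: i] g (x + t *: e_ i)).
  apply: is_deriveB; last exact: (smooth_is_derive [::] i _ sg).
  by apply: is_derive_translate; exact: (smooth_is_derive [::] i _ sg).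
have [c ca E] := line_MVT dG a.
have [d da E'] := line_MVT
  (fun t => smooth_is_derive [:: i] j (x + c *: e_ i + t *: e_ j) sg) a.
exists (x + c *: e_ i + d *: e_ j).
  have -> : x + c *: e_ i + d *: e_ j - x = c *: e_ i + d *: e_ j.
    by rewrite addrAC [x + _ + _]addrAC subrr add0r.
  apply: le_trans (ler_normD _ _) _; rewrite mulr_natl mulr2n.
  have small (b : R) k : `|b| <= `|a| -> `|b *: e_ k| <= `|a|.
    move=> ba; rewrite normrZ -[leRHS]mulr1.
    by apply: ler_pM; rewrite ?normr_ge0 ?norm_delta.
  by apply: lerD; apply: small.
rewrite -E' -E /G.
have fB (y : 'rV[R]_n) : ((fun y => g (y + a *: e_ j)) - g) y = g (y + a *: e_ j) - g y by [].
rewrite !fB (addrAC x); move: (g _) (g _) (g _) (g x) => *; ring.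
Qed.

Let eq_of_nearby_values (A B : 'rV[R]_n -> R) x : continuous A -> continuous B ->
  (forall k : R, 0 < k -> exists y z, [/\ `|y - x| < k, `|z - x| < k & A y = B z]) ->
  A x = B x.
Proof.
move=> cA cB H; apply/eqP; rewrite -subr_eq0 -normr_le0; apply: le_of_forall_eps => e e0.
rewrite add0r; have e2 : 0 < e / 2 by rewrite divr_gt0.
have /cvgrPdist_lt /(_ _ e2) /nbhs_ballP [k1 /= k10 H1] := cA x.
have /cvgrPdist_lt /(_ _ e2) /nbhs_ballP [k2 /= k20 H2] := cB x.
have k0 : 0 < Num.min k1 k2 by rewrite lt_min k10.
have [y [z []]] := H _ k0; rewrite !lt_min => /andP[y1 _] /andP[_ z2] E.
have b1 : `|A x - A y| < e / 2 by apply: H1; rewrite -ball_normE /= distrC.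
have b2 : `|B x - B z| < e / 2 by apply: H2; rewrite -ball_normE /= distrC.
have -> : A x - B x = (A x - A y) - (B x - B z) by rewrite E; ring.
by apply: le_trans (ler_normB _ _) _; lra.
Qed.

(** Schwarz' theorem: a second difference quotient equals, by two
    applications of the mean value theorem in either order, a value of each of
    the two mixed derivatives at points close to [x]. *)
Lemma pdC g i j x : smooth g -> pd [:: i; j] g x = pd [:: j; i] g x.
Proof.
move=> sg; apply: eq_of_nearby_values => [||k k0].
- exact: smooth_continuous.
- exact: smooth_continuous.
have a0 : 0 < k / 4 by rewrite divr_gt0.
have a1 : 2 * `|k / 4| < k by rewrite gtr0_norm //; lra.
have [y yx Ey] := second_difference i j x (k / 4) sg.
have [z zx Ez] := second_difference j i x (k / 4) sg.
exists z, y; split; [exact: le_lt_trans zx a1 | exact: le_lt_trans yx a1 |].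
apply: (mulfI (lt0r_neq0 a0)); apply: (mulfI (lt0r_neq0 a0)).
apply: etrans (esym Ez) (etrans _ Ey); rewrite (addrAC x).
by congr (_ + _); rewrite [RHS]addrAC.
Qed.

(** Adjacent derivatives commute by [pdC], so that the head of one list can be
    moved to its place in the other. *)
Lemma pd_perm g s1 s2 : smooth g -> perm_eq s1 s2 -> pd s1 g = pd s2 g.
Proof.
move=> sg; have mid i r1 r2 : pd (i :: r1 ++ r2) g = pd (r1 ++ i :: r2) g.
  elim: r1 => [//|j r1 IH] /=; rewrite -[RHS]/(partial j (pd (r1 ++ i :: r2) g)) -IH.
  apply/funext => x; exact: (pdC i j x (smooth_pd (r1 ++ r2) sg)).
elim: s1 s2 => [|i s1 IH] s2; first by rewrite perm_sym => /perm_nilP ->.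
move=> E; have : i \in s2 by rewrite -(perm_mem E) mem_head.
move=> /path.splitPr is2; case: is2 E => r1 r2 E.
rewrite -mid /= -[LHS]/(partial i (pd s1 g)) (IH (r1 ++ r2)) //.
by rewrite -(perm_cons i); apply: perm_trans E _; rewrite -cat1s perm_catCA.
Qed.

Definition multiplicity s : {ffun 'I_n -> nat} := [ffun i => count_mem i s].

Definition index_list (alpha : {ffun 'I_n -> nat}) : seq 'I_n :=
  flatten [seq nseq (alpha i) i | i <- enum 'I_n].

Lemma mderivE alpha g : mderiv alpha g = pd (index_list alpha) g.
Proof.
rewrite /mderiv /index_list; elim: (enum _) => //= i r ->.
by rewrite pd_cat; elim: (alpha i) => //= k ->.
Qed.

Lemma size_index_list alpha : size (index_list alpha) = mabs alpha.
Proof.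
rewrite size_flatten /shape -map_comp sumnE big_map big_enum /=.
by apply: eq_bigr => i _; rewrite size_nseq.
Qed.

Lemma perm_index_list s : perm_eq s (index_list (multiplicity s)).
Proof.
apply/allP => i _ /=; apply/eqP.
rewrite /index_list count_flatten -map_comp sumnE big_map big_enum /=.
rewrite (bigD1 i) //= count_nseq /= eqxx mul1n ffunE big1 ?addn0 // => j ji.
by rewrite count_nseq /= (negbTE ji).
Qed.

Lemma mabs_multiplicity s : mabs (multiplicity s) = size s.
Proof. by rewrite -size_index_list -(perm_size (perm_index_list s)). Qed.

Lemma pd_multiplicity g s : smooth g -> pd s g = mderiv (multiplicity s) g.
Proof. by move=> sg; rewrite mderivE; apply: pd_perm => //; exact: perm_index_list. Qed.

Lemma pd_support g (U : set 'rV[R]_n) s : open U ->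
  (forall x, U x -> g x = 0) -> forall x, U x -> pd s g x = 0.
Proof.
move=> oU gU; elim: s => [//|i s IH] x Ux.
have nz : \forall y \near x, cst (0 : R) y = pd s g y.
  have : nbhs x U by exact: open_nbhs_nbhs.
  by apply: filterS => y Uy; rewrite IH.
have := near_eq_is_derive nz (is_derive_cst (0 : R) x (e_ i)).
by case.
Qed.

Lemma open_norm_gt (r : R) : open [set x : 'rV[R]_n | r < `|x|].
Proof.
have /continuousP H := @norm_continuous _ 'rV[R]_n.
exact: H _ (@open_gt R r).
Qed.

Lemma open_norm_lt (r : R) : open [set x : 'rV[R]_n | `|x| < r].
Proof.
have /continuousP H := @norm_continuous _ 'rV[R]_n.
exact: H _ (@open_lt R r).
Qed.

End MixedPartials.

(** * Elementary facts on sequences *)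

Section TelescopingSequences.
Variable R : realType.
Implicit Types (a b t : nat -> R).

(** Cauchy's criterion with a majorant that telescopes; it also controls the
    distance to the limit. *)
Lemma telescope_cvg a b :
  (forall m, `|a m.+1 - a m| <= b m - b m.+1) -> b @ \oo --> 0 ->
  exists2 l : R, a @ \oo --> l & forall m, `|a m - l| <= b m.
Proof.
move=> ab b0.
have bdec m : b m.+1 <= b m by have := normr_ge0 (a m.+1 - a m); have := ab m; lra.
have bge0 m : 0 <= b m.
  rewrite -(cvg_lim (@Rhausdorff R) b0); apply: nonincreasing_cvgn_ge.
    exact/nonincreasing_seqP.
  by apply/cvg_ex; exists 0.
have step m k : `|a (m + k)%N - a m| <= b m - b (m + k)%N.
  elim: k => [|k IH]; first by rewrite addn0 !subrr normr0.
  rewrite addnS -[_ - a m](subrKA (a (m + k)%N)); apply: le_trans (ler_normD _ _) _.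
  by have := ab (m + k)%N; lra.
have cab : cvgn (fun m => a m + b m).
  apply: nonincreasing_is_cvgn.
    apply/nonincreasing_seqP => m; have := ab m; rewrite ler_norml => /andP[] *; lra.
  exists (a 0 - b 0) => _ [m _ <-].
  by have := bge0 m; have := step 0 m; rewrite add0n ler_norml => /andP[] *; lra.
pose l := limn (fun m => a m + b m).
have al : a @ \oo --> l.
  have -> : a = (fun m => a m + b m) - b by apply/funext => m; rewrite -[RHS]/(a m + b m - b m) addrK.
  by rewrite -[l]subr0; apply: cvgB.
exists l => // m.
have : (fun k => `|a m - a (m + k)%N|) @ \oo --> `|a m - l|.
  apply: cvg_norm; apply: cvgB; first exact: cvg_cst.
  by rewrite -(cvg_shiftn m) in al; move: al; under eq_fun do rewrite addnC.
move=> H; rewrite -(cvg_lim (@Rhausdorff R) H); apply: limr_le.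
  by apply/cvg_ex; exists `|a m - l|.
apply: nearW => k; rewrite distrC; apply: le_trans (step m k) _.
by rewrite gerBl.
Qed.

Lemma eventually_nonincreasing_bounded a N : (forall p, 0 <= a p) ->
  (forall p, (N <= p)%N -> a p.+1 <= a p) ->
  exists2 C, 0 < C & forall p, a p <= C.
Proof.
move=> a0 aN; exists (1 + \sum_(i < N.+1) a i).
  by rewrite ltr_pwDl // sumr_ge0.
have small p : (p <= N)%N -> a p <= 1 + \sum_(i < N.+1) a i.
  move=> pN; rewrite (bigD1 (Ordinal (pN : (p < N.+1)%N))) //=.
  have : 0 <= \sum_(i < N.+1 | i != Ordinal (pN : (p < N.+1)%N)) a i by rewrite sumr_ge0.
  lra.
elim=> [|p IH]; first exact: small.
have [pN|Np] := ltnP p N; first exact: small.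
exact: le_trans (aN _ Np) IH.
Qed.

(** Beyond the rank where [t j <= h], the quotients by [h ^+ p] no longer
    increase. *)
Lemma prod_null_le t (h : R) : (forall j, 0 <= t j) -> t @ \oo --> 0 -> 0 < h ->
  exists2 C, 0 < C & forall p, \prod_(j < p) t j <= C * h ^+ p.
Proof.
move=> t0 tc h0; have /cvgrPdist_le /(_ _ h0) [N _ NP] := tc.
have [||C C0 CP] := @eventually_nonincreasing_bounded
    (fun p => (\prod_(j < p) t j) / h ^+ p) N.
- by move=> p; rewrite divr_ge0 ?prodr_ge0 // exprn_ge0 // ltW.
- move=> p /NP /=; rewrite sub0r normrN ger0_norm // => tp.
  have hp : 0 < h ^+ p by rewrite exprn_gt0.
  rewrite big_ord_recr /= exprSr ler_pdivrMr ?mulr_gt0 // mulrA divfK ?lt0r_neq0 //.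
  by rewrite ler_wpM2l // prodr_ge0.
exists C => // p; by rewrite -ler_pdivrMr ?exprn_gt0.
Qed.

End TelescopingSequences.

(** * A non-quasianalytic step function *)

Section Splines.
Variable R : realType.
Implicit Types (x y a : R) (L : seq R) (f : R -> R).

Lemma symmetric_MVT f (df : R -> R) x a : 0 < a ->
  (forall y, is_derive y 1 f (df y)) ->
  exists2 y, x - a <= y <= x + a & f (x + a) - f (x - a) = 2 * a * df y.
Proof.
move=> a0 dfP; have xa : x - a <= x + a by lra.
have [|y] := @MVT_segment R f df (x - a) (x + a) xa (fun y _ => dfP y).
  apply: continuous_subspaceT => y.
  by apply: differentiable_continuous; apply/derivable1_diffP; case: (dfP y).
by rewrite in_itv /= => yP E; exists y => //; rewrite E; ring.
Qed.

Definition ramp k y : R := Num.max y 0 ^+ k / k`!%:R.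

(** Convolution of [ramp k] with the uniform probabilities on the intervals
    [[- a, a]], written with symmetric differences. *)
Fixpoint spline L k x : R :=
  if L is a :: L' then (spline L' k (x + a) - spline L' k (x - a)) / (2 * a)
  else ramp k x.

Lemma is_derive_ramp k y : is_derive y (1 : R) (ramp k.+2) (ramp k.+1 y).
Proof.
have H : is_derive y (1 : R) (fun y => Num.max y 0 ^+ k.+2) (k.+2%:R * Num.max y 0 ^+ k.+1).
  elim: k => [|k IH].
    apply/is_derive_epsP => e e0; exists e => // t te.
    have -> : t *: (1 : R) = t by rewrite /GRing.scale /= mulr1.
    apply: le_trans (_ : `|t| * `|t| <= _); last by rewrite ler_wpM2r // ltW.
    rewrite -normrM ger0_norm; last by rewrite -expr2 sqr_ge0.
    rewrite !expr2 expr1 ler_norml.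
    by case: (leP y 0); case: (leP (y + t) 0) => ? ?; apply/andP; split; nra.
  rewrite (_ : (fun y => _) = id * (fun y => Num.max y 0 ^+ k.+2)); last first.
    apply/funext => z; rewrite exprS -[RHS]/(z * _).
    by case: (leP z 0) => // _; rewrite exprS !mul0r mulr0.
  apply: is_derive_eq (is_deriveM (is_derive_id y 1) IH) _.
  rewrite /GRing.scale /= mulr1.
  case: (leP y 0) => [_|_]; first by rewrite ![0 ^+ _.+1]exprS !mul0r !mulr0 addr0.
  by rewrite [y ^+ k.+2]exprS -[k.+3]addn1 natrD; ring.
have := @is_deriveZ _ _ _ _ (k.+2`!%:R)^-1 y 1 _ H.
rewrite (_ : _ \*: _ = ramp k.+2); last first.
  by apply/funext => z; rewrite /ramp mulrC.
move/is_derive_eq; apply; rewrite /ramp /GRing.scale /= [in LHS]factS natrM.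
have : (k.+1)`!%:R != 0 :> R by rewrite pnatr_eq0 -lt0n fact_gt0.
have : k.+2%:R != 0 :> R by rewrite pnatr_eq0.
by move=> ? ?; field; apply/andP.
Qed.

Lemma is_derive_spline L k x : is_derive x (1 : R) (spline L k.+2) (spline L k.+1 x).
Proof.
elim: L x => [|a L IH] x /=; first exact: is_derive_ramp.
have := is_deriveB (is_derive_translate (IH (x + a))) (is_derive_translate (IH (x - a))).
move=> /(@is_deriveZ _ _ _ _ (2 * a)^-1).
rewrite (_ : _ \*: _ = spline (a :: L) k.+2); last first.
  apply/funext => z.
  by rewrite -[LHS]/((2 * a)^-1 * (spline L k.+2 (z + a) - spline L k.+2 (z - a))) mulrC.
by move/is_derive_eq; apply; rewrite /GRing.scale /= mulrC.
Qed.

(** Averaging evaluates the function at a nearby point, so it preserves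
    bounds, locally constant values and, up to the width, the function. *)
Lemma spline_mean a L k x : 0 < a ->
  exists2 y, x - a <= y <= x + a & spline (a :: L) k.+2 x = spline L k.+1 y.
Proof.
move=> a0; have [y yP E] := symmetric_MVT x a0 (is_derive_spline L k).
by exists y => //; rewrite /= E mulrC mulKf // lt0r_neq0 // mulr_gt0.
Qed.

Lemma spline_values L k x : size L = k.+1 -> all (fun a => 0 < a) L ->
  [/\ 0 <= spline L k.+1 x <= 1,
      x <= - \sum_(a <- L) a -> spline L k.+1 x = 0
    & \sum_(a <- L) a <= x -> spline L k.+1 x = 1].
Proof.
elim: k L x => [|k IH] [//|a L] x /= [sL] /andP[a0 aL]; last first.
  have [y /andP[y1 y2] E] := spline_mean L k x a0.
  have [A B C] := IH L y sL aL.
  rewrite -/(spline (a :: L) k.+2 x) E big_cons; split=> // H.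
    by apply: B; lra.
  by apply: C; lra.
case: L sL aL => // _ _; rewrite big_seq1 /= /ramp !expr1 !divr1.
set D := Num.max (x + a) 0 - Num.max (x - a) 0.
have [D0 D1 D2 D3] : [/\ 0 <= D, D <= 2 * a, x <= - a -> D = 0 & a <= x -> D = 2 * a].
  by rewrite /D; case: (leP (x + a) 0); case: (leP (x - a) 0) => ? ?; split; lra.
have a2 : 0 < 2 * a by rewrite mulr_gt0.
split=> [|/D2 ->|/D3 ->]; last by rewrite divff // lt0r_neq0.
  by rewrite divr_ge0 ?(ltW a2) // ler_pdivrMr // mul1r.
by rewrite mul0r.
Qed.

(** The averages of [L2] bring [ramp k.+1] down to values between [0] and
    [1]; each further one is a difference quotient of a function already
    bounded, and costs a factor [a^-1]. *)
Lemma spline_bound L1 L2 k x : size L2 = k.+1 -> all (fun a => 0 < a) (L1 ++ L2) ->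
  `|spline (L1 ++ L2) k.+1 x| <= \prod_(a <- L1) a^-1.
Proof.
move=> sL; elim: L1 x => [|a L1 IH] x /=.
  move=> aL; have [/andP[A B] _ _] := spline_values x sL aL.
  by rewrite big_nil ger0_norm.
move=> /andP[a0 aL]; rewrite big_cons normrM normfV (gtr0_norm (mulr_gt0 _ a0)) //.
rewrite ler_pdivrMr ?mulr_gt0 // mulrAC mulrCA mulVf ?lt0r_neq0 // mulr1.
apply: le_trans (ler_normB _ _) _.
by have := IH (x + a) aL; have := IH (x - a) aL; lra.
Qed.

(** The averages commute: the last one can be performed first. *)
Lemma spline_rcons L a k x :
  spline (rcons L a) k x = (spline L k (x + a) - spline L k (x - a)) / (2 * a).
Proof.
elim: L x => [//|b L IH] x /=; rewrite !IH.
have -> : x + b + a = x + a + b by ring.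
have -> : x + b - a = x - a + b by ring.
have -> : x - b + a = x + a - b by ring.
have -> : x - b - a = x - a - b by ring.
by ring.
Qed.

End Splines.

Section StepFunction.
Variable R : realType.
Implicit Types (a b : nat -> R) (x y : R).

Lemma sum_mkseq_le a b m : (forall j, a j <= b j - b j.+1) -> (forall j, 0 <= b j) ->
  \sum_(y <- mkseq a m) y <= b 0%N.
Proof.
move=> ab b0; apply: le_trans (_ : b 0%N - b m <= _); last by rewrite gerBl.
elim: m => [|m IH]; first by rewrite big_nil subrr.
rewrite /mkseq -(addn1 m) iotaD map_cat big_cat /= big_seq1 add0n addn1.
by have := ab m; move: IH; rewrite /mkseq; lra.
Qed.

(** The limit of splines with more and more averages, of widths given by
    [a]. A derivative of order [p] pays for the first [p] averages only, and the
    later ones move its values by multiples of the [a m], whose sums are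
    controlled by [b]. *)
Lemma exists_step a b : (forall j, 0 < a j) -> (forall j, a j <= b j - b j.+1) ->
  b @ \oo --> 0 ->
  exists w : nat -> R -> R,
  [/\ forall p x, is_derive x (1 : R) (w p) (w p.+1 x),
      forall p x, `|w p x| <= \prod_(j < p) (a j)^-1,
      forall x, x <= - b 0%N -> w 0%N x = 0
    & forall x, b 0%N <= x -> w 0%N x = 1].
Proof.
move=> a0 ab bc.
have bge0 j : 0 <= b j.
  rewrite -(cvg_lim (@Rhausdorff R) bc); apply: nonincreasing_cvgn_ge.
    by apply/nonincreasing_seqP => m; have := ab m; have := a0 m; lra.
  by apply/cvg_ex; exists 0.
pose v p m : R -> R := spline (mkseq a (m + p.+2)) m.+2.
pose K p : R := \prod_(j < p) (a j)^-1.
have K0 p : 0 <= K p by apply: prodr_ge0 => j _; rewrite invr_ge0 ltW.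
have apos m : all (fun y => 0 < y) (mkseq a m).
  by apply/allP => _ /mapP[j _ ->].
have bound p k x : `|spline (mkseq a (p + k.+1)) k.+1 x| <= K p.
  have E : mkseq a (p + k.+1) = mkseq a p ++ [seq a j | j <- iota p k.+1].
    by rewrite /mkseq iotaD map_cat add0n.
  have := apos (p + k.+1)%N; rewrite E => /(spline_bound _) /=.
  move=> /(_ k x); rewrite size_map size_iota => /(_ erefl) /le_trans; apply.
  by rewrite big_map /K -(big_mkord xpredT (fun j => (a j)^-1)) /index_iota subn0.
have vd p m x : is_derive x (1 : R) (v p m.+1) (v p.+1 m x).
  by rewrite /v -[(m + p.+3)%N]addSnnS; exact: is_derive_spline.
have vb p m x : `|v p m x| <= K p.
  by rewrite /v (_ : (m + p.+2)%N = (p + m.+2)%N); [exact: bound|lia].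
have cauchy p x m : `|v p m.+1 x - v p m x| <= K p.+1 * b (m + p.+2)%N - K p.+1 * b (m.+1 + p.+2)%N.
  have [y /andP[y1 y2] E] := spline_mean (mkseq a (m + p.+2)) m.+1 x (a0 (m + p.+2)%N).
  have {E} -> : v p m.+1 x = v p m y.
    rewrite /v -E -[RHS]spline_rcons addSn; congr (spline _ _ _).
    by rewrite /mkseq -addn1 iotaD map_cat cats1.
  have [c _ E] := line_MVT (fun t => is_derive_spline (mkseq a (m + p.+2)) m (x + t *: 1)) (y - x).
  have {E} -> : v p m y - v p m x = (y - x) * spline (mkseq a (m + p.+2)) m.+1 (x + c *: 1).
    rewrite /v -E; congr (spline _ _ _ - _).
    by rewrite [_ *: 1]mulr1 addrC subrK.
  rewrite -mulrBr normrM mulrC; apply: ler_pM => //.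
    by rewrite (_ : (m + p.+2)%N = (p.+1 + m.+1)%N); [exact: bound|lia].
  apply: le_trans (ab _); rewrite ler_norml; apply/andP; split; lra.
pose w p x := limn (fun m => v p m x).
have Kb p : (fun m => K p * b (m + p.+1)%N) @ \oo --> 0.
  rewrite -[0](mulr0 (K p)); apply: cvgMl_tmp.
  by move: bc; rewrite -(cvg_shiftn p.+1); apply.
have wP p x : (fun m => v p m x) @ \oo --> w p x /\
    forall m, `|v p m x - w p x| <= K p.+1 * b (m + p.+2)%N.
  have [l vl H] := telescope_cvg (cauchy p x) (Kb p.+1).
  have El : w p x = l by exact: cvg_lim.
  by rewrite El.
have wval x l : (forall m, v 0%N m x = l) -> w 0%N x = l.
  move=> H; have [+ _] := wP 0%N x.
  rewrite (_ : (fun m => v 0%N m x) = cst l); last exact/funext.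
  by move=> /cvg_lim <- //; rewrite lim_cst.
have sv m : size (mkseq a (m + 2)) = m.+2 by rewrite size_mkseq addn2.
have sb m : \sum_(y <- mkseq a (m + 2)) y <= b 0%N by exact: sum_mkseq_le.
exists w; split=> [p x|p x|x xb|x xb].
- apply: (@is_derive_lim _ _ (fun m => v p m.+1) (fun m => v p.+1 m) (w p) (w p.+1) 1
    (fun m => K p.+2 * b (m + p.+3)%N)) => //.
  + by move=> y; have [+ _] := wP p y; rewrite -(cvg_shiftS (fun m => v p m y)).
  + by move=> m y; have [_] := wP p.+1 y; apply.
- have [+ _] := wP p x => /cvg_norm H.
  rewrite -(cvg_lim (@Rhausdorff R) H); apply: limr_le; last exact: nearW.
  by apply/cvg_ex; exists `|w p x|.
- apply: wval => m; rewrite /v.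
  have [_ + _] := spline_values x (sv m) (apos _); apply.
  by have := sb m; lra.
- apply: wval => m; rewrite /v.
  have [_ _] := spline_values x (sv m) (apos _); apply.
  by have := sb m; lra.
Qed.

End StepFunction.

(** * Tensor products and limits of smooth functions *)

Section TensorProducts.
Variables (R : realType) (n : nat).
Implicit Types (x : 'rV[R]_n) (s : seq 'I_n).

Local Notation e_ i := (delta_mx (0 : 'I_1) i : 'rV[R]_n).

Lemma is_derive_continuous (f df : R -> R) :
  (forall y, is_derive y (1 : R) f (df y)) -> continuous f.
Proof.
move=> H y; apply: differentiable_continuous; apply/derivable1_diffP.
by case: (H y).
Qed.

Lemma continuous_bigprod (V : normedModType R) (I : Type) (r : seq I) (F : I -> V -> R) :
  (forall i, continuous (F i)) -> continuous (fun y => \prod_(i <- r) F i y).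
Proof.
move=> H; elim: r => [|i r IH].
  have -> : (fun y => \prod_(i <- [::]) F i y) = cst 1.
    by apply/funext => y; rewrite big_nil.
  exact: cst_continuous.
have -> : (fun y => \prod_(j <- i :: r) F j y) =
    (fun y => F i y * \prod_(j <- r) F j y).
  by apply/funext => y; rewrite big_cons.
by apply: continuous_mulf; [exact: H|exact: IH].
Qed.

Lemma smooth_tensor (u : 'I_n -> nat -> R -> R) :
  (forall i p y, is_derive y (1 : R) (u i p) (u i p.+1 y)) ->
  smooth (fun x => \prod_i u i 0%N (x 0 i)) /\
  forall s, pd s (fun x => \prod_i u i 0%N (x 0 i)) =
            fun x => \prod_i u i (count_mem i s) (x 0 i).
Proof.
move=> ud.
pose F s x := \prod_i u i (count_mem i s) (x 0 i).
apply: (@smooth_family _ _ F) => [s|s i x].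
  apply: continuous_bigprod => i x.
  apply: (@continuous_comp _ _ _ (fun x : 'rV[R]_n => x 0 i)).
    exact: coord_continuous.
  exact: (is_derive_continuous (ud i _)).
have E t : F s (x + t *: e_ i) =
    (\prod_(j | j != i) u j (count_mem j s) (x 0 j)) * u i (count_mem i s) (t + x 0 i).
  rewrite /F (bigD1 i) //= mulrC; congr (_ * _).
    apply: eq_bigr => j ji; congr (u _ _ _).
    by rewrite !mxE /= (negbTE ji) mulr0 addr0.
  by congr (u _ _ _); rewrite !mxE /= !eqxx mulr1 addrC.
have E' : F (i :: s) x =
    (\prod_(j | j != i) u j (count_mem j s) (x 0 j)) * u i (count_mem i s).+1 (x 0 i).
  rewrite /F (bigD1 i) //= mulrC eqxx add1n; congr (_ * _).
  by apply: eq_bigr => j ji; rewrite eq_sym (negbTE ji) add0n.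
suff : is_derive (x + (0 : R) *: e_ i) (e_ i) (F s) (F (i :: s) x).
  by rewrite scale0r addr0.
apply/is_derive_line.
rewrite (_ : (fun t => _) = fun t => (\prod_(j | j != i) u j (count_mem j s) (x 0 j))
   * u i (count_mem i s) (t + x 0 i)); last exact/funext.
rewrite E'; apply: (@is_deriveZ _ _ _ (fun t => u i (count_mem i s) (t + x 0 i))).
by apply: is_derive_translate; rewrite add0r.
Qed.

Lemma smooth_lim (g : nat -> 'rV[R]_n -> R) (F : seq 'I_n -> 'rV[R]_n -> R)
    (eps : seq 'I_n -> nat -> R) :
  (forall m, smooth (g m)) -> (forall s, eps s @ \oo --> 0) ->
  (forall s m x, `|pd s (g m) x - F s x| <= eps s m) ->
  smooth (F [::]) /\ forall s, pd s (F [::]) = F s.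
Proof.
move=> sg e0 H; apply: smooth_family => [s|s i x].
  apply: (@continuous_lim _ _ (fun m => pd s (g m)) _ (eps s)) => // m.
  exact: smooth_continuous.
apply: (@is_derive_lim _ _ (fun m => pd s (g m)) (fun m => pd (i :: s) (g m)) _ _ _
   (eps (i :: s))) => // [m y|y].
  exact: smooth_is_derive.
apply/cvgrPdist_le => e ep; have /cvgrPdist_le /(_ e ep) := e0 s.
apply: filterS => m; rewrite sub0r normrN distrC => em.
by apply: le_trans (H s m y) (le_trans (ler_norm _) em).
Qed.

End TensorProducts.

(** * Weight sequences *)

Section LogConvexity.
Variable R : realType.
Implicit Types (m : nat -> R).

(** Quotients of consecutive terms increase: those leading from [m 0] to
    [m q] are below those leading from [m p] to [m (p + q)]. *)
Lemma log_convex_supermul m : (forall p, 0 < m p) -> log_convex m ->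
  forall p q, m p * m q <= m 0%N * m (p + q)%N.
Proof.
move=> m0 lc.
have ratio p q : (p <= q)%N -> m p.+1 * m q <= m p * m q.+1.
  elim: q => [|q IH]; first by rewrite leqn0 => /eqP ->; rewrite mulrC.
  rewrite leq_eqVlt => /predU1P[->|]; first by rewrite mulrC.
  rewrite ltnS => /IH {}IH; have := lc q.+1 isT; rewrite /= => lcq.
  rewrite -(ler_pM2r (m0 q)) mulrAC.
  apply: le_trans (_ : m p * m q.+1 * m q.+1 <= _); first by rewrite ler_pM2r.
  by rewrite -!mulrA ler_pM2l // mulrC -expr2 [m q.+2 * _]mulrC.
move=> p; elim=> [|q IH]; first by rewrite addn0 mulrC.
rewrite addnS -(ler_pM2r (m0 q)).
have -> : m p * m q.+1 * m q = m p * m q * m q.+1 by rewrite mulrAC.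
apply: le_trans (_ : m 0%N * m (p + q)%N * m q.+1 <= _); first by rewrite ler_pM2r.
by rewrite -!mulrA ler_pM2l // mulrC [leRHS]mulrC; apply: ratio; exact: leq_addl.
Qed.

(** Log-convexity of [N p / p!] bounds it below by a geometric sequence. *)
Lemma star_log_convex_lower (N : nat -> R) : (forall p, 0 < N p) -> cond_M1star N ->
  exists2 r, 0 < r & forall p, N 0%N * r ^+ p * p`!%:R <= N p.
Proof.
move=> N0 lc.
have f0 p : 0 < p`!%:R :> R by rewrite ltr0n fact_gt0.
have s0 p : 0 < star N p by rewrite divr_gt0.
exists (star N 1%N / star N 0%N); first by rewrite divr_gt0.
move=> p; rewrite -ler_pdivlMr // -/(star N p).
elim: p => [|p IH]; first by rewrite expr0 mulr1 /star fact0 divr1.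
have := log_convex_supermul s0 lc p 1; rewrite addn1 => H.
apply: le_trans (_ : star N p * (star N 1%N / star N 0%N) <= _).
  by rewrite exprSr (mulrA (N 0%N)) ler_wpM2r ?divr_ge0 // ltW.
by rewrite mulrA ler_pdivrMr // [leRHS]mulrC.
Qed.

End LogConvexity.

Section Weights.
Variable R : realType.
Implicit Types (a b l : nat -> R) (c : ucase) (h : R).

Definition positive_increasing a :=
  (forall p, (1 <= p)%N -> 0 < a p) /\ (forall p, (1 <= p)%N -> a p <= a p.+1).

Lemma Rset_positive_increasing c a : Rset c a -> positive_increasing a.
Proof.
case: c => [[k k0 ak]|[a0 a1 _]]; last by split.
by split=> p p1; rewrite !ak.
Qed.

Lemma cumprod0 a : cumprod a 0 = 1.
Proof. by rewrite /cumprod big_geq. Qed.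

Lemma cumprodS a p : cumprod a p.+1 = cumprod a p * a p.+1.
Proof. by rewrite /cumprod big_nat_recr. Qed.

Lemma cumprod_gt0 a p : positive_increasing a -> 0 < cumprod a p.
Proof.
by move=> [a0 _]; elim: p => [|p IH]; rewrite ?cumprod0 ?cumprodS ?mulr_gt0 // a0.
Qed.

Lemma eq_cumprod a b : (forall p, (1 <= p)%N -> a p = b p) -> cumprod a =1 cumprod b.
Proof.
by move=> ab; elim=> [|p IH]; rewrite ?cumprod0 // !cumprodS IH ab.
Qed.

Lemma cumprod_cst h p : cumprod (fun=> h) p = h ^+ p.
Proof. by elim: p => [|p IH]; rewrite ?cumprod0 // cumprodS IH exprSr. Qed.

Lemma cumprod_scale h a p : cumprod (fun j => h * a j) p = h ^+ p * cumprod a p.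
Proof.
by elim: p => [|p IH]; rewrite ?cumprod0 ?mulr1 // !cumprodS IH exprSr mulrACA.
Qed.

Lemma positive_increasing_le a p q : positive_increasing a -> (1 <= p)%N ->
  (p <= q)%N -> a p <= a q.
Proof.
move=> [_ a1] p1; elim: q => [|q IH]; first by rewrite leqn0 => /eqP ->.
rewrite leq_eqVlt => /predU1P[->//|]; rewrite ltnS => pq.
by apply: le_trans (IH pq) (a1 _ (leq_trans p1 pq)).
Qed.

Lemma cumprod_supermul a p q : positive_increasing a ->
  cumprod a p * cumprod a q <= cumprod a (p + q).
Proof.
move=> pa; have c0 k := cumprod_gt0 k pa; have [a0 _] := pa.
elim: q => [|q IH]; first by rewrite cumprod0 mulr1 addn0.
rewrite addnS !cumprodS mulrA; apply: ler_pM => //.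
- by rewrite mulr_ge0 // ltW.
- by rewrite ltW // a0.
by apply: positive_increasing_le => //; rewrite ltnS leq_addl.
Qed.

Lemma positive_increasing_cst h : 0 < h -> positive_increasing (fun=> h).
Proof. by []. Qed.

Lemma Rset_cst h : 0 < h -> Rset Beurling (fun=> h).
Proof. by exists h. Qed.

Lemma Rset_scale c a h : 0 < h -> Rset c a -> Rset c (fun j => h * a j).
Proof.
move=> h0; case: c => [[k k0 ak]|[a0 a1 ac]].
  by exists (h * k); [rewrite mulr_gt0|move=> p /ak ->].
split=> [p p1|p p1|]; first by rewrite mulr_gt0 // a0.
  by rewrite ler_pM2l // a1.
apply/cvgryPge => A; move/cvgryPge : ac => /(_ (A / h)).
by apply: filterS => p; rewrite ler_pdivrMr // mulrC.
Qed.

Lemma Rset_shift c a k : Rset c a -> Rset c (fun j => a (maxn 1 (j - k))).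
Proof.
move=> ac; have pa := Rset_positive_increasing ac.
case: c ac => [[h h0 ah]|[a0 a1 ac]].
  by exists h => // p _; rewrite ah // leq_maxl.
split=> [p p1|p p1|]; first by rewrite a0 // leq_maxl.
  by apply: positive_increasing_le => //; [rewrite leq_maxl|lia].
apply/cvgryPge => A; move/cvgryPge : ac => /(_ A)[m _ mA].
exists (m + k + 1)%N => // p /= mp; apply: mA => /=; lia.
Qed.

Lemma cumprod_shift a k p :
  cumprod (fun j => a (maxn 1 (j - k))) (p + k) = a 1%N ^+ k * cumprod a p.
Proof.
elim: p => [|p IH]; last by rewrite addSn !cumprodS IH mulrA; congr (_ * a _); lia.
rewrite cumprod0 mulr1 add0n -(cumprod_cst (a 1%N)) /cumprod.
by apply: eq_big_nat => j /andP[_ jk]; congr (a _); lia.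
Qed.

Lemma Roumieu_dominates_powers a h : Rset Roumieu a -> 0 < h ->
  exists2 C, 0 < C & forall p, h ^+ p <= C * cumprod a p.
Proof.
move=> aR h0; have pa := Rset_positive_increasing aR; have [a0 a1 ac] := aR.
have [||| C C0 CP] := @prod_null_le R (fun j => (a j.+1)^-1) h^-1.
- by move=> j; rewrite invr_ge0 ltW // a0.
- apply/cvgrPdist_le => e e0; move/cvgryPge : ac => /(_ e^-1)[m _ mA].
  exists m => // p /= mp; have ap : 0 < a p.+1 by rewrite a0.
  rewrite sub0r normrN gtr0_norm ?invr_gt0 // -[leRHS]invrK lef_pV2 ?posrE ?invr_gt0 //.
  by apply: mA; rewrite /= leqW.
- by rewrite invr_gt0.
exists C => // p; have cp := cumprod_gt0 p pa.
have E : \prod_(j < p) (a j.+1)^-1 = (cumprod a p)^-1.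
  by rewrite -prodfV /cumprod big_add1 big_mkord.
have := CP p; rewrite E exprVn ler_pdivlMr ?exprn_gt0 // mulrC ler_pdivrMr //.
Qed.

(** The value at [j] is the first [k] with [j <= P k], so that it is
    at most [k] up to [P k]. *)
Lemma slow_sequence (P : nat -> nat) : exists2 a : nat -> R, Rset Roumieu a &
  forall k p, (1 <= k)%N -> (p <= P k)%N -> cumprod a p <= k%:R ^+ p.
Proof.
pose Q k := maxn (P k) k.
have ex j : exists k, (1 <= k)%N && (j <= Q k)%N.
  by exists (maxn 1 j); rewrite leq_maxl /Q; lia.
pose b j := ex_minn (ex j).
have bP j : [/\ (1 <= b j)%N, (j <= Q (b j))%N &
    forall k, (1 <= k)%N -> (j <= Q k)%N -> (b j <= k)%N].
  rewrite /b; case: ex_minnP => k /andP[k1 jk] kmin; split=> // k' k1' jk'.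
  by apply: kmin; rewrite k1'.
have bmono j : (b j <= b j.+1)%N.
  by have [_ _ H] := bP j; have [H1 H2 _] := bP j.+1; apply: H => //; exact: ltnW.
pose a j : R := (b j)%:R.
have pa : positive_increasing a.
  by split=> p _; rewrite /a ?ltr0n ?ler_nat //; case: (bP p).
exists a => [|k p k1 pk].
  have [a0 a1] := pa; split=> //; apply/cvgryPge => A.
  pose k0 := Num.bound `|A|; pose m := (\sum_(k < k0.+1) Q k)%N.
  exists m.+1 => // j /= mj; apply: le_trans (ler_norm A) _.
  apply: le_trans (ltW (archi_boundP (normr_ge0 A))) _; rewrite -/k0.
  rewrite /a ler_nat leqNgt; apply/negP => bk; have [_ jb _] := bP j.
  have : (Q (b j) <= m)%N.
    by rewrite /m (bigD1 (Ordinal (leqW bk : (b j < k0.+1)%N))) //= leq_addr.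
  by move=> /(leq_trans jb); rewrite leqNgt mj.
elim: p pk => [|p IH] pk; first by rewrite cumprod0 expr0.
have [a0 _] := pa.
rewrite cumprodS exprSr; apply: ler_pM; last 1 first.
- have [_ _ H] := bP p.+1; rewrite ler_nat; apply: H => //.
  exact: leq_trans pk (leq_maxl _ _).
- exact: ltW (cumprod_gt0 p pa).
- exact: ltW (a0 p.+1 isT).
- exact: IH (ltnW pk).
Qed.

End Weights.

(** * The associated function *)

Section AssociatedFunction.
Variables (R : realType) (N : nat -> R).
Hypotheses (N0 : forall p, 0 < N p) (N1 : cond_M1star N).
Implicit Types (a b l : nat -> R) (c : ucase) (s t : R).

(** A quantity dominated by all the weights of Roumieu type is dominated by
    powers of one constant: otherwise the places [deg (x k)] where domination by
    [k%:R ^+ p] fails by a factor [k] would be below the threshold of a weight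
    that increases slowly enough to stay under these powers there. *)
Lemma power_bound_of_Roumieu (T : Type) (D : set T) (deg : T -> nat) (val : T -> R) :
  (forall a, Rset Roumieu a ->
     exists C, forall x, D x -> val x <= C * cumprod a (deg x)) ->
  exists2 k, (1 <= k)%N & exists C, forall x, D x -> val x <= C * k%:R ^+ deg x.
Proof.
move=> H; apply: contrapT => nH.
have ex k : exists x, D x /\ k.+1%:R * k.+1%:R ^+ deg x < val x.
  apply: contrapT => /forallNP nE; apply: nH.
  exists k.+1 => //; exists k.+1%:R => x Dx; rewrite leNgt; apply/negP => lt.
  by apply: (nE x).
have [x xP] := choice ex.
have [a aR aP] := slow_sequence R (fun k => deg (x k.-1)).
have [C CP] := H a aR.
have [] := xP (Num.bound `|C|); set k := Num.bound _ => Dx; apply/negP; rewrite -leNgt.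
have Ck : C <= k.+1%:R.
  apply: le_trans (ler_norm C) (le_trans (ltW (archi_boundP (normr_ge0 C))) _).
  by rewrite ler_nat.
have cp := cumprod_gt0 (deg (x k)) (Rset_positive_increasing aR).
apply: le_trans (CP _ Dx) _; apply: le_trans (_ : k.+1%:R * cumprod a (deg (x k)) <= _).
  by rewrite ler_wpM2r // ltW.
by rewrite ler_wpM2l // aP.
Qed.

Definition assoc_term l t p : R := t ^+ p * N 0%N / (cumprod l p * N p).

(** The exponential of the associated function; unlike the latter it is a real
    number and its values at [0] need no convention. *)
Definition assoc_weight l t : R := sup [set assoc_term l t p | p in setT].

Let den_gt0 l p : positive_increasing l -> 0 < cumprod l p * N p.
Proof. by move=> pl; rewrite mulr_gt0 ?cumprod_gt0. Qed.

Lemma assoc_term_ge0 l t p : positive_increasing l -> 0 <= t -> 0 <= assoc_term l t p.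
Proof.
move=> pl t0; rewrite divr_ge0 ?(ltW (den_gt0 p pl)) //.
by rewrite mulr_ge0 ?exprn_ge0 ?(ltW (N0 0)).
Qed.

(** By [(M.1)*] the terms are dominated by those of an exponential series;
    this is why the associated function is finite. *)
Lemma assoc_term_cvg l t : positive_increasing l -> 0 <= t ->
  assoc_term l t @ \oo --> 0.
Proof.
move=> pl t0; have [r r0 rP] := star_log_convex_lower N0 N1.
have l1 : 0 < l 1%N by case: pl => + _; apply.
have cl p : (l 1%N) ^+ p <= cumprod l p.
  elim: p => [|p IH]; first by rewrite cumprod0 expr0.
  rewrite cumprodS exprSr; apply: ler_pM; rewrite ?exprn_ge0 ?(ltW l1) //.
  exact: positive_increasing_le.
apply: (@squeeze_cvgr _ _ _ _ (fun=> 0) (exp_coeff (t / (l 1%N * r)))); last 2 first.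
- exact: cvg_cst.
- exact: cvg_exp_coeff.
apply: nearW => p; apply/andP; split.
  exact: assoc_term_ge0.
have f0 : 0 < p`!%:R :> R by rewrite ltr0n fact_gt0.
rewrite /assoc_term /exp_coeff /= ler_pdivrMr ?mulr_gt0 ?cumprod_gt0 //.
apply: le_trans (_ : (t / (l 1%N * r)) ^+ p / p`!%:R *
   ((l 1%N) ^+ p * (N 0%N * r ^+ p * p`!%:R)) <= _); last first.
  have lr : 0 <= t / (l 1%N * r) by rewrite divr_ge0 // ltW // mulr_gt0.
  rewrite ler_wpM2l ?divr_ge0 ?exprn_ge0 //; apply: ler_pM => //.
    by rewrite exprn_ge0 // ltW.
  by rewrite ltW // !mulr_gt0 ?exprn_gt0.
rewrite expr_div_n exprMn.
have lp : l 1%N ^+ p != 0 by rewrite lt0r_neq0 ?exprn_gt0.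
have rp : r ^+ p != 0 by rewrite lt0r_neq0 ?exprn_gt0.
apply: le_of_eq; field.
by rewrite lp rp lt0r_neq0.
Qed.

Lemma assoc_term0 l t : assoc_term l t 0 = 1.
Proof. by rewrite /assoc_term cumprod0 expr0 !mul1r divff // lt0r_neq0. Qed.

Lemma assoc_has_sup l t : positive_increasing l -> 0 <= t ->
  has_sup [set assoc_term l t p | p in setT].
Proof.
move=> pl t0; split; first by exists 1, 0%N => //; rewrite assoc_term0.
have /cvgrPdist_le /(_ _ ltr01) [P _ PP] := assoc_term_cvg pl t0.
exists (1 + \sum_(p < P) assoc_term l t p) => _ [p _ <-].
have S0 : 0 <= \sum_(p < P) assoc_term l t p.
  by rewrite sumr_ge0 // => i _; exact: assoc_term_ge0.
have [pP|Pp] := ltnP p P.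
  rewrite (bigD1 (Ordinal pP)) //= addrCA lerDl addr_ge0 // sumr_ge0 // => i _.
  exact: assoc_term_ge0.
have := PP p Pp; rewrite /= sub0r normrN => H.
by apply: le_trans (ler_norm _) (le_trans H _); rewrite lerDl.
Qed.

Lemma assoc_weight_ge l t p : positive_increasing l -> 0 <= t ->
  assoc_term l t p <= assoc_weight l t.
Proof.
move=> pl t0; have [_ H] := assoc_has_sup pl t0.
by apply: ub_le_sup => //; exists p.
Qed.

Lemma assoc_weight_le l t y : (forall p, assoc_term l t p <= y) -> assoc_weight l t <= y.
Proof.
move=> H; apply: ge_sup; first by exists (assoc_term l t 0), 0%N.
by move=> _ [p _ <-].
Qed.

Lemma assoc_weight_ge1 l t : positive_increasing l -> 0 <= t -> 1 <= assoc_weight l t.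
Proof. by move=> pl t0; rewrite -(assoc_term0 l t); exact: assoc_weight_ge. Qed.

Lemma assoc_weight_gt0 l t : positive_increasing l -> 0 <= t -> 0 < assoc_weight l t.
Proof. by move=> pl t0; apply: lt_le_trans ltr01 (assoc_weight_ge1 pl t0). Qed.

Lemma assoc_weight_homo l s t : positive_increasing l -> 0 <= s -> s <= t ->
  assoc_weight l s <= assoc_weight l t.
Proof.
move=> pl s0 st; have t0 := le_trans s0 st; apply: assoc_weight_le => p.
apply: le_trans (assoc_weight_ge p pl t0).
rewrite /assoc_term ler_wpM2r ?invr_ge0 ?(ltW (den_gt0 p pl)) //.
by rewrite ler_wpM2r ?(ltW (N0 0)) // lerXn2r.
Qed.

Lemma assoc_term_scale l s t p : 0 < s -> positive_increasing l ->
  assoc_term l (s * t) p = assoc_term (fun j => s^-1 * l j) t p.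
Proof.
move=> s0 pl; rewrite /assoc_term cumprod_scale exprMn exprVn.
have sp : s ^+ p != 0 by rewrite lt0r_neq0 ?exprn_gt0.
have cp : cumprod l p != 0 by rewrite lt0r_neq0 ?cumprod_gt0.
have np : N p != 0 by rewrite lt0r_neq0.
by field; rewrite sp cp np.
Qed.

Lemma assoc_weight_scale l s t : 0 < s -> positive_increasing l ->
  assoc_weight l (s * t) = assoc_weight (fun j => s^-1 * l j) t.
Proof.
move=> s0 pl; rewrite /assoc_weight; congr (sup _).
by apply/seteqP; split=> _ [p _ <-]; exists p; rewrite // assoc_term_scale.
Qed.

Lemma power_le_assoc_weight l t p : positive_increasing l -> 0 <= t ->
  t ^+ p <= assoc_weight l t / N 0%N * (cumprod l p * N p).
Proof.
move=> pl t0; have := assoc_weight_ge p pl t0.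
by rewrite /assoc_term ler_pdivrMr ?mulr_gt0 ?cumprod_gt0 // mulrAC ler_pdivlMr.
Qed.

Lemma expeR_assoc_fun l t : positive_increasing l -> 0 <= t ->
  expeR (- assoc_fun N l t) = ((assoc_weight l t)^-1)%:E.
Proof.
move=> pl; rewrite le_eqVlt => /predU1P[<-|t0].
  rewrite /assoc_fun eqxx oppe0 expeR0; congr (_%:E); symmetry.
  rewrite (_ : assoc_weight l 0 = 1) ?invr1 //; apply/eqP; rewrite eq_le.
  rewrite assoc_weight_ge1 // andbT; apply: assoc_weight_le => -[|p].
    by rewrite assoc_term0.
  by rewrite /assoc_term exprS !mul0r.
have tp p : 0 < assoc_term l t p.
  by rewrite divr_gt0 ?mulr_gt0 ?exprn_gt0 ?cumprod_gt0.
have W0 := assoc_weight_gt0 pl (ltW t0).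
suff -> : assoc_fun N l t = (ln (assoc_weight l t))%:E.
  by rewrite /= expRN lnK.
rewrite /assoc_fun gt_eqF //; apply/eqP; rewrite eq_le; apply/andP; split.
  apply: ge_ereal_sup => _ [p _ <-]; rewrite lee_fin ler_ln ?posrE //.
    exact: (assoc_weight_ge p pl (ltW t0)).
  exact: tp.
set S := ereal_sup _.
have Sp p : ((ln (assoc_term l t p))%:E <= S)%E.
  by apply: ereal_sup_ubound; exists p.
case E : S => [r||]; last by have := Sp 0%N; rewrite E.
  rewrite lee_fin -[leRHS]expRK ler_ln ?posrE ?expR_gt0 //.
  apply: assoc_weight_le => p; have := Sp p; rewrite E lee_fin => H.
  by rewrite -[leLHS]lnK ?posrE // ler_expR.
by rewrite leey.
Qed.

(** Shifting the sequence and using stability under products, decay against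
    the powers [t ^+ q] compensates the growth of the associated function and a
    further power of [t]. *)
Lemma assoc_weight_absorb c l s k : Rset c l -> 0 < s -> cond_M2 N ->
  exists2 b, Rset c b & exists2 C, 0 < C & forall t X C0, 0 <= t -> 0 <= X ->
    (forall q, t ^+ q * X <= C0 * (cumprod b q * N q)) ->
    assoc_weight l (s * t) * (t ^+ k * X) <= C * C0.
Proof.
move=> lR s0 [A [H [A1 H1 AH]]]; have pl := Rset_positive_increasing lR.
have H0 : 0 < H by apply: lt_le_trans H1.
have A0 : 0 < A by apply: lt_le_trans A1.
have l1 : 0 < l 1%N by case: pl => + _; apply.
have sH : 0 < (s * H)^-1 by rewrite invr_gt0 mulr_gt0.
(* the shift by [k] pays for [t ^+ k], the factor for [s] and for (M.2) *)
exists (fun j => (s * H)^-1 * l (maxn 1 (j - k))).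
  exact: Rset_scale sH (Rset_shift k lR).
exists (N 0%N * A * H ^+ k * N k * ((s * H)^-1 * l 1%N) ^+ k).
  by rewrite !mulr_gt0 ?exprn_gt0 // mulr_gt0.
move=> t X C0 t0 X0 bX; set C := (X in X * C0).
have [->|Y0] := eqVneq (t ^+ k * X) 0.
  rewrite mulr0 mulr_ge0 //; first by rewrite ltW // !mulr_gt0 ?exprn_gt0 // mulr_gt0.
  have := bX 0%N; rewrite cumprod0 mul1r expr0 mul1r => h.
  by rewrite -(pmulr_lge0 _ (N0 0)) (le_trans X0) // mulrC.
have {}Y0 : 0 < t ^+ k * X by rewrite lt0r Y0 mulr_ge0 ?exprn_ge0.
rewrite -ler_pdivlMr //; apply: assoc_weight_le => p; rewrite ler_pdivlMr //.
have cp := cumprod_gt0 p pl.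
rewrite /assoc_term mulrAC ler_pdivrMr ?mulr_gt0 //.
rewrite exprMn [leLHS](_ : _ = s ^+ p * N 0%N * (t ^+ (p + k) * X)); last first.
  by rewrite exprD; ring.
apply: le_trans (ler_wpM2l _ (bX _)) _; first by rewrite ltW // mulr_gt0 ?exprn_gt0.
rewrite cumprod_scale cumprod_shift.
have C00 : 0 <= C0.
  have := bX 0%N; rewrite cumprod0 mul1r expr0 mul1r => h.
  by rewrite -(pmulr_lge0 _ (N0 0)) (le_trans X0) // mulrC.
apply: le_trans (_ : s ^+ p * N 0%N * (C0 * ((s * H)^-1 ^+ (p + k) *
  (l 1%N ^+ k * cumprod l p) * (A * H ^+ (p + k) * N p * N k))) <= _).
  rewrite ler_wpM2l //; first by rewrite ltW // mulr_gt0 ?exprn_gt0.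
  rewrite ler_wpM2l // ler_wpM2l //.
  by rewrite ltW // !mulr_gt0 ?exprn_gt0.
apply: le_of_eq; rewrite /C !exprMn !exprVn !exprMn !exprD.
have sp : s ^+ p != 0 by rewrite lt0r_neq0 ?exprn_gt0.
have sk : s ^+ k != 0 by rewrite lt0r_neq0 ?exprn_gt0.
have Hp : H ^+ p != 0 by rewrite lt0r_neq0 ?exprn_gt0.
have Hk : H ^+ k != 0 by rewrite lt0r_neq0 ?exprn_gt0.
by field; rewrite sp sk Hp Hk.
Qed.

End AssociatedFunction.

(** * A step function of class (M_p) *)

Section UltradifferentiableStep.
Variables (R : realType) (M : nat -> R).
Hypotheses (M0 : forall p, 0 < M p) (M3 : cond_M3' M).

Let q j : R := (M j.+1 / M j)^-1.

Let q_gt0 j : 0 < q j.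
Proof. by rewrite invr_gt0 divr_gt0. Qed.

(** Remainders of the convergent series of the inverse quotients. *)
Lemma M3_tail : exists T : nat -> R,
  [/\ forall j, 0 < T j, forall j, T j.+1 = T j - q j & T @ \oo --> 0].
Proof.
pose s k : R := \sum_(j < k) q j.
have sS k : s k.+1 = s k + q k by rewrite /s big_ord_recr.
have [S SP] : exists S, forall k, s k <= S.
  have t0 : (0 <= \sum_(1 <= p <oo) ((M p / M p.-1)^-1)%:E)%E.
    by apply: nneseries_ge0 => p _ _; rewrite lee_fin invr_ge0 divr_ge0 ?ltW.
  exists (fine (\sum_(1 <= p <oo) ((M p / M p.-1)^-1)%:E)%E) => k.
  rewrite -lee_fin fineK; last by rewrite ge0_fin_numE.
  apply: le_trans (nneseries_lim_ge k.+1 _); last first.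
    by move=> p _; rewrite lee_fin invr_ge0 divr_ge0 ?ltW.
  by rewrite sumEFin lee_fin big_add1 big_mkord.
have cs : cvgn s.
  apply: nondecreasing_is_cvgn; last by exists S => _ [k _ <-].
  by apply/nondecreasing_seqP => k; rewrite sS lerDl ltW.
pose T k : R := limn s - s k.
have sl k : s k <= limn s.
  apply: nondecreasing_cvgn_le => //.
  by apply/nondecreasing_seqP => j; rewrite sS lerDl ltW.
exists T; split=> [j|j|].
- by rewrite subr_gt0; apply: lt_le_trans (sl j.+1); rewrite sS ltrDl.
- by rewrite /T sS; ring.
- by rewrite -(subrr (limn s)); apply: cvgB => //; exact: cvg_cst.
Qed.

(** With [q j] the inverse quotients and [T j] the remainders of their
    series, the widths [q j / sqrt (T j)] still have a finite sum, since each is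
    at most twice the difference of two consecutive square roots; they exceed
    [q j] by a factor tending to infinity, and this gives every power [h ^+ p]
    in the estimate of the derivatives. *)
Lemma exists_ultradifferentiable_step : exists (w : nat -> R -> R) (d : R),
  [/\ 0 <= d, forall p x, is_derive x (1 : R) (w p) (w p.+1 x),
      forall h : R, 0 < h ->
        exists2 C, 0 < C & forall p x, `|w p x| <= C * (h ^+ p * M p),
      forall x, x <= - d -> w 0%N x = 0
    & forall x, d <= x -> w 0%N x = 1].
Proof.
have [T [T0 TS Tc]] := M3_tail.
pose t j := Num.sqrt (T j).
have t0 j : 0 < t j by rewrite sqrtr_gt0.
have tt j : t j * t j = T j by rewrite -expr2 sqr_sqrtr // ltW.
have tc : t @ \oo --> 0.
  rewrite -sqrtr0; apply: continuous_cvg => //; exact: sqrt_continuous.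
pose a j := q j / t j; pose b j := 2 * t j.
have a0 j : 0 < a j by rewrite divr_gt0.
have ab j : a j <= b j - b j.+1.
  rewrite /a ler_pdivrMr // (_ : q j = T j - T j.+1); last by rewrite TS; ring.
  rewrite -!tt /b; have := sqr_ge0 (t j - t j.+1); rewrite expr2; nra.
have bc : b @ \oo --> 0 by rewrite -[0](mulr0 2); exact: cvgMl_tmp.
have [w [wd wb w0 w1]] := exists_step a0 ab bc.
exists w, (b 0%N); split=> // [|h h0].
  by rewrite mulr_ge0 // ltW.
have [C C0 CP] := prod_null_le (fun j => ltW (t0 j)) tc h0.
exists (C / M 0%N); first by rewrite divr_gt0.
move=> p x; apply: le_trans (wb p x) _.
have E : \prod_(j < p) (a j)^-1 = (\prod_(j < p) t j) * (M p / M 0%N).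
  elim: p => [|p IH]; first by rewrite !big_ord0 divff ?mul1r // lt0r_neq0.
  rewrite !big_ord_recr /= IH /a /q invf_div invrK.
  by field; rewrite !lt0r_neq0.
rewrite E; apply: le_trans (ler_wpM2r _ (CP p)) _.
  by rewrite divr_ge0 // ltW.
by apply: le_of_eq; field; rewrite lt0r_neq0.
Qed.

End UltradifferentiableStep.

(** * Function spaces, functionals and translations *)

Section ComplexModulus.
Variable R : realType.
Implicit Types (z w : R[i]) (r : R).

Lemma cabsE z : cabs z = Num.sqrt (complex.Re z ^+ 2 + complex.Im z ^+ 2).
Proof. by rewrite /cabs normc_def. Qed.

Lemma cabs_normC z : `|z| = (cabs z)%:C%C.
Proof. by rewrite cabsE normc_def. Qed.

Lemma cabs_ge0 z : 0 <= cabs z.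
Proof. by rewrite cabsE sqrtr_ge0. Qed.

Lemma cabsD z w : cabs (z + w) <= cabs z + cabs w.
Proof.
have := ler_normD z w; rewrite !cabs_normC -[X in _ <= X]rmorphD lecR.
exact.
Qed.

Lemma cabsM z w : cabs (z * w) = cabs z * cabs w.
Proof.
have := normrM z w; rewrite !cabs_normC -[RHS]rmorphM.
exact: complexI.
Qed.

Lemma cabsN z : cabs (- z) = cabs z.
Proof. by rewrite /cabs normrN. Qed.

Lemma cabs0 : cabs (0 : R[i]) = 0.
Proof. by rewrite /cabs normr0. Qed.

Lemma cabsr r : cabs (r%:C)%C = `|r|.
Proof. by rewrite cabsE /= expr0n addr0 sqrtr_sqr. Qed.

Lemma cabs_Re z : `|complex.Re z| <= cabs z.
Proof. by rewrite cabsE -sqrtr_sqr ler_wsqrtr // lerDl sqr_ge0. Qed.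

Lemma cabs_Im z : `|complex.Im z| <= cabs z.
Proof. by rewrite cabsE -sqrtr_sqr ler_wsqrtr // lerDr sqr_ge0. Qed.

Lemma cabs_le_ReIm z : cabs z <= `|complex.Re z| + `|complex.Im z|.
Proof.
rewrite cabsE -[leRHS]ger0_norm ?addr_ge0 // -[leRHS]sqrtr_sqr ler_wsqrtr //.
rewrite sqrrD !real_normK ?num_real //.
by rewrite addrAC lerDl mulrn_wge0 // mulr_ge0.
Qed.

Lemma cabs_sum (I : Type) (r : seq I) (P : pred I) (F : I -> R[i]) :
  cabs (\sum_(i <- r | P i) F i) <= \sum_(i <- r | P i) cabs (F i).
Proof.
elim/big_rec2: _ => [|i y x _ H]; first by rewrite cabs0.
by apply: le_trans (cabsD _ _) _; rewrite lerD2l.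
Qed.

End ComplexModulus.

Section Spaces.
Variables (R : realType) (n : nat) (c : ucase) (M N : nat -> R).
Hypotheses (M0 : forall p, 0 < M p) (N0 : forall p, 0 < N p).
Implicit Types (a b l : nat -> R) (g h : 'rV[R]_n -> R)
  (phi psi : 'rV[R]_n -> R[i]) (K : set ('rV[R]_n -> R[i]))
  (f : ('rV[R]_n -> R[i]) -> R[i]) (s : seq 'I_n) (x t : 'rV[R]_n) (C : R).

Definition re phi x : R := complex.Re (phi x).
Definition im phi x : R := complex.Im (phi x).

(** The estimates defining the norms, with lists of indices instead of
    multi-indices and a power of the sup norm instead of a monomial. *)
Definition decays C a b g := forall s q t,
  `|t| ^+ q * `|pd s g t| <=
  C * (cumprod a (size s) * M (size s) * (cumprod b q * N q)).

Definition cdecays C a b phi := decays C a b (re phi) /\ decays C a b (im phi).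

Lemma csmoothE phi : csmooth phi = (smooth (re phi) /\ smooth (im phi)).
Proof. by []. Qed.

Let den_gt0 a b p q : positive_increasing a -> positive_increasing b ->
  0 < cumprod a p * M p * (cumprod b q * N q).
Proof. by move=> pa pb; rewrite !mulr_gt0 ?cumprod_gt0. Qed.

Lemma decays_ge0 C a b g : positive_increasing a -> positive_increasing b ->
  decays C a b g -> 0 <= C.
Proof.
move=> pa pb /(_ [::] 0%N 0) H.
rewrite -(pmulr_lge0 _ (den_gt0 0 0 pa pb)) //; apply: le_trans H.
by rewrite mulr_ge0 ?exprn_ge0.
Qed.

Lemma decays_le C C' a b g : positive_increasing a -> positive_increasing b ->
  C <= C' -> decays C a b g -> decays C' a b g.
Proof.
move=> pa pb CC H s q t; apply: le_trans (H s q t) _.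
by rewrite ler_wpM2r // ltW // den_gt0.
Qed.

Lemma cdecays_le C C' a b phi : positive_increasing a -> positive_increasing b ->
  C <= C' -> cdecays C a b phi -> cdecays C' a b phi.
Proof. by move=> pa pb CC [H1 H2]; split; apply: decays_le CC _. Qed.

Lemma mpow_le t beta : `|mpow t beta| <= `|t| ^+ mabs beta.
Proof.
rewrite /mpow /mabs normr_prod -prodrXr; apply: ler_prod => i _.
by rewrite normr_ge0 normrX lerXn2r ?nnegrE // rV_norm_coord.
Qed.

(** The sup norm of [t] is the modulus of a coordinate, hence a power of it
    is the modulus of a monomial, except when [t] vanishes. *)
Lemma mpow_attained t q :
  (exists2 beta, mabs beta = q & `|t| ^+ q = `|mpow t beta|) \/ `|t| ^+ q = 0.
Proof.
have [t0|/eqP t0] := eqVneq `|t| 0.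
  case: q => [|q]; last by right; rewrite t0 exprS mul0r.
  left; exists [ffun=> 0%N]; first by rewrite /mabs big1 // => i _; rewrite ffunE.
  by rewrite expr0 /mpow big1 ?normr1 // => i _; rewrite ffunE expr0.
have /rV_norm_witness [i ti] : `|t| != 0 by apply/eqP.
left; exists [ffun j => if j == i then q else 0%N].
  rewrite /mabs (bigD1 i) //= ffunE eqxx big1 ?addn0 // => j ji.
  by rewrite ffunE (negbTE ji).
rewrite /mpow (bigD1 i) //= ffunE eqxx big1 ?mulr1 ?normrX ?ti // => j ji.
by rewrite ffunE (negbTE ji) expr0.
Qed.

Lemma Snorm_le C a b phi : positive_increasing a -> positive_increasing b ->
  cdecays C a b phi -> (Snorm M N a b phi <= (2 * C)%:E)%E.
Proof.
move=> pa pb [H1 H2]; apply: ge_ereal_sup => _ [alpha [beta [t ->]]].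
have Dp := den_gt0 (mabs alpha) (mabs beta) pa pb; rewrite mulrA in Dp.
rewrite lee_fin ler_pdivrMr // cabsM cabsr.
apply: le_trans (_ : `|t| ^+ mabs beta *
    (`|pd (index_list alpha) (re phi) t| + `|pd (index_list alpha) (im phi) t|) <= _).
  apply: ler_pM => //; first exact: cabs_ge0.
    exact: mpow_le.
  by apply: le_trans (cabs_le_ReIm _) _; rewrite /= !mderivE.
have := lerD (H1 (index_list alpha) (mabs beta) t) (H2 (index_list alpha) (mabs beta) t).
rewrite !size_index_list -mulrDr => /le_trans; apply.
by rewrite -mulr2n mulr_natl mulrnAl !mulrA.
Qed.

(** Schwarz' theorem is what allows lists of indices in any order. *)
Lemma Snorm_decays C a b phi : positive_increasing a -> positive_increasing b ->
  csmooth phi -> (Snorm M N a b phi <= C%:E)%E -> cdecays C a b phi.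
Proof.
move=> pa pb [s1 s2] H.
have main s q t : `|t| ^+ q *
    Num.max `|pd s (re phi) t| `|pd s (im phi) t| <=
    C * (cumprod a (size s) * M (size s) * (cumprod b q * N q)).
  have bnd beta : cabs ((mpow t beta)%:C%C * cderiv (multiplicity s) phi t) <=
      C * (cumprod a (size s) * M (size s) * (cumprod b (mabs beta) * N (mabs beta))).
    rewrite -ler_pdivrMr ?den_gt0 // -lee_fin; apply: le_trans H.
    apply: ereal_sup_ubound; exists (multiplicity s), beta, t.
    by rewrite mabs_multiplicity mulrA.
  have C0 : 0 <= C.
    have := bnd [ffun=> 0%N]; move=> /(le_trans (cabs_ge0 _)).
    by rewrite pmulr_lge0 // den_gt0.
  have [[beta E ->]|->] := mpow_attained t q; last first.
    by rewrite mul0r mulr_ge0 // ltW // den_gt0.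
  rewrite -{}E; apply: le_trans (bnd beta); rewrite cabsM cabsr ler_wpM2l //.
  rewrite ge_max (pd_multiplicity s s1) (pd_multiplicity s s2).
  by rewrite (cabs_Re (cderiv _ _ _)) (cabs_Im (cderiv _ _ _)).
split=> s q t; apply: le_trans (main s q t); rewrite ler_wpM2l ?exprn_ge0 //.
  by rewrite le_max lexx.
by rewrite le_max lexx orbT.
Qed.

Lemma Rset_nonempty : exists a : nat -> R, Rset c a.
Proof.
case: c; first by exists (fun=> 1); exact: Rset_cst.
by have [a aR _] := slow_sequence R id; exists a.
Qed.

Lemma SspaceP phi : Sspace c M N phi <->
  csmooth phi /\ forall a b, Rset c a -> Rset c b -> exists C, cdecays C a b phi.
Proof.
split=> [H|[sm H] a b ar br].
  have [e eR] := Rset_nonempty.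
  split=> [|a b ar br]; first by case: (H e e eR eR).
  have [sm fin] := H a b ar br.
  have pa := Rset_positive_increasing ar; have pb := Rset_positive_increasing br.
  case E : (Snorm M N a b phi) fin => [r||] // _.
    by exists r; apply: Snorm_decays; rewrite ?E.
  by exists 0; apply: Snorm_decays; rewrite ?E // leNye.
split=> //; have [C HC] := H a b ar br.
apply: le_lt_trans (ltry (2 * C)); apply: Snorm_le => //.
  exact: Rset_positive_increasing ar.
exact: Rset_positive_increasing br.
Qed.

Lemma SboundedP K : Sbounded c M N K <->
  K `<=` Sspace c M N /\ forall a b, Rset c a -> Rset c b ->
    exists C, forall phi, K phi -> cdecays C a b phi.
Proof.
split=> -[KS H]; split=> // a b ar br; have {}H := H a b ar br;
  have pa := Rset_positive_increasing ar; have pb := Rset_positive_increasing br.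
  set S := ereal_sup _ in H.
  have KB phi : K phi -> (Snorm M N a b phi <= S)%E.
    by move=> Kp; apply: ereal_sup_ubound; exists phi.
  have sm phi : K phi -> csmooth phi by move=> /KS /SspaceP[].
  exists (fine S) => phi Kp; apply: Snorm_decays => //; first exact: sm.
  move: (KB phi Kp) H; case: S {KB} => [r||] //=.
  by rewrite leeNy_eq => /eqP -> _; rewrite leNye.
have [C HC] := H; apply: le_lt_trans (ltry (2 * C)).
by apply: ge_ereal_sup => _ [phi Kp <-]; apply: Snorm_le => //; exact: HC.
Qed.

Definition combine (r : R) phi psi : 'rV[R]_n -> R[i] := fun x => (r%:C)%C * phi x + psi x.

Lemma re_combine r phi psi :
  re (combine r phi psi) = fun x => r * re phi x + 1 * re psi x.
Proof.
by apply/funext => x; rewrite /re /combine; case: (phi x) (psi x) => [u v] [u' v'] /=; ring.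
Qed.

Lemma im_combine r phi psi :
  im (combine r phi psi) = fun x => r * im phi x + 1 * im psi x.
Proof.
by apply/funext => x; rewrite /im /combine; case: (phi x) (psi x) => [u v] [u' v'] /=; ring.
Qed.

Lemma csmooth_combine r phi psi : csmooth phi -> csmooth psi -> csmooth (combine r phi psi).
Proof.
rewrite !csmoothE re_combine im_combine => -[a1 a2] [b1 b2].
by split; apply: (proj1 (smooth_lincomb _ _ _ _)).
Qed.

Lemma pd_re_combine r phi psi s x : csmooth phi -> csmooth psi ->
  pd s (re (combine r phi psi)) x = r * pd s (re phi) x + pd s (re psi) x.
Proof.
move=> [a1 a2] [b1 b2]; rewrite re_combine (proj2 (smooth_lincomb _ _ a1 b1)).
by rewrite mul1r.
Qed.

Lemma pd_im_combine r phi psi s x : csmooth phi -> csmooth psi ->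
  pd s (im (combine r phi psi)) x = r * pd s (im phi) x + pd s (im psi) x.
Proof.
move=> [a1 a2] [b1 b2]; rewrite im_combine (proj2 (smooth_lincomb _ _ a2 b2)).
by rewrite mul1r.
Qed.

Lemma cdecays_combine r phi psi C1 C2 a b : csmooth phi -> csmooth psi ->
  cdecays C1 a b phi -> cdecays C2 a b psi ->
  cdecays (`|r| * C1 + C2) a b (combine r phi psi).
Proof.
move=> s1 s2 [a1 a2] [b1 b2].
split=> s q t; rewrite ?pd_re_combine ?pd_im_combine // mulrDl -(mulrA _ C1).
  apply: le_trans (_ : `|t| ^+ q * (`|r| * `|pd s (re phi) t| + `|pd s (re psi) t|) <= _).
    by rewrite ler_wpM2l ?exprn_ge0 // -normrM ler_normD.
  rewrite mulrDr mulrCA; apply: lerD; last exact: b1.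
  by rewrite ler_wpM2l.
apply: le_trans (_ : `|t| ^+ q * (`|r| * `|pd s (im phi) t| + `|pd s (im psi) t|) <= _).
  by rewrite ler_wpM2l ?exprn_ge0 // -normrM ler_normD.
rewrite mulrDr mulrCA; apply: lerD; last exact: b2.
by rewrite ler_wpM2l.
Qed.

Lemma Sspace_combine r phi psi : Sspace c M N phi -> Sspace c M N psi ->
  Sspace c M N (combine r phi psi).
Proof.
move=> /SspaceP[s1 H1] /SspaceP[s2 H2]; apply/SspaceP.
split=> [|a b ar br]; first exact: csmooth_combine.
have [C1 B1] := H1 a b ar br; have [C2 B2] := H2 a b ar br.
by exists (`|r| * C1 + C2); exact: cdecays_combine.
Qed.

Lemma csmooth0 : csmooth (fun _ : 'rV[R]_n => 0 : R[i]).
Proof. by split; exact: (proj1 (smooth_cst n (0 : R))). Qed.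

Lemma cdecays0 a b : cdecays 0 a b (fun=> 0).
Proof.
have E s t : pd s (fun _ : 'rV[R]_n => 0 : R) t = 0.
  by rewrite (proj2 (smooth_cst n (0 : R))); case: s.
by split=> s q t; rewrite mul0r [pd _ _ _]E normr0 mulr0.
Qed.

Lemma Sspace0 : Sspace c M N (fun _ : 'rV[R]_n => 0 : R[i]).
Proof.
by apply/SspaceP; split; [exact: csmooth0|move=> a b _ _; exists 0; exact: cdecays0].
Qed.

End Spaces.

Section DualAndTranslates.
Variables (R : realType) (n : nat) (c : ucase) (M N : nat -> R).
Hypotheses (M0 : forall p, 0 < M p) (N0 : forall p, 0 < N p) (N1 : cond_M1star N).
Implicit Types (a b l : nat -> R) (g h : 'rV[R]_n -> R)
  (phi psi : 'rV[R]_n -> R[i]) (K : set ('rV[R]_n -> R[i]))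
  (f : ('rV[R]_n -> R[i]) -> R[i]) (s : seq 'I_n) (x t : 'rV[R]_n) (C : R).

Lemma dual_combine f r phi psi : dual c M N f ->
  Sspace c M N phi -> Sspace c M N psi ->
  f (combine r phi psi) = (r%:C)%C * f phi + f psi.
Proof. by move=> [H _] Sp Sq; exact: H. Qed.

Lemma dual_zero f : dual c M N f -> f (fun=> 0) = 0.
Proof.
move=> df; have S0 := @Sspace0 R n c M N M0 N0.
have := dual_combine 1 df S0 S0; rewrite (_ : combine _ _ _ = fun=> 0); last first.
  by apply/funext => x; rewrite /combine mulr0 addr0.
by rewrite mul1r => /eqP; rewrite -subr_eq0 opprD addNKr oppr_eq0 => /eqP.
Qed.

Lemma cdecays_scale r phi X a b : csmooth phi -> cdecays M N X a b phi ->
  cdecays M N (`|r| * X) a b (combine r phi (fun=> 0)).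
Proof.
move=> sm H; have := cdecays_combine r sm (csmooth0 R n) H (cdecays0 n M N a b).
by rewrite addr0.
Qed.

(** Rescaling turns the neighbourhood of the origin on which [f] is less than
    one into a linear estimate. *)
Lemma dual_bound f : dual c M N f ->
  exists (k : nat) (a b : 'I_k -> nat -> R) (C : R),
  [/\ forall j, Rset c (a j) /\ Rset c (b j), 0 <= C &
      forall psi X, Sspace c M N psi -> 0 <= X ->
        (forall j, cdecays M N X (a j) (b j) psi) -> cabs (f psi) <= C * X].
Proof.
move=> df; have [_ cf] := df; have S0 := @Sspace0 R n c M N M0 N0.
have [k [a [b [e [ab e0 H]]]]] := cf _ S0 1 ltr01.
have pos psi X : Sspace c M N psi -> 0 < X ->
    (forall j, cdecays M N X (a j) (b j) psi) -> cabs (f psi) <= 4 / e * X.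
  move=> Sp X0 cd; pose r := e / (4 * X).
  have r0 : 0 < r by rewrite divr_gt0 // mulr_gt0.
  have Sr : Sspace c M N (combine r psi (fun=> 0)) by exact: Sspace_combine.
  have [sm _] := proj1 (SspaceP c M0 N0 psi) Sp.
  have : cabs (f (combine r psi (fun=> 0)) - f (fun=> 0)) < 1.
    apply: H => // j; have [aR bR] := ab j.
    have pa := Rset_positive_increasing aR; have pb := Rset_positive_increasing bR.
    rewrite (_ : (fun t => _) = combine r psi (fun=> 0)); last first.
      by apply/funext => t; rewrite subr0.
    apply: le_lt_trans (Snorm_le M0 N0 pa pb (cdecays_scale r sm (cd j))) _.
    rewrite lte_fin gtr0_norm // (_ : 2 * (r * X) = e / 2).
      by rewrite ltr_pdivrMr // ltr_pMr // ltr1n.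
    by rewrite /r; field; rewrite lt0r_neq0.
  rewrite dual_combine // dual_zero // subr0 addr0 cabsM cabsr gtr0_norm //.
  rewrite -ltr_pdivlMl // => /ltW /le_trans; apply.
  by apply: le_of_eq; rewrite /r; field; rewrite !lt0r_neq0.
exists k, a, b, (4 / e); split=> //; first by rewrite divr_ge0 // ltW.
move=> psi X Sp; rewrite le_eqVlt => /predU1P[<-|X0] cd; last exact: pos.
apply: le_of_forall_eps => d d0; rewrite mulr0 add0r.
have e4 : 0 < 4 / e by rewrite divr_gt0.
rewrite -[d](mulVKf (lt0r_neq0 e4)).
apply: pos => //; first by rewrite mulr_gt0 ?invr_gt0.
move=> j; have [aR bR] := ab j; apply: cdecays_le (cd j) => //.
- exact: Rset_positive_increasing aR.
- exact: Rset_positive_increasing bR.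
by rewrite mulr_ge0 ?invr_ge0 // ltW.
Qed.

Lemma dual_sum f (I : Type) (r : seq I) (F : I -> 'rV[R]_n -> R[i]) :
  dual c M N f -> (forall i, Sspace c M N (F i)) ->
  Sspace c M N (fun x => \sum_(i <- r) F i x) /\
  f (fun x => \sum_(i <- r) F i x) = \sum_(i <- r) f (F i).
Proof.
move=> df SF; elim: r => [|i r [IH1 IH2]].
  rewrite (_ : (fun x => _) = fun=> 0); last by apply/funext => x; rewrite big_nil.
  by rewrite big_nil; split; [exact: Sspace0|exact: dual_zero].
rewrite (_ : (fun x => _) = combine 1 (F i) (fun x => \sum_(i <- r) F i x)); last first.
  by apply/funext => x; rewrite big_cons /combine mul1r.
by split; [exact: Sspace_combine|rewrite dual_combine // IH2 big_cons mul1r].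
Qed.

Definition supported_in (r : R) phi := forall t, r < `|t| -> phi t = 0.

Definition uniform_bound C a g := forall s t,
  `|pd s g t| <= C * (cumprod a (size s) * M (size s)).

Definition cuniform_bound C a phi :=
  uniform_bound C a (re phi) /\ uniform_bound C a (im phi).

Lemma uniform_bound_ge0 C a g : uniform_bound C a g -> 0 <= C.
Proof.
move=> /(_ [::] 0); rewrite /= cumprod0 mul1r => /(le_trans (normr_ge0 _)).
by rewrite pmulr_lge0.
Qed.

Lemma cuniform0 a : cuniform_bound 0 a (fun=> 0).
Proof.
have E s t : pd s (fun _ : 'rV[R]_n => 0 : R) t = 0.
  by rewrite (proj2 (smooth_cst n (0 : R))); case: s.
by split=> s t; rewrite mul0r [pd _ _ _]E normr0.
Qed.

Lemma decays_of_uniform C a b g r : positive_increasing a -> positive_increasing b ->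
  (forall t, r < `|t| -> g t = 0) -> 0 <= r -> uniform_bound C a g ->
  decays M N (C * (assoc_weight N b r / N 0%N)) a b g.
Proof.
move=> pa pb gr r0 gb s q t.
have C0 : 0 <= C := uniform_bound_ge0 gb.
have AM : 0 <= C * (cumprod a (size s) * M (size s)).
  by rewrite mulr_ge0 // mulr_ge0 // ltW // cumprod_gt0.
have wN : 0 <= assoc_weight N b r / N 0%N * (cumprod b q * N q).
  rewrite ltW // mulr_gt0 // ?divr_gt0 ?(assoc_weight_gt0 N0 N1 pb r0) //.
  by rewrite mulr_gt0 ?cumprod_gt0.
have -> : C * (assoc_weight N b r / N 0%N) *
     (cumprod a (size s) * M (size s) * (cumprod b q * N q)) =
   assoc_weight N b r / N 0%N * (cumprod b q * N q) *
   (C * (cumprod a (size s) * M (size s))) by ring.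
have [tr|rt] := leP `|t| r.
  apply: ler_pM => //.
  apply: le_trans (power_le_assoc_weight N0 N1 q pb r0).
  by rewrite lerXn2r // nnegrE.
rewrite (@pd_support _ _ g _ s (@open_norm_gt R n r)) // normr0 mulr0.
by rewrite mulr_ge0.
Qed.

Definition reflection x phi : 'rV[R]_n -> R[i] := fun t => phi (x - t).

Lemma reflectE g x : (fun t => g (x - t)) = fun t => g (x + (-1) *: t).
Proof. by apply/funext => t; rewrite scaleN1r. Qed.

Lemma csmooth_reflection x phi : csmooth phi -> csmooth (reflection x phi).
Proof.
rewrite !csmoothE => -[s1 s2]; split.
  have -> : re (reflection x phi) = _ := reflectE (re phi) x.
  exact: (proj1 (smooth_affine x (-1) s1)).
have -> : im (reflection x phi) = _ := reflectE (im phi) x.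
exact: (proj1 (smooth_affine x (-1) s2)).
Qed.

Lemma pd_reflection g x s t : smooth g ->
  `|pd s (fun t => g (x - t)) t| = `|pd s g (x - t)|.
Proof.
move=> sg; rewrite reflectE (proj2 (smooth_affine x (-1) sg)) scaleN1r.
by rewrite normrM normrX normrN1 expr1n mul1r.
Qed.

(** Translation by [x] costs the growth of the associated function at
    [`|x| + r], uniformly in the test function. *)
Lemma cdecays_reflection C a b phi r x : positive_increasing a -> positive_increasing b ->
  csmooth phi -> supported_in r phi -> 0 <= r -> cuniform_bound C a phi ->
  cdecays M N (C * (assoc_weight N b (`|x| + r) / N 0%N)) a b (reflection x phi).
Proof.
move=> pa pb [s1 s2] sr r0 [u1 u2].
have far t : `|x| + r < `|t| -> reflection x phi t = 0.
  move=> xr; apply: sr; have := ler_normB x (x - t).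
  by rewrite opprB addrC subrK; lra.
split; apply: decays_of_uniform; rewrite ?addr_ge0 //.
- by move=> t /far xt; rewrite /re xt.
- by move=> s t; rewrite [leLHS](pd_reflection x s t s1); exact: u1.
- by move=> t /far xt; rewrite /im xt.
- by move=> s t; rewrite [leLHS](pd_reflection x s t s2); exact: u2.
Qed.

Lemma cuniform_of_Sspace phi a : Sspace c M N phi -> Rset c a ->
  exists C, cuniform_bound C a phi.
Proof.
move=> /(SspaceP c M0 N0)[_ H] aR; have [C [d1 d2]] := H a a aR aR.
exists (C * N 0%N); split=> s t.
  have := d1 s 0%N t; rewrite expr0 mul1r cumprod0 mul1r => /le_trans; apply.
  by apply: le_of_eq; ring.
have := d2 s 0%N t; rewrite expr0 mul1r cumprod0 mul1r => /le_trans; apply.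
by apply: le_of_eq; ring.
Qed.

Lemma Sspace_reflection phi r x : csmooth phi -> supported_in r phi -> 0 <= r ->
  (forall a, Rset c a -> exists C, cuniform_bound C a phi) ->
  Sspace c M N (reflection x phi).
Proof.
move=> sm sr r0 H; apply/(SspaceP c M0 N0).
split=> [|a b aR bR]; first exact: csmooth_reflection.
have [C HC] := H a aR; exists (C * (assoc_weight N b (`|x| + r) / N 0%N)).
by apply: cdecays_reflection => //; [exact: Rset_positive_increasing aR|exact: Rset_positive_increasing bR].
Qed.

Lemma reflection_involutive x phi : reflection x (reflection x phi) = phi.
Proof. by apply/funext => t; rewrite /reflection subKr. Qed.

(** Compactness of the support is kept as an inclusion in a ball, which
    behaves well under limits and products. *)
Lemma DspaceP phi : Dspace c M N phi <->
  exists2 r : R, 0 <= r & [/\ csmooth phi, supported_in r phi &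
    forall a, Rset c a -> exists C, cuniform_bound C a phi].
Proof.
split=> [[Sp /compact_bounded Kb]|[r r0 [sm sr ub]]].
  have [r [_ rP]] := Kb; exists (`|r| + 1); first by rewrite addr_ge0.
  split=> [|t rt|a aR]; first by case: (proj1 (SspaceP c M0 N0 _) Sp).
    apply/eqP; apply: contraTT rt => pt; rewrite -leNgt; apply: rP.
      by rewrite (le_lt_trans (ler_norm r)) // ltrDl.
    by apply: subset_closure.
  exact: cuniform_of_Sspace.
split.
  have sm' := csmooth_reflection 0 sm.
  have sr' : supported_in r (reflection 0 phi).
    by move=> t rt; apply: sr; rewrite sub0r normrN.
  suff ub' a : Rset c a -> exists C, cuniform_bound C a (reflection 0 phi).
    by have := Sspace_reflection 0 sm' sr' r0 ub'; rewrite reflection_involutive.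
  move=> aR; have [C [u1 u2]] := ub a aR; have [s1 s2] := sm.
  exists C; split=> s t; first by rewrite [leLHS](pd_reflection 0 s t s1).
  by rewrite [leLHS](pd_reflection 0 s t s2).
have sub : closure [set x | phi x != 0] `<=` [set x | `|x| <= r].
  have cl : closed [set x : 'rV[R]_n | `|x| <= r].
    rewrite (_ : mkset _ = ~` [set x : 'rV[R]_n | r < `|x|]).
      by apply: open_closedC; exact: open_norm_gt.
    by apply/seteqP; split=> x /=; rewrite leNgt => /negP.
  have pr : [set x | phi x != 0] `<=` [set x : 'rV[R]_n | `|x| <= r].
    by move=> x /= px; rewrite leNgt; apply: contra px => /sr ->.
  by move=> x /(closure_subset pr); rewrite -(proj1 (closure_id _) cl).
apply: bounded_closed_compact; last exact: closed_closure.
exists r; split; first exact: num_real.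
by move=> y ry x /sub /= xr; apply: le_trans xr (ltW ry).
Qed.

End DualAndTranslates.

(** * Uniform boundedness on test functions *)

Section GlidingHump.
Variable R : realType.

(** A principle of uniform boundedness which only asks for the convergence of
    certain series: if no bound holds on any [E k], one builds a sum
    [sigma = \sum_i r_i psi_i], where [psi_i] is a hump for the seminorm
    [p (l_i)] which dominates the part of the sum already built, and where the
    later terms are so small for [p (l_i)] that they cannot destroy it; then
    [p (l_i) sigma] is unbounded. *)
Lemma gliding_hump (F L : Type) (acc : R -> F -> F -> F) (z0 : F) (D : set F)
    (E : nat -> set F) (p : L -> F -> R) :
  (forall l r psi S, D S -> D psi -> 0 <= r ->
     r * p l psi <= p l (acc r psi S) + p l S /\
     p l S <= p l (acc r psi S) + r * p l psi) ->
  D z0 -> (forall k, E k `<=` D) ->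
  (forall r psi S, D S -> D psi -> D (acc r psi S)) ->
  (forall l, exists k C, forall psi, E k psi -> p l psi <= C) ->
  (forall k k', (k <= k')%N -> E k' `<=` E k) ->
  (forall (psi S : nat -> F) (r : nat -> R), (forall i, E i (psi i)) ->
     (forall i, 0 <= r i <= 2^-1 ^+ i) -> S 0%N = z0 ->
     (forall i, S i.+1 = acc (r i) (psi i) (S i)) ->
     exists2 sigma, D sigma & forall l e, 0 < e ->
       exists i0, forall i, (i0 <= i)%N -> p l (S i) <= p l sigma + e) ->
  (forall psi, D psi -> exists C, forall l, p l psi <= C) ->
  exists k C, forall l psi, E k psi -> p l psi <= C.
Proof.
move=> psub D0 ED Dacc pcont Edec conv ptbd; apply: contrapT => nub.
have bad k C : exists o : L * F, E k o.2 /\ C < p o.1 o.2.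
  apply: contrapT => /forallNP H; apply: nub; exists k, C => l psi Ek.
  by rewrite leNgt; apply/negP => lt; apply: (H (l, psi)).
have half0 i : 0 < 2^-1 ^+ i :> R by rewrite exprn_gt0 // invr_gt0.
pose St := (F * nat * R)%type.
(* a state consists of the partial sum [T], and of [K] and [G] such that the
   seminorms already chosen are bounded by [G] on [E K] *)
pose Q (x : nat * St) (o : F * L * R * (nat * R)) :=
  let: (i, (T, K, G)) := x in let: (psi, l, r, (K', G')) := o in
  D T -> 0 <= G ->
  [/\ E (maxn K i) psi, 0 <= r <= 2^-1 ^+ i, r * G <= 2^-1 ^+ i,
      ((K <= K')%N /\ G <= G') & (forall psi', E K' psi' -> p l psi' <= G') /\
      i%:R + 3 <= p l (acc r psi T)].
have step x : exists o, Q x o.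
  case: x => i [[T K] G].
  have [[DS G0]|nH] := pselect (D T /\ 0 <= G); last first.
    have [[l psi] _] := bad 0%N 0.
    by exists (psi, l, 0, (0%N, 0)) => /= DS G0; exfalso; apply: nH.
  have G1 : 0 < 1 + G by rewrite ltr_pwDl.
  have [CS CSP] := ptbd T DS; pose r : R := 2^-1 ^+ i / (1 + G).
  have r0 : 0 < r by rewrite divr_gt0.
  have [[l psi] /= [Epsi big]] := bad (maxn K i) ((i%:R + 3 + CS) / r).
  have [k [C kC]] := pcont l.
  exists (psi, l, r, (maxn K k, Num.max G C)) => _ _; split.
  - exact: Epsi.
  - rewrite ltW //= /r ler_pdivrMr // ler_pMr //; lra.
  - by rewrite /r mulrAC ler_pdivrMr // ler_pM2l //; lra.
  - by rewrite leq_maxl le_max lexx.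
  - split=> [psi' /(Edec _ _ (leq_maxr K k)) /kC /le_trans|].
      by apply; rewrite le_max lexx orbT.
    have [H _] := psub l r psi T DS (ED _ _ Epsi) (ltW r0).
    move: big; rewrite ltr_pdivrMr // mulrC; have := CSP l; lra.
have [nx nxP] := choice step.
pose st := fix st i : St := if i is j.+1 then
  let: (psi, l, r, (K', G')) := nx (j, st j) in (acc r psi (st j).1.1, K', G')
  else (z0, 0%N, 0).
pose T i := (st i).1.1; pose K i := (st i).1.2; pose G i := (st i).2.
pose psi i := (nx (i, st i)).1.1.1; pose l i := (nx (i, st i)).1.1.2.
pose r i := (nx (i, st i)).1.2.
have stS i : [/\ T i.+1 = acc (r i) (psi i) (T i),
    K i.+1 = (nx (i, st i)).2.1 & G i.+1 = (nx (i, st i)).2.2].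
  by rewrite /T /K /G /r /psi /=; case: (nx _) => [[[? ?] ?] [? ?]].
have QP i : D (T i) -> 0 <= G i ->
  [/\ E (maxn (K i) i) (psi i), 0 <= r i <= 2^-1 ^+ i, r i * G i <= 2^-1 ^+ i,
      ((K i <= K i.+1)%N /\ G i <= G i.+1) &
      (forall psi', E (K i.+1) psi' -> p (l i) psi' <= G i.+1) /\
      i%:R + 3 <= p (l i) (T i.+1)].
  have [-> -> ->] := stS i; have := nxP (i, st i).
  rewrite /Q /T /K /G /r /psi /l; case: (st i) => [[? ?] ?] /=.
  by case: (nx _) => [[[? ?] ?] [? ?]].
have inv i : D (T i) /\ 0 <= G i.
  elim: i => [|i [DS G0]]; first by split.
  have [Ei _ _ [_ GG] _] := QP i DS G0; have [-> _ _] := stS i.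
  by split; [apply: Dacc => //; exact: ED Ei|exact: le_trans GG].
have {}QP i := QP i (proj1 (inv i)) (proj2 (inv i)).
have Kmono i j : (i <= j)%N -> (K i <= K j)%N /\ G i <= G j.
  elim: j => [|j IH]; first by rewrite leqn0 => /eqP ->.
  rewrite leq_eqVlt => /predU1P[->//|]; rewrite ltnS => /IH[A1 A2].
  have [_ _ _ [B1 B2] _] := QP j.
  by split; [exact: leq_trans B1|exact: le_trans B2].
have Epsi i : E i (psi i).
  by have [+ _ _ _ _] := QP i; apply: Edec; exact: leq_maxr.
have [sigma Dsigma sP] : exists2 sigma, D sigma & forall l e, 0 < e ->
    exists i0, forall i, (i0 <= i)%N -> p l (T i) <= p l sigma + e.
  apply: (conv psi T r) => // i; first by have [] := QP i.
  by have [] := stS i.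
have tail i m : p (l i) (T i.+1) <=
    p (l i) (T (i.+1 + m)%N) + (2 * 2^-1 ^+ i.+1 - 2 * 2^-1 ^+ (i.+1 + m)).
  elim: m => [|m IH]; first by rewrite addn0 subrr addr0.
  rewrite addnS; set j := (i.+1 + m)%N in IH *.
  have [A1 A2] := Kmono i.+1 j (leq_addr _ _).
  have [Ej /andP[r0 _] rG _ _] := QP j.
  have [_ _ _ _ [H _]] := QP i.
  have small : r j * p (l i) (psi j) <= 2^-1 ^+ j.
    apply: le_trans rG; rewrite ler_wpM2l //; apply: le_trans A2; apply: H.
    by apply: Edec Ej; apply: leq_trans A1 (leq_maxl _ _).
  have [_ B] := psub (l i) (r j) (psi j) (T j) (proj1 (inv j)) (ED _ _ Ej) r0.
  have [EjS _ _] := stS j; rewrite -EjS in B; rewrite (exprS _ j).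
  have : 2 * (2^-1 * 2^-1 ^+ j) = 2^-1 ^+ j :> R by rewrite mulrA divff ?mul1r // pnatr_eq0.
  lra.
have [C CP] := ptbd sigma Dsigma.
pose i := Num.bound `|C|.
have iC : C < i%:R by apply: le_lt_trans (ler_norm C) (archi_boundP (normr_ge0 C)).
have [i0 i0P] := sP (l i) 1 ltr01.
have := i0P (i.+1 + i0)%N (leq_addl _ _); have := tail i i0; have := CP (l i).
have [_ _ _ _ [_ big]] := QP i.
have : 2 * 2^-1 ^+ i.+1 <= 2 :> R.
  by rewrite ler_piMr // exprn_ile1 ?invr_ge0 // invf_le1 // ler1n.
have : 0 <= 2 * 2^-1 ^+ (i.+1 + i0) :> R by rewrite mulr_ge0 // ltW.
lra.
Qed.

End GlidingHump.

Section UniformBoundedness.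
Variables (R : realType) (n : nat) (c : ucase) (M N : nat -> R).
Hypotheses (M0 : forall p, 0 < M p) (N0 : forall p, 0 < N p) (N1 : cond_M1star N).
Implicit Types (a b l : nat -> R) (g : 'rV[R]_n -> R)
  (phi psi : 'rV[R]_n -> R[i]) (f : ('rV[R]_n -> R[i]) -> R[i])
  (s : seq 'I_n) (x t : 'rV[R]_n) (C : R).

Lemma cvg_shift_add (u : nat -> R) (l : R) k : u @ \oo --> l ->
  (fun m => u (k + m)%N) @ \oo --> l.
Proof.
rewrite -(cvg_shiftn k) => H.
by rewrite (_ : (fun m => u (k + m)%N) = fun m => u (m + k)%N) //; apply/funext => m; rewrite addnC.
Qed.

(** Covers both cases: [h k = 1 / k.+1] for constant sequences, which form a
    countable filtering family, and [h] constant for sequences tending to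
    infinity, which dominate every geometric sequence. *)
Definition cofinal_powers (h : nat -> R) :=
  [/\ forall k, 0 < h k, forall k, h k.+1 <= h k &
      forall a, Rset c a -> exists k C, 0 <= C /\ forall p, h k ^+ p <= C * cumprod a p].

Lemma cofinal_powers_homo h : cofinal_powers h -> forall i j, (i <= j)%N -> h j <= h i.
Proof.
move=> [_ hdec _] i; elim=> [|j IH]; first by rewrite leqn0 => /eqP ->.
by rewrite leq_eqVlt => /predU1P[->//|]; rewrite ltnS => /IH; apply: le_trans.
Qed.

Definition test_function (r : R) psi := [/\ csmooth psi, supported_in r psi &
  forall a, Rset c a -> exists C, cuniform_bound M C a psi].

Lemma test_function_Dspace r psi : 0 <= r -> test_function r psi -> Dspace c M N psi.
Proof. by move=> r0 H; apply/(DspaceP _ M0 N0 N1); exists r. Qed.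

Lemma test_function_Sspace r x psi : 0 <= r -> test_function r psi ->
  Sspace c M N (reflection x psi).
Proof. by move=> r0 [sm sr ub]; exact: (Sspace_reflection M0 N0 N1 x sm sr r0 ub). Qed.

Lemma cuniform_le C C' a phi : positive_increasing a -> C <= C' ->
  cuniform_bound M C a phi -> cuniform_bound M C' a phi.
Proof.
move=> pa CC [u1 u2]; split=> s t; [apply: le_trans (u1 s t) _|apply: le_trans (u2 s t) _];
  by rewrite ler_wpM2r // ltW // mulr_gt0 // cumprod_gt0.
Qed.

Lemma cuniform_weight C C' a a' phi : (forall p, cumprod a p <= C' * cumprod a' p) ->
  0 <= C -> cuniform_bound M C a phi -> cuniform_bound M (C * C') a' phi.
Proof.
move=> aa C0 [u1 u2]; split=> s t; [apply: le_trans (u1 s t) _|apply: le_trans (u2 s t) _];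
  by rewrite -mulrA ler_wpM2l // mulrA ler_wpM2r // ltW.
Qed.

Lemma cuniform_combine r phi psi C1 C2 a : csmooth phi -> csmooth psi ->
  cuniform_bound M C1 a phi -> cuniform_bound M C2 a psi ->
  cuniform_bound M (`|r| * C1 + C2) a (combine r phi psi).
Proof.
move=> s1 s2 [a1 a2] [b1 b2].
split=> s t; rewrite ?pd_re_combine ?pd_im_combine // mulrDl -(mulrA _ C1);
  apply: le_trans (ler_normD _ _) _; apply: lerD; rewrite ?normrM ?ler_wpM2l //.
Qed.

Lemma test_function_combine r e psi phi : test_function r psi -> test_function r phi ->
  test_function r (combine e psi phi).
Proof.
move=> [s1 sp1 u1] [s2 sp2 u2]; split=> [|t rt|a aR].
- exact: csmooth_combine.
- by rewrite /combine sp1 // sp2 // mulr0 addr0.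
have [C1 b1] := u1 a aR; have [C2 b2] := u2 a aR.
by exists (`|e| * C1 + C2); exact: cuniform_combine.
Qed.

Lemma test_function0 r : test_function r (fun=> 0).
Proof.
split=> [|//|a aR]; first exact: csmooth0.
by exists 0; exact: cuniform0.
Qed.

(** For a fixed translation, the seminorms of the dual bound see a test function
    only through one of its uniform bounds; the same estimate gives continuity
    of the functionals on test functions and convergence along the series. *)
Lemma dual_translate_bound h f x r : cofinal_powers h -> dual c M N f -> 0 <= r ->
  exists k C, 0 <= C /\ forall psi Y, test_function r psi -> 0 <= Y ->
    cuniform_bound M Y (fun=> h k) psi -> cabs (f (reflection x psi)) <= C * Y.
Proof.
move=> hP df r0; have [h0 hdec hcof] := hP; have [k [a [b [C [ab C0 H]]]]] := dual_bound M0 N0 df.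
have [kj kjP] := choice (fun j => hcof (a j) (proj1 (ab j))).
have [Cj CjP] := choice kjP.
pose K := (\max_(j < k) kj j)%N.
pose W j := assoc_weight N (b j) (`|x| + r) / N 0%N.
have pa j := Rset_positive_increasing (proj1 (ab j)).
have pb j := Rset_positive_increasing (proj2 (ab j)).
have xr : 0 <= `|x| + r by rewrite addr_ge0.
have W0 j : 0 <= W j by rewrite ltW // divr_gt0 // (assoc_weight_gt0 N0 N1).
have hmono := cofinal_powers_homo hP.
exists K, (C * \sum_(j < k) Cj j * W j); split.
  by rewrite mulr_ge0 // sumr_ge0 // => j _; rewrite mulr_ge0 //; case: (CjP j).
move=> psi Y tf Y0 ub; rewrite -mulrA.
apply: H; first exact: test_function_Sspace tf.
  by rewrite mulr_ge0 // sumr_ge0 // => j _; rewrite mulr_ge0 //; case: (CjP j).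
move=> j; have [Cj0 CjB] := CjP j; have [sm sr _] := tf.
have ubj : cuniform_bound M (Y * Cj j) (a j) psi.
  apply: cuniform_weight ub => // p; rewrite cumprod_cst.
  apply: le_trans (CjB p); rewrite lerXn2r ?nnegrE ?(ltW (h0 _)) //.
  by apply: hmono; exact: (leq_bigmax j).
apply: cdecays_le (cdecays_reflection M0 N0 N1 x (pa j) (pb j) sm sr r0 ubj) => //.
rewrite -/(W j) -mulrA mulrC ler_wpM2r // (bigD1 j) //= lerDl sumr_ge0 // => i _.
by rewrite mulr_ge0 //; case: (CjP i).
Qed.

(** The powers [h k] decrease along the series, so that its remainder after [k]
    terms is small for [h k], not only for [h 0]: this is what makes the sum a
    test function in the Beurling case. *)
Lemma test_function_series h r (psi S : nat -> 'rV[R]_n -> R[i]) (e : nat -> R) :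
  cofinal_powers h ->
  (forall i, test_function r (psi i)) ->
  (forall i, cuniform_bound M 1 (fun=> h i) (psi i)) ->
  (forall i, 0 <= e i <= 2^-1 ^+ i) -> S 0%N = (fun=> 0) ->
  (forall i, S i.+1 = combine (e i) (psi i) (S i)) ->
  (forall i, test_function r (S i)) /\
  exists2 sigma, test_function r sigma & forall k i, (k <= i)%N ->
    cuniform_bound M (2 * 2^-1 ^+ i) (fun=> h k) (combine (-1) sigma (S i)).
Proof.
move=> hP tp up e01 S0 SS; have [h0 hdec hcof] := hP.
have tS i : test_function r (S i).
  elim: i => [|i IH]; first by rewrite S0; exact: test_function0.
  by rewrite SS; exact: test_function_combine.
split=> //.
have hmono := cofinal_powers_homo hP.
have smS i : csmooth (S i) by case: (tS i).
have smp i : csmooth (psi i) by case: (tp i).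
have geo (K : R) : (fun m => 2 * 2^-1 ^+ m * K) @ \oo --> 0.
  rewrite -(mul0r K); apply: cvgMr_tmp; rewrite -(mulr0 2); apply: cvgMl_tmp.
  by apply: cvg_expr; rewrite ger0_norm ?invr_ge0 // invf_lt1 // ltr1n.
have half i : 2 * 2^-1 ^+ i.+1 = 2^-1 ^+ i :> R.
  by rewrite exprS mulrA divff ?mul1r // pnatr_eq0.
(* one argument for the real and for the imaginary parts *)
have lim (u v : nat -> 'rV[R]_n -> R) : (forall i, smooth (u i)) ->
    (forall s i t, pd s (u i.+1) t = e i * pd s (v i) t + pd s (u i) t) ->
    (forall i, uniform_bound M 1 (fun=> h i) (v i)) ->
    (forall i t, r < `|t| -> u i t = 0) ->
    exists g, [/\ smooth g, forall t, r < `|t| -> g t = 0 & forall k i, (k <= i)%N ->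
      forall s t, `|pd s (u i) t - pd s g t| <= 2 * 2^-1 ^+ i * (h k ^+ size s * M (size s))].
  move=> su uS vb us.
  have cauchy k s t m : `|pd s (u (k + m.+1)%N) t - pd s (u (k + m)%N) t| <=
      2 * 2^-1 ^+ (k + m) * (h k ^+ size s * M (size s)) -
      2 * 2^-1 ^+ (k + m.+1) * (h k ^+ size s * M (size s)).
    rewrite -mulrBl addnS half mulr_natl mulr2n addrK uS addrK normrM.
    have /andP[e0 e1] := e01 (k + m)%N; apply: ler_pM => //; first by rewrite ger0_norm.
    apply: le_trans (vb _ s t) _; rewrite mul1r cumprod_cst ler_wpM2r ?(ltW (M0 _)) //.
    by rewrite lerXn2r ?nnegrE ?(ltW (h0 _)) // hmono // leq_addr.
  pose F s t := limn (fun m => pd s (u m) t).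
  have FP k s t : (fun m => pd s (u (k + m)%N) t) @ \oo --> F s t /\ forall m,
      `|pd s (u (k + m)%N) t - F s t| <= 2 * 2^-1 ^+ (k + m) * (h k ^+ size s * M (size s)).
    have gk : (fun m => 2 * 2^-1 ^+ (k + m) * (h k ^+ size s * M (size s))) @ \oo --> 0.
      exact: (cvg_shift_add k (geo (h k ^+ size s * M (size s)))).
    have [l0 cl0 _] := telescope_cvg (cauchy 0%N s t)
       (geo (h 0%N ^+ size s * M (size s))).
    have [lk clk lkP] := telescope_cvg (cauchy k s t) gk.
    have El0 : F s t = l0 by exact: cvg_lim cl0.
    have Elk : lk = F s t.
      by rewrite El0 -(cvg_lim (@Rhausdorff R) clk) (cvg_lim (@Rhausdorff R) (cvg_shift_add k cl0)).
    by rewrite -Elk.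
  have [sF pF] := @smooth_lim R n u F (fun s m => 2 * 2^-1 ^+ m * (h 0%N ^+ size s * M (size s)))
    su (fun s => geo _) (fun s m t => (proj2 (FP 0%N s t)) m).
  exists (F [::]); split=> [//|t rt|k i ki s t].
    have [+ _] := FP 0%N [::] t.
    rewrite (_ : (fun m => _) = fun=> 0) => [/(cvg_lim (@Rhausdorff R)) <-|].
      by rewrite lim_cst.
    by apply/funext => m; exact: us.
  by rewrite pF -(subnKC ki); exact: (proj2 (FP k s t)).
have [g1 [sg1 z1 b1]] := lim (fun i => re (S i)) (fun i => re (psi i))
  (fun i => proj1 (smS i))
  (fun s i t => etrans (congr1 (fun S' => pd s (re S') t) (SS i))
                       (pd_re_combine _ s t (smp i) (smS i)))
  (fun i => proj1 (up i))
  (fun i t rt => congr1 (@complex.Re R) (let: And3 _ sr _ := tS i in sr t rt)).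
have [g2 [sg2 z2 b2]] := lim (fun i => im (S i)) (fun i => im (psi i))
  (fun i => proj2 (smS i))
  (fun s i t => etrans (congr1 (fun S' => pd s (im S') t) (SS i))
                       (pd_im_combine _ s t (smp i) (smS i)))
  (fun i => proj2 (up i))
  (fun i t rt => congr1 (@complex.Im R) (let: And3 _ sr _ := tS i in sr t rt)).
pose sigma : 'rV[R]_n -> R[i] := fun t => (g1 t +i* g2 t)%C.
have ssig : csmooth sigma by split; [exact: sg1|exact: sg2].
have close k i : (k <= i)%N ->
    cuniform_bound M (2 * 2^-1 ^+ i) (fun=> h k) (combine (-1) sigma (S i)).
  move=> ki; split=> s t; rewrite cumprod_cst.
    by rewrite (pd_re_combine (-1) s t ssig (smS i)) mulN1r addrC; exact: b1.
  by rewrite (pd_im_combine (-1) s t ssig (smS i)) mulN1r addrC; exact: b2.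
exists sigma => //; split=> // [t rt|a aR].
  by rewrite /sigma z1 // z2.
have [k [C [C0 hC]]] := hcof a aR; have [_ _ /(_ a aR)[C1 bC1]] := tS k.
have pa := Rset_positive_increasing aR.
exists (`|-1| * (2 * 2^-1 ^+ k * C) + C1).
have -> : sigma = combine (-1) (combine (-1) sigma (S k)) (S k).
  apply/funext => t; rewrite /combine (_ : ((-1)%:C)%C = -1 :> R[i]).
    by rewrite !mulN1r opprD opprK subrK.
  by rewrite rmorphN1.
have h20 : 0 <= 2 * 2^-1 ^+ k :> R by rewrite mulr_ge0 // exprn_ge0 // invr_ge0.
have hCa p : cumprod (fun=> h k) p <= C * cumprod a p by rewrite cumprod_cst.
have cW := cuniform_weight hCa h20 (close k k (leqnn k)).
exact: (cuniform_combine (-1) (csmooth_combine (-1) ssig (smS k)) (smS k) cW bC1).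
Qed.

(** The gliding hump is applied to the seminorms which send [psi] to
    [cabs (f * psi (x)) / w x], on the test functions supported in a ball. *)
Lemma uniform_convolution_bound (B : set (('rV[R]_n -> R[i]) -> R[i]))
    (w : 'rV[R]_n -> R) h r : B `<=` dual c M N -> (forall x, 0 < w x) ->
  cofinal_powers h -> 0 <= r ->
  (forall psi, Dspace c M N psi ->
     exists C, forall f x, B f -> cabs (convolution f psi x) <= C * w x) ->
  exists k C, forall f x psi, B f -> test_function r psi ->
    cuniform_bound M 1 (fun=> h k) psi -> cabs (convolution f psi x) <= C * w x.
Proof.
move=> Bd w0 hP r0 H; have [h0 hdec hcof] := hP.
pose L := {o : (('rV[R]_n -> R[i]) -> R[i]) * 'rV[R]_n | `[<B o.1>]}.
pose p (o : L) psi := cabs ((sval o).1 (reflection (sval o).2 psi)) / w (sval o).2.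
have hmono := cofinal_powers_homo hP.
have lin (o : L) e psi phi : test_function r psi -> test_function r phi ->
    (sval o).1 (reflection (sval o).2 (combine e psi phi)) =
    (e%:C)%C * (sval o).1 (reflection (sval o).2 psi) + (sval o).1 (reflection (sval o).2 phi).
  move=> tp tf; case: o => [[f x] /= /asboolP /Bd df].
  by apply: (dual_combine e df); [exact: test_function_Sspace tp|exact: test_function_Sspace tf].
have Lw (o : L) : 0 < (w (sval o).2)^-1 by rewrite invr_gt0.
have conc := @gliding_hump R ('rV[R]_n -> R[i]) L (@combine R n) (fun=> 0)
  [set psi | test_function r psi]
  (fun k => [set psi | test_function r psi /\ cuniform_bound M 1 (fun=> h k) psi]) p.
have {conc} [||||||||k [C CP]] := conc.
- move=> o e psi phi tp tf e0; rewrite /p lin // !mulrA -!mulrDl.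
  set u := (sval o).1 _; set v := (sval o).1 _.
  split; rewrite ler_pM2r //.
    rewrite -{1}(ger0_norm e0) -cabsr -cabsM.
    by have := cabsD ((e%:C)%C * u + v) (- v); rewrite addrK cabsN.
  rewrite -{2}(ger0_norm e0) -(cabsr e) -cabsM.
  by have := cabsD ((e%:C)%C * u + v) (- ((e%:C)%C * u)); rewrite addrC addKr cabsN.
- exact: test_function0.
- by move=> k psi [].
- by move=> e psi phi tp tf; exact: test_function_combine.
- move=> o; have [k [C [C0 CP]]] := dual_translate_bound (sval o).2 hP
    (Bd _ (asboolW (valP o))) r0.
  exists k, (C / w (sval o).2) => psi [tf ub].
  by rewrite /p ler_pM2r // -[C]mulr1; exact: CP.
- move=> k k' kk psi [tf ub]; split=> //; rewrite -[1]mulr1.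
  apply: cuniform_weight ub => // m; rewrite !cumprod_cst mul1r.
  by rewrite lerXn2r ?nnegrE ?(ltW (h0 _)) // hmono.
- move=> psi S e Ep e01 S0 SS.
  have [tS [sigma ts close]] := test_function_series hP (fun i => proj1 (Ep i))
    (fun i => proj2 (Ep i)) e01 S0 SS.
  exists sigma => // o d d0.
  have [k [C [C0 CP]]] := dual_translate_bound (sval o).2 hP
    (Bd _ (asboolW (valP o))) r0.
  have : (fun i => C / w (sval o).2 * 2 * 2^-1 ^+ i) @ \oo --> 0.
    rewrite -[0](mulr0 (C / w (sval o).2 * 2)); apply: cvgMl_tmp.
    by apply: cvg_expr; rewrite ger0_norm ?invr_ge0 // invf_lt1 // ltr1n.
  move=> /cvgrPdist_le /(_ d d0)[i0 _ i0P]; exists (maxn i0 k) => i.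
  rewrite geq_max => /andP[i0i ki]; have := i0P i i0i; rewrite /= sub0r normrN => Hi.
  have tc : test_function r (combine (-1) sigma (S i)) by exact: test_function_combine.
  have h20 : 0 <= 2 * 2^-1 ^+ i :> R by rewrite mulr_ge0 // exprn_ge0 // invr_ge0.
  have := CP _ _ tc h20 (close k i ki); rewrite lin //.
  set u := (sval o).1 _; set v := (sval o).1 _ => Huv.
  have : cabs v <= cabs u + C * (2 * 2^-1 ^+ i).
    have := cabsD u (((-1)%:C)%C * u + v); rewrite addrA (_ : u + _ = 0) ?add0r.
      by move=> /le_trans; apply; rewrite lerD2l.
    by rewrite rmorphN1 mulN1r subrr.
  rewrite /p -/u -/v -(ler_pM2r (Lw o)) mulrDl => /le_trans; apply; rewrite lerD2l.
  apply: le_trans Hi; apply: le_trans (ler_norm _).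
  by apply: le_of_eq; ring.
- move=> psi tp; have [C CP] := H psi (test_function_Dspace r0 tp).
  exists C => o; rewrite /p ler_pdivrMr //; apply: CP.
  exact: asboolW (valP o).
exists k, C => f x psi Bf tp ub.
have := CP (exist _ (f, x) (asboolT Bf)) psi (conj tp ub).
by rewrite /p /= ler_pdivrMr.
Qed.

End UniformBoundedness.

(** * Localization by a partition of unity *)

Section Localization.
Variables (R : realType) (n : nat) (c : ucase) (M N : nat -> R).
Hypotheses (M0 : forall p, 0 < M p) (N0 : forall p, 0 < N p).
Hypotheses (M1 : cond_M1 M) (N2 : cond_M2 N).
Implicit Types (a b l : nat -> R) (g chi : 'rV[R]_n -> R)
  (phi psi : 'rV[R]_n -> R[i]) (f : ('rV[R]_n -> R[i]) -> R[i])
  (s : seq 'I_n) (x t : 'rV[R]_n) (C : R).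

Lemma weight_supermul a p q : positive_increasing a ->
  (cumprod a p * M p) * (cumprod a q * M q) <= M 0%N * (cumprod a (p + q) * M (p + q)%N).
Proof.
move=> pa; rewrite mulrACA (mulrCA (M 0%N)).
have A0 k := ltW (cumprod_gt0 k pa).
apply: ler_pM; rewrite ?mulr_ge0 ?(ltW (M0 _)) //; first exact: cumprod_supermul.
exact: log_convex_supermul.
Qed.

Lemma prod_log_convex (I : Type) (r : seq I) (p : I -> nat) :
  M 0%N * \prod_(i <- r) M (p i) <= M 0%N ^+ size r * M (\sum_(i <- r) p i)%N.
Proof.
elim: r => [|i r IH] /=; first by rewrite !big_nil expr0 mulrC.
rewrite !big_cons mulrCA.
apply: le_trans (ler_wpM2l (ltW (M0 _)) IH) _.
rewrite mulrCA exprSr -mulrA ler_wpM2l ?exprn_ge0 ?(ltW (M0 _)) //.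
exact: log_convex_supermul.
Qed.

Lemma uniform_bound_tensor (v : nat -> R -> R) (o : 'I_n -> R) C h : 0 < h ->
  (forall p y, is_derive y (1 : R) (v p) (v p.+1 y)) ->
  (forall p y, `|v p y| <= C * (h ^+ p * M p)) ->
  smooth (fun x => \prod_i v 0%N (x 0 i + o i)) /\
  uniform_bound M (C ^+ n * M 0%N ^+ n / M 0%N) (fun=> h)
    (fun x : 'rV[R]_n => \prod_i v 0%N (x 0 i + o i)).
Proof.
move=> h0 vd vb.
have [|sm pE] := @smooth_tensor R n (fun i p y => v p (y + o i)).
  by move=> i p y; exact: is_derive_translate.
split=> // s t; rewrite pE normr_prod cumprod_cst.
have C0 : 0 <= C.
  have := vb 0%N 0; rewrite expr0 mul1r => /(le_trans (normr_ge0 _)).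
  by rewrite pmulr_lge0.
apply: le_trans (_ : \prod_i (C * (h ^+ count_mem i s * M (count_mem i s))) <= _).
  by apply: ler_prod => i _; rewrite normr_ge0 vb.
rewrite big_split /= prodr_const cardT size_enum_ord -!mulrA ler_wpM2l ?exprn_ge0 //.
rewrite big_split /= prodrXr.
have -> : (\sum_(i < n) count_mem i s)%N = size s.
  by rewrite -mabs_multiplicity; apply: eq_bigr => i _; rewrite ffunE.
have := prod_log_convex (index_enum 'I_n) (fun i => count_mem i s).
have -> : size (index_enum 'I_n) = n by rewrite [index_enum _]unlock -enumT size_enum_ord.
have -> : (\sum_(i <- index_enum 'I_n) count_mem i s)%N = size s.
  by rewrite -mabs_multiplicity; apply: eq_bigr => i _; rewrite ffunE.
move=> H; apply: le_trans (_ : h ^+ size s * (M 0%N ^+ n * M (size s) / M 0%N) <= _).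
  by rewrite ler_wpM2l ?exprn_ge0 ?(ltW h0) // ler_pdivlMr // mulrC.
by apply: le_of_eq; ring.
Qed.

Lemma leibniz_weight g chi a C1 C2 s t : positive_increasing a ->
  smooth g -> smooth chi -> 0 <= C1 -> 0 <= C2 ->
  (forall s', `|pd s' g t| <= C1 * (cumprod a (size s') * M (size s'))) ->
  (forall s', `|pd s' chi t| <= C2 * (cumprod a (size s') * M (size s'))) ->
  `|pd s (fun y => g y * chi y) t| <=
    C1 * C2 * M 0%N * (cumprod (fun j => 2 * a j) (size s) * M (size s)).
Proof.
move=> pa sg sc C10 C20 bg bc; rewrite cumprod_scale -[2 ^+ _ * _ * _]mulrA.
exact: (@leibniz_bound _ _ g chi (fun p => cumprod a p * M p) (M 0%N) C1 C2 t s sg sc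
  C10 C20 (fun p q => weight_supermul p q pa) bg bc).
Qed.

Definition localize chi phi : 'rV[R]_n -> R[i] := fun t => phi t * (chi t)%:C%C.

Lemma re_localize chi phi : re (localize chi phi) = fun t => re phi t * chi t.
Proof.
by apply/funext => t; rewrite /re /localize; case: (phi t) => u v /=; ring.
Qed.

Lemma im_localize chi phi : im (localize chi phi) = fun t => im phi t * chi t.
Proof.
by apply/funext => t; rewrite /im /localize; case: (phi t) => u v /=; ring.
Qed.

Lemma csmooth_localize chi phi : smooth chi -> csmooth phi -> csmooth (localize chi phi).
Proof.
rewrite !csmoothE re_localize im_localize => sc [s1 s2].
by split; apply: (proj1 (smooth_mul _ _)).
Qed.

Lemma exists_small_power a : Rset c a ->
  exists2 h, 0 < h & exists2 C, 0 < C & forall p, h ^+ p <= C * cumprod a p.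
Proof.
have [eB|eR] : c = Beurling \/ c = Roumieu by case: c; [left|right].
  rewrite eB => -[k k0 ak]; exists k => //; exists 1 => // p.
  by rewrite mul1r (eq_cumprod ak) cumprod_cst.
rewrite eR => aR; exists 1 => //.
exact: Roumieu_dominates_powers.
Qed.

Lemma shift_weight b : Rset c b -> exists2 b', Rset c b' & exists2 C, 0 < C &
  forall q, cumprod b' q.+1 * N q.+1 <= C * (cumprod b q * N q).
Proof.
move=> bR; have [A [H [A1 H1 AH]]] := N2.
have pb := Rset_positive_increasing bR.
have H0 : 0 < H by apply: lt_le_trans H1.
have A0 : 0 < A by apply: lt_le_trans A1.
have b1 : 0 < b 1%N by case: pb => + _; apply.
exists (fun j => H^-1 * b (maxn 1 (j - 1))).
  by apply: Rset_scale; [rewrite invr_gt0|exact: Rset_shift].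
exists (b 1%N * A * N 1%N); first by rewrite !mulr_gt0.
move=> q; rewrite -(addn1 q) cumprod_scale cumprod_shift expr1 exprVn.
apply: le_trans (ler_wpM2l _ (AH q 1%N)) _.
  by rewrite ltW // !mulr_gt0 ?invr_gt0 ?exprn_gt0 ?cumprod_gt0.
have Hq : H ^+ (q + 1) != 0 by rewrite lt0r_neq0 ?exprn_gt0.
by apply: le_of_eq; field.
Qed.

End Localization.

Section Reconstruction.
Variables (R : realType) (n : nat) (c : ucase) (M N : nat -> R).
Hypotheses (M0 : forall p, 0 < M p) (N0 : forall p, 0 < N p) (N1 : cond_M1star N).
Hypotheses (M1 : cond_M1 M) (N2 : cond_M2 N).
Implicit Types (a b l : nat -> R) (g chi : 'rV[R]_n -> R)
  (phi psi : 'rV[R]_n -> R[i]) (f : ('rV[R]_n -> R[i]) -> R[i])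
  (s : seq 'I_n) (x t : 'rV[R]_n) (C : R).

Lemma euclid_ge0 x : 0 <= euclid x.
Proof. exact: sqrtr_ge0. Qed.

Lemma norm_le_euclid x : `|x| <= euclid x.
Proof.
apply: rV_normP; first exact: euclid_ge0.
move=> i; rewrite -sqrtr_sqr ler_wsqrtr // (bigD1 i) //= lerDl.
by rewrite sumr_ge0 // => j _; rewrite sqr_ge0.
Qed.

Lemma euclid_le_norm x : euclid x <= n%:R * `|x|.
Proof.
rewrite -[leRHS]ger0_norm ?mulr_ge0 // -[leRHS]sqrtr_sqr ler_wsqrtr //.
apply: le_trans (_ : \sum_(i < n) `|x| ^+ 2 <= _).
  apply: ler_sum => i _; rewrite -[x 0 i ^+ 2]real_normK ?num_real //.
  by rewrite lerXn2r ?nnegrE // rV_norm_coord.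
rewrite sumr_const card_ord -[leLHS]mulr_natl exprMn ler_wpM2r ?sqr_ge0 // -natrX ler_nat.
by case: n => // m; rewrite expnS expn1 leq_pmulr.
Qed.

(** The decay of [g] at [t], hence near [x], wins against the weight at [x]
    and leaves a factor that is summable over the integer points [x]. *)
Lemma decay_at_center l (r : R) : Rset c l -> 0 <= r ->
  exists2 b, Rset c b & exists2 C, 0 < C & forall h g C0 x t s, 0 < h ->
    decays M N C0 (fun=> h) b g -> `|x - t| <= r ->
    `|pd s g t| <= C * C0 / (assoc_weight N l (euclid x) * \prod_i (1 + `|x 0 i|) ^+ 2)
      * (cumprod (fun=> h) (size s) * M (size s)).
Proof.
move=> lR r0; have pl := Rset_positive_increasing lR.
have r1 : 0 < n.+1%:R * (1 + r) by rewrite mulr_gt0 // ltr_pwDl.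
(* [2 * n] powers of [t] pay for the product, and [euclid x] is at most
   [n.+1 * (1 + r)] times the maximum of [1] and of the norm of [t] *)
have [b bR [C1 C10 bP]] := assoc_weight_absorb N0 (2 * n) lR r1 N2.
have pb := Rset_positive_increasing bR.
have W1 := assoc_weight_gt0 N0 N1 pb ler01.
exists b => //; exists ((2 + r) ^+ (2 * n) * (C1 * (1 + assoc_weight N b 1))).
  have r2 : 0 < 2 + r by rewrite ltr_pwDl.
  by rewrite mulr_gt0 ?exprn_gt0 // mulr_gt0 // addr_gt0.
move=> h g C0 x t s h0 dg xt.
have D0 : 0 < cumprod (fun=> h) (size s) * M (size s) by rewrite mulr_gt0 // cumprod_gt0.
set D := cumprod (fun=> h) (size s) * M (size s) in D0 *.
have W0 := assoc_weight_gt0 N0 N1 pl (euclid_ge0 x).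
have P0 : 0 < \prod_i (1 + `|x 0 i|) ^+ 2.
  by apply: prodr_gt0 => i _; rewrite exprn_gt0 // ltr_pwDl.
rewrite -ler_pdivrMr // ler_pdivlMr ?mulr_gt0 //.
set X := `|pd s g t| / D; set tau := Num.max `|t| 1.
have X0 : 0 <= X by rewrite divr_ge0 // ltW.
have tau1 : 1 <= tau by rewrite le_max lexx orbT.
have ttau : `|t| <= tau by rewrite le_max lexx.
have tau0 : 0 <= tau by apply: le_trans tau1.
have dec q : `|t| ^+ q * X <= C0 * (cumprod b q * N q).
  rewrite [leLHS]mulrA ler_pdivrMr // -mulrA [_ * D]mulrC; exact: dg.
have decay q : tau ^+ q * X <= C0 * (1 + assoc_weight N b 1) * (cumprod b q * N q).
  apply: le_trans (_ : (`|t| ^+ q + 1) * X <= _).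
    rewrite ler_wpM2r // /tau; case: (leP `|t| 1) => _; first by rewrite expr1n lerDr exprn_ge0.
    by rewrite lerDl.
  rewrite mulrDl mul1r mulrDr mulr1 mulrDl; apply: lerD; first exact: dec.
  have := dec 0%N; rewrite expr0 cumprod0 !mul1r => /le_trans; apply.
  have C00 : 0 <= C0.
    have := dec 0%N; rewrite expr0 cumprod0 !mul1r => /(le_trans X0).
    by rewrite pmulr_lge0.
  rewrite -mulrA ler_wpM2l //.
  have := power_le_assoc_weight N0 N1 q pb ler01; rewrite expr1n => H.
  by move: H; rewrite mulrAC ler_pdivlMr // mul1r.
have xtau : `|x| <= (1 + r) * tau.
  have := ler_normD (x - t) t; rewrite subrK => /le_trans; apply.
  rewrite mulrDl mul1r addrC lerD // -[leLHS]mulr1; apply: ler_pM => //.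
have e1 : assoc_weight N l (euclid x) <= assoc_weight N l (n.+1%:R * (1 + r) * tau).
  apply: assoc_weight_homo => //; first exact: euclid_ge0.
  apply: le_trans (euclid_le_norm x) _; rewrite -mulrA; apply: ler_pM => //.
  by rewrite ler_nat.
have e2 : \prod_i (1 + `|x 0 i|) ^+ 2 <= (2 + r) ^+ (2 * n) * tau ^+ (2 * n).
  rewrite -exprMn exprM -[X in _ ^+ X](card_ord n) -prodr_const.
  apply: ler_prod => i _; rewrite exprn_ge0 ?addr_ge0 //=.
  rewrite lerXn2r ?nnegrE ?addr_ge0 ?mulr_ge0 ?addr_ge0 //.
  have := rV_norm_coord x i; have : (2 + r) * tau = tau + (1 + r) * tau by ring.
  by move=> -> H; apply: lerD => //; exact: le_trans H xtau.
have := bP tau X _ tau0 X0 decay => main.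
apply: le_trans (_ : X * (assoc_weight N l (n.+1%:R * (1 + r) * tau) *
   ((2 + r) ^+ (2 * n) * tau ^+ (2 * n))) <= _).
  by rewrite ler_wpM2l //; apply: ler_pM => //; exact: ltW.
have := ler_wpM2l (exprn_ge0 (2 * n) (addr_ge0 (ler0n R 2) r0)) main.
rewrite (_ : X * _ = (2 + r) ^+ (2 * n) *
  (assoc_weight N l (n.+1%:R * (1 + r) * tau) * (tau ^+ (2 * n) * X))); last by ring.
by move=> /le_trans; apply; apply: le_of_eq; ring.
Qed.

Section Partition.
Variables (w : nat -> R -> R) (d : R).
Hypotheses (d0 : 0 <= d) (wd : forall p y, is_derive y (1 : R) (w p) (w p.+1 y))
  (wb : forall h : R, 0 < h ->
     exists2 C, 0 < C & forall p y, `|w p y| <= C * (h ^+ p * M p))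
  (w0 : forall y, y <= - d -> w 0%N y = 0) (w1 : forall y, d <= y -> w 0%N y = 1).

Definition pulse p y : R := w p y - w p (y - 1).

Definition plateau (m : nat) p y : R := w p (y + m%:R) - w p (y - m%:R - 1).

Lemma pulse_derive p y : is_derive y (1 : R) (pulse p) (pulse p.+1 y).
Proof. by apply: is_deriveB => //; exact: is_derive_translate. Qed.

Lemma plateau_derive m p y : is_derive y (1 : R) (plateau m p) (plateau m p.+1 y).
Proof.
rewrite /plateau; apply: is_deriveB; first exact: is_derive_translate.
rewrite -addrA (_ : (fun y => _) = fun y => w p (y + (- m%:R - 1))).
  exact: is_derive_translate.
by apply/funext => z; rewrite addrA.
Qed.

Lemma pulse_bound h : 0 < h ->
  exists2 C, 0 < C & forall p y, `|pulse p y| <= C * (h ^+ p * M p).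
Proof.
move=> h0; have [C C0 CP] := wb h0; exists (2 * C); first by rewrite mulr_gt0.
move=> p y; apply: le_trans (ler_normB _ _) _.
by have := CP p y; have := CP p (y - 1); lra.
Qed.

Lemma plateau_bound h : 0 < h ->
  exists2 C, 0 < C & forall m p y, `|plateau m p y| <= C * (h ^+ p * M p).
Proof.
move=> h0; have [C C0 CP] := wb h0; exists (2 * C); first by rewrite mulr_gt0.
move=> m p y; apply: le_trans (ler_normB _ _) _.
by have := CP p (y + m%:R); have := CP p (y - m%:R - 1); lra.
Qed.

Lemma pulse_support y : 1 + d < `|y| -> pulse 0 y = 0.
Proof.
rewrite /pulse ltr_normr => /orP[H|H].
  by rewrite !w1 ?subrr //; lra.
by rewrite !w0 ?subrr //; lra.
Qed.

Lemma plateau_eq1 m y : `|y| <= m%:R - d -> plateau m 0 y = 1.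
Proof.
rewrite ler_norml => /andP[H1 H2]; rewrite /plateau w1 ?w0 ?subr0 //; lra.
Qed.

Lemma sum_pulse m y : \sum_(j < (2 * m).+1) pulse 0 (y + (m%:R - j%:R)) = plateau m 0 y.
Proof.
have T k : \sum_(j < k) pulse 0 (y + (m%:R - j%:R)) = w 0%N (y + m%:R) - w 0%N (y + m%:R - k%:R).
  elim: k => [|k IH]; first by rewrite big_ord0 subr0 subrr.
  rewrite big_ord_recr /= IH /pulse addrA addrA subrK; congr (_ - w _ _).
  by rewrite -addn1 natrD; ring.
rewrite T /plateau; congr (_ - w _ _).
by rewrite -addn1 natrD natrM; ring.
Qed.

Local Notation grid m := {ffun 'I_n -> 'I_(2 * m).+1}.

Definition piece m (k : grid m) x : R := \prod_i pulse 0 (x 0 i + (m%:R - (k i)%:R)).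

(** The offset [0] gives the factors the form used in [uniform_bound_tensor]. *)
Definition cut m x : R := \prod_i plateau m 0 (x 0 i + 0).

Definition center m (k : grid m) : 'rV[R]_n := \row_i ((k i)%:R - m%:R).

Lemma sum_pieces m x : \sum_k piece (k : grid m) x = cut m x.
Proof.
rewrite /piece /cut -(bigA_distr_bigA (fun i j => pulse 0 (x 0 i + (m%:R - (j : 'I__)%:R)))).
by apply: eq_bigr => i _; rewrite addr0 sum_pulse.
Qed.

(** The part of [phi] near a grid point, moved to the origin and reflected, so
    that [f] evaluates on that part as a convolution at the grid point. *)
Definition local_part m (k : grid m) phi := reflection (center k) (localize (piece k) phi).

Lemma smooth_piece m (k : grid m) : smooth (piece k).
Proof.
have [C C0 CP] := pulse_bound ltr01.
exact: (proj1 (uniform_bound_tensor M0 M1 _ ltr01 pulse_derive CP)).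
Qed.

Lemma piece_bound h : 0 < h ->
  exists2 C, 0 < C & forall m (k : grid m), uniform_bound M C (fun=> h) (piece k).
Proof.
move=> h0; have [C C0 CP] := pulse_bound h0.
exists (C ^+ n * M 0%N ^+ n / M 0%N); first by rewrite divr_gt0 ?mulr_gt0 ?exprn_gt0.
by move=> m k; exact: (proj2 (uniform_bound_tensor M0 M1 _ h0 pulse_derive CP)).
Qed.

Lemma csmooth_local_part m (k : grid m) phi : csmooth phi -> csmooth (local_part k phi).
Proof.
move=> sm; apply: csmooth_reflection; apply: csmooth_localize => //.
exact: smooth_piece.
Qed.

Lemma local_part_supported m (k : grid m) phi : supported_in (1 + d) (local_part k phi).
Proof.
move=> t dt; have [|i ti] := @rV_norm_witness _ _ t.
  by rewrite gt_eqF // (le_lt_trans _ dt) // addr_ge0.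
rewrite /local_part /reflection /localize /piece (bigD1 i) //= pulse_support.
  by rewrite mul0r mulr0.
rewrite !mxE; have -> : (k i)%:R - m%:R - t 0 i + (m%:R - (k i)%:R) = - t 0 i by ring.
by rewrite normrN -ti.
Qed.

(** Outside the ball of radius [1 + d] there is nothing to prove, and inside it
    the bounds on [phi] are only needed close to the grid point. *)
Lemma local_part_bound a C1 C2 m (k : grid m) phi : positive_increasing a ->
  csmooth phi -> 0 <= C1 -> 0 <= C2 -> uniform_bound M C2 a (piece k) ->
  (forall t, `|center k - t| <= 1 + d -> forall s,
     `|pd s (re phi) t| <= C1 * (cumprod a (size s) * M (size s)) /\
     `|pd s (im phi) t| <= C1 * (cumprod a (size s) * M (size s))) ->
  cuniform_bound M (C1 * C2 * M 0%N) (fun j => 2 * a j) (local_part k phi).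
Proof.
move=> pa sm C10 C20 uk H; have [s1 s2] := sm.
have pa2 : positive_increasing (fun j => 2 * a j).
  by case: pa => a0 a1; split=> p p1; rewrite ?mulr_gt0 ?a0 // ler_pM2l // a1.
have B0 s : 0 <= C1 * C2 * M 0%N * (cumprod (fun j => 2 * a j) (size s) * M (size s)).
  by rewrite !mulr_ge0 ?(ltW (M0 _)) // ltW // cumprod_gt0.
have [sl1 sl2] := csmooth_localize (smooth_piece k) sm.
have near g t s : smooth g -> `|t| <= 1 + d ->
    (forall s', `|pd s' g (center k - t)| <= C1 * (cumprod a (size s') * M (size s'))) ->
    `|pd s (fun y => g y * piece k y) (center k - t)| <=
    C1 * C2 * M 0%N * (cumprod (fun j => 2 * a j) (size s) * M (size s)).
  move=> sg td Hg.
  exact: (leibniz_weight M0 M1 s pa sg (smooth_piece k) C10 C20 Hg (fun s' => uk s' _)).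
have close t : `|t| <= 1 + d -> `|center k - (center k - t)| <= 1 + d by rewrite subKr.
split=> s t; have [td|dt] := leP `|t| (1 + d).
- rewrite [leLHS](pd_reflection (center k) s t sl1) -/(re _) re_localize.
  exact: near s1 td (fun s' => proj1 (H _ (close t td) s')).
- rewrite (@pd_support _ _ _ _ s (@open_norm_gt R n (1 + d))) ?normr0 //.
  by move=> y dy; rewrite /re local_part_supported.
- rewrite [leLHS](pd_reflection (center k) s t sl2) -/(im _) im_localize.
  exact: near s2 td (fun s' => proj2 (H _ (close t td) s')).
- rewrite (@pd_support _ _ _ _ s (@open_norm_gt R n (1 + d))) ?normr0 //.
  by move=> y dy; rewrite /im local_part_supported.
Qed.

Lemma half_twice a : (fun j => 2 * (2^-1 * a j)) = a.
Proof. by apply/funext => j; rewrite mulVKf // pnatr_eq0. Qed.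

Lemma local_part_test_function m (k : grid m) phi : Sspace c M N phi ->
  test_function c M (1 + d) (local_part k phi).
Proof.
move=> Sp; have [sm _] := proj1 (SspaceP c M0 N0 _) Sp.
split=> [||a aR]; first exact: csmooth_local_part.
  exact: local_part_supported.
have aR' : Rset c (fun j => 2^-1 * a j) by apply: Rset_scale => //; rewrite invr_gt0.
have pa' := Rset_positive_increasing aR'.
have [C1 [u1 u2]] := cuniform_of_Sspace M0 N0 Sp aR'.
have [h h0 [C2 C20 hC]] := exists_small_power aR'.
have [C3 C30 uk] := piece_bound h0.
have C10 : 0 <= C1 := uniform_bound_ge0 M0 u1.
exists (C1 * (C3 * C2) * M 0%N); rewrite -[a in cuniform_bound _ _ a _]half_twice.
have uk' : uniform_bound M (C3 * C2) (fun j => 2^-1 * a j) (piece k).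
  move=> s t; apply: le_trans (uk m k s t) _; rewrite -mulrA ler_wpM2l ?(ltW C30) //.
  by rewrite mulrA ler_wpM2r ?(ltW (M0 _)) // cumprod_cst.
have C320 : 0 <= C3 * C2 by rewrite mulr_ge0 // ltW.
by apply: (local_part_bound pa' sm C10 C320 uk') => t _ s; split; [exact: u1|exact: u2].
Qed.

End Partition.
End Reconstruction.

(** * From convolutions to bounded sets *)

Section Sufficiency.
Variables (R : realType) (n : nat) (c : ucase) (M N : nat -> R).
Hypotheses (M0 : forall p, 0 < M p) (N0 : forall p, 0 < N p) (N1 : cond_M1star N).
Hypotheses (M1 : cond_M1 M) (N2 : cond_M2 N).
Implicit Types (a b l : nat -> R) (g chi : 'rV[R]_n -> R)
  (phi psi : 'rV[R]_n -> R[i]) (f : ('rV[R]_n -> R[i]) -> R[i])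
  (s : seq 'I_n) (x t : 'rV[R]_n) (C : R).

Local Notation grid m := {ffun 'I_n -> 'I_(2 * m).+1}.

(** The two new terms at each step are below the increment of the right-hand
    side, whose value for [m = 0] is exact. *)
Lemma sum_inverse_squares m :
  \sum_(j < (2 * m).+1) ((1 + `|j%:R - m%:R|) ^+ 2)^-1 <= 5 - 4 / (1 + m%:R) :> R.
Proof.
elim: m => [|m IH].
  by rewrite muln0 big_ord1 /= !mulr0n subrr normr0 !addr0 expr1n invr1; lra.
have -> : (2 * m.+1).+1 = (2 * m).+1.+2 by rewrite mulnS.
rewrite big_ord_recr big_ord_recl /=.
have E : \sum_(j < (2 * m).+1) ((1 + `|(bump 0 j)%:R - m.+1%:R|) ^+ 2)^-1 =
    \sum_(j < (2 * m).+1) ((1 + `|j%:R - m%:R|) ^+ 2)^-1 :> R.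
  apply: eq_bigr => j _; congr ((1 + `|_|) ^+ 2)^-1.
  by rewrite /bump /= natrD -[m.+1]addn1 natrD; ring.
rewrite E.
have m0 : 0 <= m%:R :> R by [].
have mS : m.+1%:R = m%:R + 1 :> R by rewrite -addn1 natrD.
have e1 : `|0%:R - m.+1%:R| = m%:R + 1 :> R by rewrite sub0r normrN mS ger0_norm // addr_ge0.
have e2 : `|(2 * m).+2%:R - m.+1%:R| = m%:R + 1 :> R.
  rewrite (_ : (2 * m).+2%:R - m.+1%:R = m%:R + 1) ?ger0_norm ?addr_ge0 //.
  by rewrite mS -addn2 natrD natrM; ring.
rewrite e1 e2 mS.
have p1 : 0 < 1 + m%:R :> R by lra.
have p2 : 0 < 2 + m%:R :> R by lra.
have -> : 1 + (m%:R + 1) = 2 + m%:R :> R by ring.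
apply: le_trans (_ : 5 - 4 / (1 + m%:R) + 2 * ((2 + m%:R) ^+ 2)^-1 <= _).
  by move: IH; lra.
have i2 : ((2 + m%:R) ^+ 2)^-1 <= (1 + m%:R)^-1 * (2 + m%:R)^-1 :> R.
  by rewrite expr2 invfM ler_wpM2r ?invr_ge0 ?(ltW p2) // lef_pV2 ?posrE //; lra.
have i3 : (1 + m%:R)^-1 * (2 + m%:R)^-1 = (1 + m%:R)^-1 - (2 + m%:R)^-1 :> R.
  by field; rewrite !lt0r_neq0.
have i4 : 0 <= ((2 + m%:R) ^+ 2)^-1 :> R by rewrite invr_ge0 exprn_ge0 // ltW.
lra.
Qed.

Lemma grid_sum_bound m :
  \sum_(k : grid m) (\prod_i (1 + `|center R k 0 i|) ^+ 2)^-1 <= 5 ^+ n.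
Proof.
have -> : \sum_(k : grid m) (\prod_i (1 + `|center R k 0 i|) ^+ 2)^-1 =
    \sum_(k : grid m) \prod_i ((1 + `|(k i)%:R - m%:R|) ^+ 2)^-1 :> R.
  apply: eq_bigr => k _; rewrite -prodfV; apply: eq_bigr => i _; by rewrite mxE.
rewrite -(bigA_distr_bigA (fun (i : 'I_n) (j : 'I_(2 * m).+1) => ((1 + `|j%:R - m%:R|) ^+ 2)^-1)).
rewrite prodr_const cardT size_enum_ord lerXn2r ?nnegrE //.
  by apply: sumr_ge0 => j _; rewrite invr_ge0 exprn_ge0.
apply: le_trans (sum_inverse_squares m) _.
by rewrite gerBl divr_ge0.
Qed.

Variables (w : nat -> R -> R) (d : R).
Hypotheses (d0 : 0 <= d) (wd : forall p y, is_derive y (1 : R) (w p) (w p.+1 y))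
  (wb : forall h : R, 0 < h ->
     exists2 C, 0 < C & forall p y, `|w p y| <= C * (h ^+ p * M p))
  (w0 : forall y, y <= - d -> w 0%N y = 0) (w1 : forall y, d <= y -> w 0%N y = 1).

Local Notation cutoff m := (fun x : 'rV[R]_n => 1 - cut w m x).

Lemma smooth_cut m : smooth (cut w m : 'rV[R]_n -> R).
Proof.
have [C C0 CP] := plateau_bound wb ltr01.
exact: (proj1 (uniform_bound_tensor M0 M1 (fun=> 0) ltr01 (plateau_derive wd m) (CP m))).
Qed.

Lemma cutoff_lincomb m : cutoff m = fun x => 1 * (fun=> 1) x + (-1) * cut w m x.
Proof. by apply/funext => x; rewrite mulr1 mulN1r. Qed.

Lemma smooth_cutoff m : smooth (cutoff m).
Proof.
rewrite cutoff_lincomb; apply: (proj1 (smooth_lincomb _ _ _ _)).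
  exact: (proj1 (smooth_cst n (1 : R))).
exact: smooth_cut.
Qed.

Lemma cutoff_bound a : Rset c a ->
  exists2 C, 0 <= C & forall m, uniform_bound M C a (cutoff m).
Proof.
move=> aR; have pa := Rset_positive_increasing aR.
have [h h0 [C2 C20 hC]] := exists_small_power aR.
have [C C0 CP] := plateau_bound wb h0.
exists ((M 0%N)^-1 + C ^+ n * M 0%N ^+ n / M 0%N * C2).
  by rewrite addr_ge0 ?invr_ge0 ?(ltW (M0 _)) // ltW // mulr_gt0 // divr_gt0 // mulr_gt0 ?exprn_gt0.
move=> m s t.
have [_ ub] := uniform_bound_tensor M0 M1 (fun _ : 'I_n => 0) h0 (plateau_derive wd m) (CP m).
rewrite cutoff_lincomb.
have [s1 p1] := smooth_cst n (1 : R).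
rewrite (proj2 (smooth_lincomb 1 (-1) s1 (smooth_cut m))) p1 mul1r mulN1r.
apply: le_trans (ler_normB _ _) _; rewrite mulrDl; apply: lerD.
  case: s => [|i s] /=; first by rewrite normr1 cumprod0 mul1r mulVf // lt0r_neq0.
  by rewrite normr0 mulr_ge0 ?invr_ge0 ?(ltW (M0 _)) // ltW // mulr_gt0 // cumprod_gt0.
apply: le_trans (ub s t) _; rewrite -[leRHS]mulrA; apply: ler_wpM2l.
  by rewrite ltW // divr_gt0 // mulr_gt0 ?exprn_gt0.
by rewrite mulrA ler_wpM2r ?(ltW (M0 _)) // cumprod_cst.
Qed.

Lemma cutoff_zero m x : `|x| < m%:R - d -> cutoff m x = 0.
Proof.
move=> xm; rewrite /cut big1 ?subrr // => i _; rewrite addr0.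
by apply: (plateau_eq1 w0 w1); apply: le_trans (rV_norm_coord x i) (ltW xm).
Qed.

(** One power of decay is traded for smallness far from the origin. *)
Lemma cutoff_decays a b phi : Sspace c M N phi -> Rset c a -> Rset c b ->
  exists2 C, 0 <= C & forall m, d < m%:R ->
    cdecays M N (C / (m%:R - d)) a b (localize (cutoff m) phi).
Proof.
move=> Sp aR bR.
have [b' bR' [C3 C30 shift]] := shift_weight N0 N2 bR.
have aR' : Rset c (fun j => 2^-1 * a j) by apply: Rset_scale => //; rewrite invr_gt0.
have [C2 C20 cb] := cutoff_bound aR'.
have [[s1 s2] /(_ _ _ aR' bR') [C1 [d1 d2]]] := proj1 (SspaceP c M0 N0 _) Sp.
have pa := Rset_positive_increasing aR; have pa' := Rset_positive_increasing aR'.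
have pb := Rset_positive_increasing bR; have pb' := Rset_positive_increasing bR'.
have C10 : 0 <= C1 := decays_ge0 M0 N0 pa' pb' d1.
exists (C1 * C2 * M 0%N * C3).
  by rewrite !mulr_ge0 ?(ltW (M0 _)) ?(ltW C30).
move=> m dm; have md : 0 < m%:R - d by rewrite subr_gt0.
have main g : smooth g -> decays M N C1 (fun j => 2^-1 * a j) b' g ->
    decays M N (C1 * C2 * M 0%N * C3 / (m%:R - d)) a b (fun x => g x * cutoff m x).
  move=> sg dg s q t.
  have AM : 0 < cumprod a (size s) * M (size s) by rewrite mulr_gt0 // cumprod_gt0.
  have BN : 0 < cumprod b q * N q by rewrite mulr_gt0 // cumprod_gt0.
  have [tm|mt] := ltP `|t| (m%:R - d).
    rewrite (@pd_support _ _ _ _ s (@open_norm_lt R n (m%:R - d))) //.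
      rewrite normr0 mulr0 mulr_ge0 ?(ltW (mulr_gt0 AM BN)) // divr_ge0 ?(ltW md) //.
      by rewrite !mulr_ge0 ?(ltW (M0 _)) ?(ltW C30).
    by move=> x xm; rewrite cutoff_zero // mulr0.
  have t0 : 0 < `|t| by apply: lt_le_trans mt.
  pose K := C1 * (cumprod b' q.+1 * N q.+1) / `|t| ^+ q.+1.
  have K0 : 0 <= K.
    by rewrite divr_ge0 ?exprn_ge0 // mulr_ge0 // ltW // mulr_gt0 // cumprod_gt0.
  have gK s' : `|pd s' g t| <= K * (cumprod (fun j => 2^-1 * a j) (size s') * M (size s')).
    rewrite /K mulrAC ler_pdivlMr ?exprn_gt0 // mulrC.
    apply: le_trans (dg s' q.+1 t) _.
    by apply: le_of_eq; ring.
  have := leibniz_weight M0 M1 s pa' sg (smooth_cutoff m) K0 C20 gK (fun s' => cb m s' t).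
  rewrite half_twice => /(ler_wpM2l (exprn_ge0 q (normr_ge0 t))) /le_trans; apply.
  apply: le_trans (_ : C1 * C2 * M 0%N * (cumprod b' q.+1 * N q.+1) / `|t| *
      (cumprod a (size s) * M (size s)) <= _).
    apply: le_of_eq; rewrite /K exprS.
    have tq : `|t| ^+ q != 0 by rewrite lt0r_neq0 // exprn_gt0.
    by field; rewrite tq lt0r_neq0.
  apply: le_trans (_ : C1 * C2 * M 0%N * (C3 * (cumprod b q * N q)) / (m%:R - d) *
      (cumprod a (size s) * M (size s)) <= _); last first.
    by apply: le_of_eq; ring.
  have CM : 0 <= C1 * C2 * M 0%N by rewrite !mulr_ge0 // ltW.
  rewrite ler_wpM2r ?(ltW AM) //; apply: ler_pM.
  - by rewrite mulr_ge0 // ltW // mulr_gt0 // cumprod_gt0.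
  - by rewrite invr_ge0.
  - exact: ler_wpM2l.
  - by rewrite lef_pV2 ?posrE.
have Er := re_localize (cutoff m) phi; have Ei := im_localize (cutoff m) phi.
split; first by rewrite Er; exact: main s1 d1.
by rewrite Ei; exact: main s2 d2.
Qed.

Lemma localize_sum m phi :
  localize (cut w m) phi = fun x => \sum_(k : grid m) localize (piece w k) phi x.
Proof.
apply/funext => x; rewrite /localize -mulr_sumr -sum_pieces.
by rewrite -rmorph_sum.
Qed.

Lemma localize_split m phi :
  localize (cutoff m) phi = combine (-1) (localize (cut w m) phi) phi.
Proof.
apply/funext => x; rewrite /localize /combine rmorphB rmorphN1 rmorph1 mulN1r mulrBr mulr1.
by rewrite addrC.
Qed.

Lemma Sspace_localize_piece m (k : grid m) phi : Sspace c M N phi ->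
  Sspace c M N (localize (piece w k) phi).
Proof.
move=> Sp; rewrite -[localize _ _](reflection_involutive (center R k)).
have d1 : 0 <= 1 + d by rewrite addr_ge0.
apply: (test_function_Sspace M0 N0 N1 (center R k) d1).
exact: (local_part_test_function M0 N0 M1 d0 wd wb w0 w1 k Sp).
Qed.

(** The truncations of [phi] by [cut m] converge to [phi] for all the seminorms,
    and [f] evaluates each of them as a finite sum of convolutions. *)
Lemma dual_le_local_sums f phi C : dual c M N f -> Sspace c M N phi ->
  (forall m, \sum_(k : grid m) cabs (convolution f (local_part w k phi) (center R k)) <= C) ->
  cabs (f phi) <= C.
Proof.
move=> df Sp H; apply: le_of_forall_eps => e e0.
have Scut m : Sspace c M N (localize (cut w m) phi) /\
    f (localize (cut w m) phi) = \sum_(k : grid m) f (localize (piece w k) phi).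
  rewrite localize_sum.
  exact: (dual_sum M0 N0 (index_enum (grid m)) df (fun k => Sspace_localize_piece k Sp)).
have [k [a [b [C1 [ab C10 bd]]]]] := dual_bound M0 N0 df.
have ex j : exists D, 0 <= D /\ forall m, d < m%:R ->
    cdecays M N (D / (m%:R - d)) (a j) (b j) (localize (cutoff m) phi).
  by have [D D0 DP] := cutoff_decays Sp (proj1 (ab j)) (proj2 (ab j)); exists D.
have [D DP] := choice ex.
pose DD := \sum_j D j.
have DD0 : 0 <= DD by apply: sumr_ge0 => j _; case: (DP j).
pose m := Num.bound (`|d| + C1 * DD / e).
have mb : d + C1 * DD / e < m%:R.
  apply: le_lt_trans (archi_boundP _); last by rewrite addr_ge0 // divr_ge0 ?mulr_ge0 // ltW.
  by rewrite lerD2r ler_norm.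
have q0 : 0 <= C1 * DD / e by rewrite divr_ge0 ?mulr_ge0 // ltW.
have md : 0 < m%:R - d by lra.
have [Sm fm] := Scut m.
have Sr : Sspace c M N (localize (cutoff m) phi).
  by rewrite localize_split; exact: Sspace_combine.
have small : cabs (f (localize (cutoff m) phi)) <= e.
  apply: le_trans (bd _ (DD / (m%:R - d)) Sr _ _) _; first by rewrite divr_ge0 // ltW.
    move=> j; have [Dj DjP] := DP j.
    have dm : d < m%:R by lra.
    apply: cdecays_le (DjP m dm) => //.
    - exact: Rset_positive_increasing (proj1 (ab j)).
    - exact: Rset_positive_increasing (proj2 (ab j)).
    rewrite ler_wpM2r ?invr_ge0 ?(ltW md) // /DD (bigD1 j) //= lerDl sumr_ge0 // => i _.
    by case: (DP i).
  rewrite mulrA ler_pdivrMr // [leRHS]mulrC -ler_pdivrMr //; lra.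
have E : f phi = f (localize (cutoff m) phi) + f (localize (cut w m) phi).
  by rewrite localize_split (dual_combine (-1) df Sm Sp) rmorphN1 mulN1r addrAC addNr add0r.
rewrite E [C + e]addrC; apply: le_trans (cabsD _ _) _; apply: lerD => //.
rewrite fm; apply: le_trans (cabs_sum _ _ _) _; apply: le_trans (H m).
apply: ler_sum => k' _.
by rewrite /convolution -/(reflection _ _) /local_part reflection_involutive.
Qed.

Lemma convolution_scale f psi x h (r Y C : R) : dual c M N f -> 0 <= r ->
  test_function c M r psi -> 0 < Y -> cuniform_bound M Y (fun=> h) psi ->
  (forall psi', test_function c M r psi' -> cuniform_bound M 1 (fun=> h) psi' ->
     cabs (convolution f psi' x) <= C) ->
  cabs (convolution f psi x) <= C * Y.
Proof.
move=> df r0 tp Y0 ub H; have [sm _ _] := tp.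
have t0 := @test_function0 R n c M r.
have tc := test_function_combine Y^-1 tp t0.
have := cuniform_combine Y^-1 sm (csmooth0 R n) ub (cuniform0 n M (fun=> h)).
rewrite addr0 gtr0_norm ?invr_gt0 // mulVf ?lt0r_neq0 // => /(H _ tc).
rewrite -[convolution f _ x]/(f (combine Y^-1 (reflection x psi) (fun=> 0))).
rewrite (dual_combine _ df); last 2 first.
- exact: test_function_Sspace tp.
- exact: Sspace0.
rewrite (dual_zero M0 N0 df) addr0 cabsM cabsr gtr0_norm ?invr_gt0 //.
by rewrite mulrC ler_pdivrMr.
Qed.

(** The weight [b] is chosen from [l] alone, before the constant [h]: in the
    Roumieu case, [h] comes from the bounded set and depends on [b]. *)
Lemma bounded_of_local_bounds l : Rset c l ->
  exists2 b, Rset c b & forall h CU (B : set (('rV[R]_n -> R[i]) -> R[i])),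
    0 < h -> 0 <= CU -> B `<=` dual c M N ->
    (forall f x psi, B f -> test_function c M (1 + d) psi ->
      cuniform_bound M 1 (fun=> 2 * h) psi ->
      cabs (convolution f psi x) <= CU * assoc_weight N l (euclid x)) ->
    forall C0, exists C, forall f phi, B f -> Sspace c M N phi ->
      cdecays M N C0 (fun=> h) b phi -> cabs (f phi) <= C.
Proof.
move=> lR; have pl := Rset_positive_increasing lR.
have d1 : 0 <= 1 + d by rewrite addr_ge0.
have [b bR [C C_0 CP]] := decay_at_center n M0 N0 N1 N2 lR d1.
have pb := Rset_positive_increasing bR.
exists b => // h CU B h0 CU0 Bd HU C0.
have ph := @positive_increasing_cst R h h0.
have [C2 C20 uk] := piece_bound n M0 M1 wd wb h0.
pose C0' := `|C0| + 1.
have C0'0 : 0 < C0' by rewrite ltr_wpDl.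
exists (CU * (C * C0' * C2 * M 0%N) * 5 ^+ n) => f phi Bf Sp cd.
have {}cd : cdecays M N C0' (fun=> h) b phi.
  apply: cdecays_le cd => //.
  by apply: le_trans (ler_norm _) _; rewrite lerDl.
have df := Bd f Bf; have [sm _] := proj1 (SspaceP c M0 N0 _) Sp.
apply: (dual_le_local_sums df Sp) => m.
(* the decay at the grid points cancels the weight in the bound for the
   convolutions and leaves the terms of [grid_sum_bound] *)
pose P (k : grid m) := \prod_i (1 + `|center R k 0 i|) ^+ 2.
pose W (k : grid m) := assoc_weight N l (euclid (center R k)).
have P0 k : 0 < P k by apply: prodr_gt0 => i _; rewrite exprn_gt0 // ltr_pwDl.
have W0 k : 0 < W k by apply: assoc_weight_gt0 => //; exact: euclid_ge0.
have term (k : grid m) : cabs (convolution f (local_part w k phi) (center R k)) <=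
    CU * (C * C0' * C2 * M 0%N) * (P k)^-1.
  pose Y := C * C0' / (W k * P k) * C2 * M 0%N.
  have Y1 : 0 < C * C0' / (W k * P k) by rewrite divr_gt0 ?mulr_gt0.
  have Y0 : 0 < Y by rewrite /Y mulr_gt0 // mulr_gt0.
  have ub : cuniform_bound M Y (fun=> 2 * h) (local_part w k phi).
    apply: (local_part_bound M0 M1 d0 wd wb w0 w1 ph sm (ltW Y1) (ltW C20) (uk m k)).
    move=> t ct s; have [c1 c2] := cd.
    by split; [exact: CP h0 c1 ct|exact: CP h0 c2 ct].
  have tl := local_part_test_function M0 N0 M1 d0 wd wb w0 w1 k Sp.
  apply: le_trans (convolution_scale df d1 tl Y0 ub (fun psi tp up => HU f (center R k) psi Bf tp up)) _.
  apply: le_of_eq; rewrite /Y -/(W k).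
  by field; rewrite (lt0r_neq0 (W0 k)) (lt0r_neq0 (P0 k)).
apply: le_trans (ler_sum _ (fun k _ => term k)) _.
rewrite -mulr_sumr ler_wpM2l //; last exact: grid_sum_bound.
by rewrite mulr_ge0 // !mulr_ge0 // ltW.
Qed.

End Sufficiency.

(** * From bounded sets to convolutions *)

Section ExtendedSuprema.
Variable R : realType.

Lemma ereal_sup_finiteP (S : set (\bar R)) :
  (ereal_sup S < +oo)%E <-> exists C : R, forall y, S y -> (y <= C%:E)%E.
Proof.
split=> [H|[C CP]]; last first.
  by apply: le_lt_trans (ltry C); apply: ge_ereal_sup => y; exact: CP.
have ub y : S y -> (y <= ereal_sup S)%E by exact: ereal_sup_ubound.
case E : (ereal_sup S) H ub => [r||] // _ ub; first by exists r.
by exists 0 => y /ub; rewrite leeNy_eq => /eqP ->; rewrite leNye.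
Qed.

End ExtendedSuprema.

Section Necessity.
Variables (R : realType) (n : nat) (M N : nat -> R).
Hypotheses (M0 : forall p, 0 < M p) (N0 : forall p, 0 < N p) (N1 : cond_M1star N).
Implicit Types (a b l : nat -> R) (phi psi : 'rV[R]_n -> R[i])
  (f : ('rV[R]_n -> R[i]) -> R[i]) (B : set (('rV[R]_n -> R[i]) -> R[i]))
  (x t : 'rV[R]_n) (C : R).

Local Notation W h := (assoc_weight N (fun=> h)).

Lemma dual_boundedP c B : dual_bounded c M N B <->
  forall K, Sbounded c M N K ->
    exists C, forall f phi, B f -> K phi -> cabs (f phi) <= C.
Proof.
split=> H K bK.
  have /ereal_sup_finiteP[C CP] := H K bK; exists C => f phi Bf Kp.
  rewrite -lee_fin; apply: le_trans (CP (dual_seminorm K f) _); last by exists f.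
  by apply: ereal_sup_ubound; exists phi.
have [C CP] := H K bK; apply/ereal_sup_finiteP; exists C => _ [f Bf <-].
by apply: ge_ereal_sup => _ [phi Kp <-]; rewrite lee_fin; exact: CP.
Qed.

Lemma weighted_sup_finiteP l B psi : positive_increasing l ->
  (ereal_sup [set y | exists (f : ('rV[R]_n -> R[i]) -> R[i]) (x : 'rV[R]_n),
     B f /\ y = expeR (- assoc_fun N l (euclid x))
                * (cabs (convolution f psi x))%:E] < +oo)%E <->
  exists C, forall f x, B f -> cabs (convolution f psi x) <= C * assoc_weight N l (euclid x).
Proof.
move=> pl; have W0 x := assoc_weight_gt0 N0 N1 pl (euclid_ge0 x).
split=> [/ereal_sup_finiteP[C CP]|[C CP]].
  exists C => f x Bf; have := CP _ (ex_intro _ f (ex_intro _ x (conj Bf erefl))).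
  rewrite (expeR_assoc_fun N0 N1 pl (euclid_ge0 x)) -EFinM lee_fin.
  by rewrite mulrC ler_pdivrMr.
apply/ereal_sup_finiteP; exists C => _ [f [x [Bf ->]]].
rewrite (expeR_assoc_fun N0 N1 pl (euclid_ge0 x)) -EFinM lee_fin.
by rewrite mulrC ler_pdivrMr // CP.
Qed.

Lemma assoc_weight_antitone a b (s : R) : positive_increasing a -> positive_increasing b ->
  0 <= s -> (forall p, cumprod a p <= cumprod b p) ->
  assoc_weight N b s <= assoc_weight N a s.
Proof.
move=> pa pb s0 ab; apply: assoc_weight_le => p.
apply: le_trans (assoc_weight_ge N0 N1 p pa s0).
rewrite /assoc_term ler_wpM2l ?mulr_ge0 ?exprn_ge0 ?(ltW (N0 0)) //.
by rewrite lef_pV2 ?posrE ?mulr_gt0 ?cumprod_gt0 // ler_wpM2r // ltW.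
Qed.

(** The weight at [`|x| + r] splits into a factor depending on the support and
    one depending on the translation. *)
Lemma convolution_bound_of_ball c B h D r C psi : 0 < h -> 0 <= D -> 0 <= r -> 0 < C ->
  B `<=` dual c M N ->
  (forall f phi, B f -> Sspace c M N phi -> cdecays M N 1 (fun=> h) (fun=> h) phi ->
     cabs (f phi) <= D) ->
  test_function c M r psi -> cuniform_bound M C (fun=> h) psi ->
  forall f x, B f ->
    cabs (convolution f psi x) <= D * (C * W h (2 * r) / N 0%N) * W h (2 * `|x|).
Proof.
move=> h0 D0 r0 C0 Bd HD tp ub f x Bf; have [sm sr _] := tp.
have ph := @positive_increasing_cst R h h0.
have W0 s : 0 <= s -> 0 < W h s by move=> s0; exact: assoc_weight_gt0 ph s0.
have xr : 0 <= `|x| + r by rewrite addr_ge0.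
have cd := cdecays_reflection M0 N0 N1 x ph ph sm sr r0 ub.
set Y := C * _ in cd.
have Y0 : 0 < Y by rewrite mulr_gt0 // divr_gt0 // W0.
have Sr := test_function_Sspace M0 N0 N1 x r0 tp.
have S0 := @Sspace0 R n c M N M0 N0.
have := cdecays_scale Y^-1 (csmooth_reflection x sm) cd.
rewrite gtr0_norm ?invr_gt0 // mulVf ?lt0r_neq0 // => cd1.
have := HD f _ Bf (Sspace_combine M0 N0 Y^-1 Sr S0) cd1.
rewrite (dual_combine Y^-1 (Bd f Bf) Sr S0) (dual_zero M0 N0 (Bd f Bf)) addr0.
rewrite cabsM cabsr gtr0_norm ?invr_gt0 // mulrC ler_pdivrMr //.
move=> /le_trans; apply; rewrite /Y.
have x2 : 0 <= 2 * `|x| by rewrite mulr_ge0.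
have r2 : 0 <= 2 * r by rewrite mulr_ge0.
have main : W h (`|x| + r) <= W h (2 * r) * W h (2 * `|x|).
  have [le|le] := leP r `|x|.
    apply: le_trans (_ : W h (2 * `|x|) <= _).
      by apply: assoc_weight_homo => //; lra.
    by rewrite ler_pMl ?W0 // assoc_weight_ge1.
  apply: le_trans (_ : W h (2 * r) <= _).
    by apply: assoc_weight_homo => //; lra.
  by rewrite ler_pMr ?W0 // assoc_weight_ge1.
apply: le_trans (_ : D * (C * (W h (2 * r) * W h (2 * `|x|) / N 0%N)) <= _).
  by rewrite ler_wpM2l // ler_wpM2l ?(ltW C0) // ler_wpM2r ?invr_ge0 ?(ltW (N0 _)).
by apply: le_of_eq; ring.
Qed.

(** Otherwise, functions [phi_k] in the balls of radius one for the
    constants [1 / k.+1] on which some [f_k] exceeds [k] form a bounded set,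
    because each seminorm is at most one on all but finitely many of them. *)
Lemma Beurling_equicontinuity B : dual_bounded Beurling M N B ->
  exists (k : nat), forall f phi, B f -> Sspace Beurling M N phi ->
    cdecays M N 1 (fun=> k.+1%:R^-1) (fun=> k.+1%:R^-1) phi -> cabs (f phi) <= k%:R.
Proof.
move=> /dual_boundedP Bb; apply: contrapT => nH.
have ex k : exists o : (('rV[R]_n -> R[i]) -> R[i]) * ('rV[R]_n -> R[i]),
    [/\ B o.1, Sspace Beurling M N o.2,
        cdecays M N 1 (fun=> k.+1%:R^-1) (fun=> k.+1%:R^-1) o.2 & k%:R < cabs (o.1 o.2)].
  apply: contrapT => /forallNP nE; apply: nH; exists k => f phi Bf Sp cd.
  by rewrite leNgt; apply/negP => lt; apply: (nE (f, phi)).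
have [z zP] := choice ex.
have [|C CP] := Bb [set (z k).2 | k in setT].
  apply/(SboundedP _ M0 N0); split=> [_ [k _ <-]|a b aR bR]; first by case: (zP k).
  have pa := Rset_positive_increasing aR; have pb := Rset_positive_increasing bR.
  have [al al0 aE] := aR; have [be be0 bE] := bR.
  have exC k : exists C, cdecays M N C a b (z k).2.
    by have [_ /(SspaceP _ M0 N0)[_ H] _ _] := zP k; exact: H.
  have [Ck CkP] := choice exC.
  pose m := Num.bound (al^-1 + be^-1).
  (* [(z k).2] is in the unit ball for [a] and [b] as soon as [k] is at least [m] *)
exists (1 + \sum_(k < m) `|Ck k|) => _ [k _ <-].
  have [km|mk] := ltnP k m.
    apply: cdecays_le (CkP k) => //; apply: le_trans (ler_norm _) _.
    rewrite (bigD1 (Ordinal km)) //= addrCA lerDl addr_ge0 //.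
    by apply: sumr_ge0.
  have [_ _ [c1 c2] _] := zP k.
  have mm : al^-1 + be^-1 <= k.+1%:R.
    apply: le_trans (ltW (archi_boundP _)) _; first by rewrite addr_ge0 ?invr_ge0 ?ltW.
    by rewrite ler_nat leqW.
  have ha : k.+1%:R^-1 <= al.
    rewrite -[leRHS]invrK lef_pV2 ?posrE ?invr_gt0 //; apply: le_trans mm.
    by rewrite lerDl invr_ge0 ltW.
  have hb : k.+1%:R^-1 <= be.
    rewrite -[leRHS]invrK lef_pV2 ?posrE ?invr_gt0 //; apply: le_trans mm.
    by rewrite lerDr invr_ge0 ltW.
  have S0 : 0 <= \sum_(k < m) `|Ck k| by apply: sumr_ge0.
  have key s q : 1 * (cumprod (fun=> k.+1%:R^-1) (size s) * M (size s) *
      (cumprod (fun=> k.+1%:R^-1) q * N q)) <=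
      (1 + \sum_(k < m) `|Ck k|) * (cumprod a (size (s : seq 'I_n)) * M (size s) * (cumprod b q * N q)).
    rewrite (eq_cumprod aE) (eq_cumprod bE) !cumprod_cst.
    apply: ler_pM => //; first by rewrite !mulr_ge0 ?exprn_ge0 ?invr_ge0 // ltW.
      by rewrite lerDl.
    apply: ler_pM; rewrite ?mulr_ge0 ?exprn_ge0 ?invr_ge0 ?(ltW (M0 _)) ?(ltW (N0 _)) //.
      by rewrite ler_wpM2r ?(ltW (M0 _)) // lerXn2r ?nnegrE ?invr_ge0 // ltW.
    by rewrite ler_wpM2r ?(ltW (N0 _)) // lerXn2r ?nnegrE ?invr_ge0 // ltW.
  by split=> s q t; [apply: le_trans (c1 s q t) _|apply: le_trans (c2 s q t) _]; exact: key.
pose k := Num.bound `|C|.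
have [Bk _ _ big] := zP k.
have := CP _ _ Bk (ex_intro2 _ _ k I erefl).
rewrite leNgt => /negP; apply; apply: le_lt_trans big.
by apply: le_trans (ler_norm C) (ltW (archi_boundP (normr_ge0 C))).
Qed.

Lemma Roumieu_ball_bounded h : 0 < h ->
  Sbounded Roumieu M N [set phi : 'rV[R]_n -> R[i] |
    Sspace Roumieu M N phi /\ cdecays M N 1 (fun=> h) (fun=> h) phi].
Proof.
move=> h0; apply/(SboundedP _ M0 N0); split=> [phi []//|a b aR bR].
have pa := Rset_positive_increasing aR; have pb := Rset_positive_increasing bR.
have [Ca Ca0 CaP] := Roumieu_dominates_powers aR h0.
have [Cb Cb0 CbP] := Roumieu_dominates_powers bR h0.
exists (Ca * Cb) => phi [_ [d1 d2]].
have key (s : seq 'I_n) q : 1 * (cumprod (fun=> h) (size s) * M (size s) *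
    (cumprod (fun=> h) q * N q)) <=
    Ca * Cb * (cumprod a (size s) * M (size s) * (cumprod b q * N q)).
  rewrite mul1r !cumprod_cst.
  apply: le_trans (_ : Ca * cumprod a (size s) * M (size s) * (Cb * cumprod b q * N q) <= _).
    apply: ler_pM; rewrite ?mulr_ge0 ?exprn_ge0 ?(ltW h0) ?(ltW (M0 _)) ?(ltW (N0 _)) //.
      by rewrite ler_wpM2r ?(ltW (M0 _)).
    by rewrite ler_wpM2r ?(ltW (N0 _)).
  by apply: le_of_eq; ring.
by split=> s q t; [apply: le_trans (d1 s q t) _|apply: le_trans (d2 s q t) _]; exact: key.
Qed.

End Necessity.

(** * A weight for the Roumieu case *)

Section RoumieuWeight.
Variables (R : realType) (N : nat -> R).
Hypotheses (N0 : forall p, 0 < N p) (N1 : cond_M1star N).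
Implicit Types (t : R) (h : nat).

Local Notation W h := (assoc_weight N (fun=> h)).

(** A constant [D] is absorbed by doubling the argument: terms of index [p]
    with [2 ^+ p >= D] gain enough from the doubling, and those of lower index
    are, for large [t], below one term of higher index. *)
Lemma assoc_weight_dilation (h D : R) : 0 < h ->
  exists T, forall t, T <= t -> D * W h (2 * t) <= W h (4 * t).
Proof.
move=> h0; have ph := @positive_increasing_cst R h h0.
have [P PD] : exists P, D <= 2 ^+ P.
  exists (Num.bound `|D|); apply: le_trans (ler_norm D) _.
  apply: le_trans (ltW (archi_boundP (normr_ge0 D))) _.
  by rewrite -natrX ler_nat ltnW // ltn_expl.
pose K := \sum_(p < P) `|D| * (h ^+ P * N P / (h ^+ p * N p)).
have K0 p : 0 <= `|D| * (h ^+ P * N P / (h ^+ p * N p)).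
  by rewrite mulr_ge0 // divr_ge0 // ltW // mulr_gt0 ?exprn_gt0.
have KS : 0 <= K by exact: sumr_ge0.
exists (1 + K) => t Tt; have t1 : 1 <= t by lra.
have t0 : 0 < t by lra.
have t2 : 0 < 2 * t by lra.
have t4 : 0 <= 4 * t by lra.
have [D0|D0] := leP D 0.
  apply: le_trans (_ : 0 <= _); last by apply: ltW; exact: assoc_weight_gt0.
  by rewrite mulr_le0_ge0 // ltW // assoc_weight_gt0 // ltW.
rewrite mulrC -ler_pdivlMr //; apply: assoc_weight_le => p; rewrite ler_pdivlMr // mulrC.
have [pP|Pp] := ltnP p P; last first.
  apply: le_trans (assoc_weight_ge N0 N1 p ph t4).
  rewrite (_ : 4 * t = 2 * (2 * t)); last by ring.
  have -> : assoc_term N (fun=> h) (2 * (2 * t)) p = 2 ^+ p * assoc_term N (fun=> h) (2 * t) p.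
    by rewrite /assoc_term exprMn !mulrA.
  rewrite ler_wpM2r //; first exact: assoc_term_ge0 (ltW t2).
  by apply: le_trans PD _; rewrite ler_eXn2l // ltr1n.
apply: le_trans (assoc_weight_ge N0 N1 P ph t4).
rewrite /assoc_term !cumprod_cst ler_pdivlMr ?mulr_gt0 ?exprn_gt0 //.
have Kp : D * (h ^+ P * N P / (h ^+ p * N p)) <= t.
  rewrite -{1}(gtr0_norm D0); apply: le_trans (_ : K <= _); last by lra.
  rewrite /K (bigD1 (Ordinal pP)) //= lerDl; exact: sumr_ge0.
rewrite (_ : D * _ * _ = N 0%N * (2 * t) ^+ p * (D * (h ^+ P * N P / (h ^+ p * N p)))); last first.
  by rewrite invfM; ring.
rewrite [leRHS]mulrC -mulrA ler_wpM2l ?(ltW (N0 _)) //.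
apply: le_trans (_ : (2 * t) ^+ p * (2 * t) <= _).
  by rewrite ler_wpM2l ?exprn_ge0 ?(ltW t2) //; lra.
rewrite -exprSr; apply: le_trans (_ : (2 * t) ^+ P <= _).
  by apply: ler_weXn2l => //; lra.
by rewrite lerXn2r ?nnegrE ?(ltW t2) //; lra.
Qed.

(** Let [T h] be where [assoc_weight_dilation] starts to absorb [D h]. For [t]
    between [T h] and [T h.+1], only the terms of [W h (4 * t)] of index at most
    some [P h] can exceed one, and they are below the terms for [l] if the product
    of [l] up to the index [p <= P h] is at most [(h / 4) ^+ p]. *)
Lemma Roumieu_weight (D : nat -> R) : exists2 l, Rset Roumieu l &
  forall h0, (1 <= h0)%N -> exists2 C, 0 <= C & forall t, 0 <= t ->
    exists2 h, (h0 <= h)%N & D h * W h%:R (2 * t) <= C * assoc_weight N l t.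
Proof.
have exT h : exists T, (1 <= h)%N -> forall t, T <= t -> D h * W h%:R (2 * t) <= W h%:R (4 * t).
  case: h => [|h]; first by exists 0.
  by have [T TP] := @assoc_weight_dilation h.+1%:R (D h.+1) (ltr0Sn _ _); exists T.
have [T0 T0P] := choice exT.
pose T h := Num.max (T0 h) h%:R.
have TP h : (1 <= h)%N -> forall t, T h <= t -> D h * W h%:R (2 * t) <= W h%:R (4 * t).
  by move=> h1 t; rewrite ge_max => /andP[+ _]; exact: T0P.
have T_ge h : h%:R <= T h by rewrite le_max lexx orbT.
have T_pos h : 0 <= T h by apply: le_trans (T_ge h).
have exP h : exists P, (1 <= h)%N -> forall p, (P <= p)%N ->
    assoc_term N (fun=> h%:R) (4 * T h.+1) p <= 1.
  case: h => [|h]; first by exists 0%N.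
  have /cvgrPdist_le /(_ 1 ltr01)[P _ PP] := assoc_term_cvg N0 N1
    (positive_increasing_cst (ltr0Sn R h)) (mulr_ge0 (ler0n R 4) (T_pos h.+2)).
  exists P => _ p Pp; have := PP p Pp; rewrite /= sub0r normrN.
  by apply: le_trans; exact: ler_norm.
have [P PP] := choice exP.
have [a aR aP] := slow_sequence R P.
have pa := Rset_positive_increasing aR.
have i4 : 0 < 4^-1 :> R by rewrite invr_gt0.
have lR : Rset Roumieu (fun j => 4^-1 * a j) by exact: Rset_scale.
exists (fun j => 4^-1 * a j) => // h0 h01.
have pl := Rset_positive_increasing lR.
pose C := 1 + `|D h0 * W h0%:R (2 * T h0)|.
exists C; first by rewrite addr_ge0.
move=> t t0.
have Wl1 : 1 <= assoc_weight N (fun j => 4^-1 * a j) t by exact: assoc_weight_ge1.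
have t4 : 0 <= 4 * t by rewrite mulr_ge0.
have phh h : (1 <= h)%N -> positive_increasing (fun=> h%:R : R).
  by move=> h1; apply: positive_increasing_cst; rewrite ltr0n.
have [tT|Tt] := ltP t (T h0).
  exists h0 => //; apply: le_trans (_ : C * 1 <= _); last first.
    by rewrite ler_wpM2l // addr_ge0.
  rewrite mulr1 /C; have [D0|D0] := leP (D h0) 0.
    apply: le_trans (_ : 0 <= _); last by rewrite addr_ge0.
    by rewrite mulr_le0_ge0 // ltW // assoc_weight_gt0 ?mulr_ge0 //; exact: phh.
  apply: le_trans (_ : D h0 * W h0%:R (2 * T h0) <= _).
    rewrite ler_wpM2l ?(ltW D0) //; apply: assoc_weight_homo => //; first exact: phh.
      by rewrite mulr_ge0.
    by rewrite ler_wpM2l // ltW.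
  by apply: le_trans (ler_norm _) _; rewrite lerDr.
have exh : exists h, (T h <= t) by exists h0.
have hub h : T h <= t -> (h <= Num.bound t)%N.
  move=> ht; rewrite -(ler_nat R); apply: le_trans (T_ge h) (le_trans ht _).
  by apply: ltW; exact: archi_boundP.
have [h Th hmax] := ex_maxnP exh hub.
have hh0 : (h0 <= h)%N by exact: hmax.
have h1 : (1 <= h)%N by apply: leq_trans hh0.
have tT : t < T h.+1.
  by rewrite ltNge; apply/negP => /hmax; rewrite ltnn.
exists h => //; apply: le_trans (TP h h1 t Th) _.
apply: le_trans (_ : 1 * assoc_weight N (fun j => 4^-1 * a j) t <= _); last first.
  by rewrite ler_wpM2r ?(le_trans ler01 Wl1) // /C lerDl.
rewrite mul1r -(assoc_weight_scale N0) //.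
apply: assoc_weight_le => p; have [pP|Pp] := leqP p (P h).
  apply: le_trans (assoc_weight_ge N0 N1 p pa t4).
  rewrite /assoc_term ler_wpM2l ?mulr_ge0 ?exprn_ge0 ?(ltW (N0 0)) //.
  rewrite lef_pV2 ?posrE ?mulr_gt0 ?cumprod_gt0 //; last exact: phh.
  by rewrite ler_wpM2r ?(ltW (N0 _)) // cumprod_cst aP.
apply: le_trans (assoc_weight_ge1 N0 N1 pa t4).
apply: le_trans (PP h h1 p (ltnW Pp)).
have cp := cumprod_gt0 p (phh h h1).
rewrite /assoc_term ler_wpM2r ?invr_ge0 ?(ltW (mulr_gt0 cp (N0 p))) //.
rewrite ler_wpM2r ?(ltW (N0 0)) // lerXn2r ?nnegrE ?mulr_ge0 //.
by rewrite ler_wpM2l // ltW.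
Qed.

End RoumieuWeight.

(** * The characterization of bounded sets *)

Section Characterization.
Variables (R : realType) (n : nat) (M N : nat -> R).
Hypotheses (M0 : forall p, 0 < M p) (N0 : forall p, 0 < N p) (N1 : cond_M1star N).
Implicit Types (a b l : nat -> R) (phi psi : 'rV[R]_n -> R[i])
  (f : ('rV[R]_n -> R[i]) -> R[i]) (B : set (('rV[R]_n -> R[i]) -> R[i]))
  (x t : 'rV[R]_n) (C : R).

Definition convolution_dominated c B l := forall psi, Dspace c M N psi ->
  exists C, forall f x, B f ->
    cabs (convolution f psi x) <= C * assoc_weight N l (euclid x).

Lemma Beurling_necessity B : B `<=` dual Beurling M N -> dual_bounded Beurling M N B ->
  exists2 l, Rset Beurling l & convolution_dominated Beurling B l.
Proof.
move=> Bd /(Beurling_equicontinuity M0 N0) [k kP].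
have h0 : 0 < k.+1%:R^-1 :> R by rewrite invr_gt0.
have ph := positive_increasing_cst h0.
have lR := Rset_scale (_ : 0 < 2^-1 :> R) (Rset_cst h0).
have i2 : 0 < 2^-1 :> R by rewrite invr_gt0.
exists (fun=> 2^-1 * k.+1%:R^-1); first exact: lR.
move=> psi /(DspaceP _ M0 N0 N1)[r r0 tp].
have [_ _ ub] := tp; have [C uC] := ub _ (Rset_cst h0).
have uC' : cuniform_bound M (`|C| + 1) (fun=> k.+1%:R^-1) psi.
  by apply: cuniform_le uC => //; apply: le_trans (ler_norm C) _; rewrite lerDl.
have C0 : 0 < `|C| + 1 by rewrite ltr_wpDl.
have H := convolution_bound_of_ball M0 N0 N1 h0 (ler0n R k) r0 C0 Bd kP tp uC'.
set K := k%:R * _ in H; exists K => f x Bf; apply: le_trans (H f x Bf) _.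
have W0 s : 0 <= s -> 0 < assoc_weight N (fun=> k.+1%:R^-1) s.
  by move=> s0; exact: assoc_weight_gt0.
have K0 : 0 <= K.
  by rewrite mulr_ge0 // divr_ge0 ?(ltW (N0 _)) // mulr_ge0 ?(ltW C0) // ltW // W0 // mulr_ge0.
rewrite ler_wpM2l // (assoc_weight_scale N0) //.
apply: assoc_weight_homo => //.
exact: norm_le_euclid.
Qed.

(** Membership in the test space only gives a bound for each weight; by
    [power_bound_of_Roumieu] one constant is enough. *)
Lemma test_function_power r psi : test_function Roumieu M r psi ->
  exists2 k, (1 <= k)%N & exists C, cuniform_bound M C (fun=> k%:R) psi.
Proof.
move=> [_ _ ub].
have [|k k1 [C CP]] := @power_bound_of_Roumieu R (seq 'I_n * 'rV[R]_n)%type setT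
  (fun o => size o.1)
  (fun o => Num.max `|pd o.1 (re psi) o.2| `|pd o.1 (im psi) o.2| / M (size o.1)).
  move=> a aR; have [C [u1 u2]] := ub a aR; exists C => -[s t] _ /=.
  by rewrite ler_pdivrMr // -mulrA ge_max u1 u2.
exists k => //; exists C; split=> s t; have := CP (s, t) I; rewrite /= ler_pdivrMr // -mulrA;
  rewrite cumprod_cst ge_max => /andP[] //.
Qed.

Lemma Roumieu_necessity B : B `<=` dual Roumieu M N -> dual_bounded Roumieu M N B ->
  exists2 l, Rset Roumieu l & convolution_dominated Roumieu B l.
Proof.
move=> Bd /dual_boundedP Bb.
have exD h : exists D, 0 <= D /\ ((1 <= h)%N -> forall f phi, B f -> Sspace Roumieu M N phi ->
    cdecays M N 1 (fun=> h%:R) (fun=> h%:R) phi -> cabs (f phi) <= D).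
  case: h => [|h]; first by exists 0.
  have [C CP] := Bb _ (Roumieu_ball_bounded n M0 N0 (ltr0Sn R h)).
  exists `|C|; split=> // _ f phi Bf Sp cd; apply: le_trans (ler_norm C).
  exact: CP.
have [D DP] := choice exD.
have [l lR lP] := Roumieu_weight N0 N1 D.
have pl := Rset_positive_increasing lR.
exists l => // psi /(DspaceP _ M0 N0 N1)[r r0 tp].
have [h0 h01 [C uC]] := test_function_power tp.
have C0 : 0 < `|C| + 1 by rewrite ltr_wpDl.
have r2 : 0 <= 2 * r by rewrite mulr_ge0.
have W1 : 0 < assoc_weight N (fun=> 1) (2 * r).
  by apply: assoc_weight_gt0 => //; exact: positive_increasing_cst.
have [C1 C10 C1P] := lP h0 h01.
pose K := (`|C| + 1) * assoc_weight N (fun=> 1) (2 * r) / N 0%N.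
have K0 : 0 <= K by rewrite divr_ge0 ?(ltW (N0 _)) // mulr_ge0 ?(ltW C0) // ltW.
exists (K * C1) => f x Bf.
have [h hh0 hP] := C1P `|x| (normr_ge0 x).
have h1 : (1 <= h)%N := leq_trans h01 hh0.
have hp : 0 < h%:R :> R by rewrite ltr0n.
have ph := positive_increasing_cst hp.
have [D0 {}DP] := DP h; have {}DP := DP h1.
have uC' : cuniform_bound M (`|C| + 1) (fun=> h%:R) psi.
  apply: cuniform_le (_ : C <= _) _ => //.
    by apply: le_trans (ler_norm C) _; rewrite lerDl.
  have [u1 u2] := uC.
  have C00 : 0 <= C := uniform_bound_ge0 M0 u1.
  rewrite -[C]mulr1; apply: cuniform_weight uC => // p.
  by rewrite !cumprod_cst mul1r lerXn2r ?nnegrE // ler_nat.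
have H := convolution_bound_of_ball M0 N0 N1 hp D0 r0 C0 Bd DP tp uC'.
apply: le_trans (H f x Bf) _.
have Wh : 0 < assoc_weight N (fun=> h%:R) (2 * `|x|).
  by apply: assoc_weight_gt0 => //; rewrite mulr_ge0.
apply: le_trans (_ : K * (D h * assoc_weight N (fun=> h%:R) (2 * `|x|)) <= _).
  rewrite [leRHS]mulrA [K * _]mulrC ler_wpM2r ?(ltW Wh) // ler_wpM2l //.
  rewrite /K ler_wpM2r ?invr_ge0 ?(ltW (N0 _)) // ler_wpM2l ?(ltW C0) //.
  apply: assoc_weight_antitone => // p.
  by rewrite !cumprod_cst lerXn2r ?nnegrE // ler1n.
rewrite -[leRHS]mulrA ler_wpM2l //; apply: le_trans hP _.
rewrite ler_wpM2l //; apply: assoc_weight_homo => //; exact: norm_le_euclid.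
Qed.

Hypotheses (M1 : cond_M1 M) (M3 : cond_M3' M) (N2 : cond_M2 N).

Lemma Beurling_sufficiency B l : B `<=` dual Beurling M N -> Rset Beurling l ->
  convolution_dominated Beurling B l -> dual_bounded Beurling M N B.
Proof.
move=> Bd lR HB; have [w [d [d0 wd wb w0 w1]]] := exists_ultradifferentiable_step M0 M3.
have d1 : 0 <= 1 + d by rewrite addr_ge0.
have pl := Rset_positive_increasing lR.
have [b bR bP] := bounded_of_local_bounds n M0 N0 N1 M1 N2 d0 wd wb w0 w1 lR.
have Wp x : 0 < assoc_weight N l (euclid x) by apply: assoc_weight_gt0 => //; exact: euclid_ge0.
have cof : cofinal_powers Beurling (fun k => k.+1%:R^-1 : R).
  split=> [k|k|a [al al0 aE]]; first by rewrite invr_gt0.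
    by rewrite lef_pV2 ?posrE // ler_nat.
  exists (Num.bound al^-1), 1; split=> // p; rewrite mul1r (eq_cumprod aE) cumprod_cst.
  rewrite lerXn2r ?nnegrE ?invr_ge0 ?(ltW al0) // -[leRHS]invrK lef_pV2 ?posrE ?invr_gt0 //.
  apply: le_trans (ltW (archi_boundP _)) _; first by rewrite invr_ge0 ltW.
  by rewrite ler_nat.
have [k [C CP]] := uniform_convolution_bound M0 N0 N1 Bd Wp cof d1 HB.
have h0 : 0 < k.+1%:R^-1 / 2 :> R by rewrite divr_gt0 // invr_gt0.
apply/dual_boundedP => K /(SboundedP _ M0 N0)[KS KB].
have [C0 C0P] := KB _ _ (Rset_cst h0) bR.
have [|C' C'P] := bP _ `|C| B h0 (normr_ge0 C) Bd _ C0.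
  move=> f x psi Bf tp; rewrite mulrC divfK ?pnatr_eq0 // => ub.
  apply: le_trans (CP f x psi Bf tp ub) _.
  by rewrite ler_wpM2r ?(ltW (Wp x)) // ler_norm.
by exists C' => f phi Bf Kp; apply: C'P => //; [exact: KS|exact: C0P].
Qed.

Lemma Roumieu_sufficiency B l : B `<=` dual Roumieu M N -> Rset Roumieu l ->
  convolution_dominated Roumieu B l -> dual_bounded Roumieu M N B.
Proof.
move=> Bd lR HB; have [w [d [d0 wd wb w0 w1]]] := exists_ultradifferentiable_step M0 M3.
have d1 : 0 <= 1 + d by rewrite addr_ge0.
have pl := Rset_positive_increasing lR.
have [b bR bP] := bounded_of_local_bounds n M0 N0 N1 M1 N2 d0 wd wb w0 w1 lR.
have pb := Rset_positive_increasing bR.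
have Wp x : 0 < assoc_weight N l (euclid x) by apply: assoc_weight_gt0 => //; exact: euclid_ge0.
apply/dual_boundedP => K /(SboundedP _ M0 N0)[KS KB].
have BN q : 0 < cumprod b q * N q by rewrite mulr_gt0 // cumprod_gt0.
have MBN p q : 0 < M p * (cumprod b q * N q) by rewrite mulr_gt0.
have [|k k1 [C0 C0P]] := @power_bound_of_Roumieu R
  (('rV[R]_n -> R[i]) * (seq 'I_n * nat * 'rV[R]_n))%type [set z | K z.1]
  (fun z => size z.2.1.1)
  (fun z => `|z.2.2| ^+ z.2.1.2 *
     Num.max `|pd z.2.1.1 (re z.1) z.2.2| `|pd z.2.1.1 (im z.1) z.2.2| /
     (M (size z.2.1.1) * (cumprod b z.2.1.2 * N z.2.1.2))).
  move=> a aR; have [C CP] := KB a b aR bR.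
  exists C => -[phi [[s q] t]] /= /CP[c1 c2].
  rewrite ler_pdivrMr ?MBN // -[leRHS]mulrA [X in C * X]mulrA.
  by rewrite maxEle; case: ifP => _; [exact: c2|exact: c1].
have k0 : 0 < k%:R :> R by rewrite ltr0n.
have cd phi : K phi -> cdecays M N C0 (fun=> k%:R) b phi.
  move=> Kp; split=> s q t; have := C0P (phi, ((s, q), t)) Kp;
    rewrite /= ler_pdivrMr ?MBN // -[leRHS]mulrA [X in C0 * X]mulrA cumprod_cst;
    apply: le_trans; rewrite ler_wpM2l ?exprn_ge0 // le_max lexx ?orbT //.
have h0 : 0 < 2 * k%:R :> R by rewrite mulr_gt0.
have cof : cofinal_powers Roumieu (fun=> 2 * k%:R : R).
  split=> // a aR; have [C C_0 CP] := Roumieu_dominates_powers aR h0.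
  by exists 0%N, C; split; [exact: ltW|].
have [_ [C CP]] := uniform_convolution_bound M0 N0 N1 Bd Wp cof d1 HB.
have [|C' C'P] := bP _ `|C| B k0 (normr_ge0 C) Bd _ C0.
  move=> f x psi Bf tp ub; apply: le_trans (CP f x psi Bf tp ub) _.
  by rewrite ler_wpM2r ?(ltW (Wp x)) // ler_norm.
by exists C' => f phi Bf Kp; apply: C'P => //; [exact: KS|exact: cd].
Qed.

End Characterization.

Theorem lemma3p5 (R : realType) (n : nat) (c : ucase) (M N : nat -> R)
    (hMN : standing c M N)
    (B : set (('rV[R]_n -> R[i]) -> R[i])) (hB : B `<=` dual c M N) :
  dual_bounded c M N B <->
  exists2 l : nat -> R, Rset c l &
    forall psi : 'rV[R]_n -> R[i], Dspace c M N psi ->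
      (ereal_sup [set y | exists (f : ('rV[R]_n -> R[i]) -> R[i]) (x : 'rV[R]_n),
         B f /\ y = expeR (- assoc_fun N l (euclid x))
                    * (cabs (convolution f psi x))%:E] < +oo)%E.
Proof.
have [M0 N0 [M1 _ M3] [N1 N2] _] := hMN.
suff [suf nec] : (forall l, Rset c l -> convolution_dominated M N c B l ->
    dual_bounded c M N B) /\
    (dual_bounded c M N B -> exists2 l, Rset c l & convolution_dominated M N c B l).
  split=> [/nec[l lR lP]|[l lR lP]].
    exists l => // psi /lP HC.
    exact: (proj2 (weighted_sup_finiteP N0 N1 B psi (Rset_positive_increasing lR)) HC).
  apply: (suf l lR) => psi /lP HC.
  exact: (proj1 (weighted_sup_finiteP N0 N1 B psi (Rset_positive_increasing lR)) HC).
case: c hMN hB => hMN hB; split.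
- by move=> l lR; exact: Beurling_sufficiency.
- exact: Beurling_necessity.
- by move=> l lR; exact: Roumieu_sufficiency.
- exact: Roumieu_necessity.
Qed.
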